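(* Let $m\in\mathbb N$, let $\mu$ be a Borel measure on $\mathbb R$ with compact support, let $w_1,\dots,w_m$ be non-negative weight functions, and put $d\mu_j=w_j\,d\mu$ for $j=1,\dots,m$. Assume that the system $\{\mu_j\}_{j=1}^m$ belongs to the multiple Nevai class. Let $\{\vec k_n\}_{n=0}^\infty\subset\mathbb Z_{\ge 0}^m$ be a path such that $|\vec k_n|=n$, $\vec k_{n+1}=\vec k_n+\vec e_{j_n}$ for some $j_n\in\{1,\dots,m\}$, and $\vec k_n/n\to\vec\nu$ as $n\to\infty$ for some $\vec\nu\in[0,1]^m$ with $|\vec \nu|=1$. For each $n$ let $x_1,\dots,x_n$ be random points distributed according to the Multiple Orthogonal Polynomial Ensemble with the $m$ weights $w_1,\dots,w_m$, measure $\mu$ and multiplicities $\vec k_n$. Let $a_j=a_j(\vec\nu)$ and $b_j=b_j(\vec\nu)$ be the limits of the nearest neighbor recurrence coefficients in the direction $\vec\nu$ given by the definition of the multiple Nevai class. Then for any polynomial $f$ with real coefficients, $$\sum_{j=1}^n f(x_j)-\mathbb E\Big[\sum_{j=1}^n f(x_j)\Big]\longrightarrow N\Big(0,\sum_{\ell=1}^\infty \ell f_\ell f_{-\ell}\Big)$$ in distribution as $n\to\infty$, where for $\ell\in\mathbb Z$ $$f_\ell=\frac1{2\pi i}\oint_\gamma f\Big(z+\sum_{j=1}^m\frac{a_j}{z-b_j}\Big)\frac{dz}{z^{\ell+1}}$$ and $\gamma$ is a simple closed contour with counter-clockwise orientation going around all the points $b_1,\dots,b_m$ and around the origin.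
   Context: Notation: $|\vec k|=k_1+\dots+k_m$ for a vector $\vec k=(k_1,\dots,k_m)$; $\vec e_1,\dots,\vec e_m$ is the standard basis of $\mathbb R^m$. $N(0,\sigma^2)$ is the normal law with mean $0$ and variance $\sigma^2$. Multiple orthogonal polynomials: given Borel measures $\mu_1,\dots,\mu_m$ on $\mathbb R$ (for which the integrals below exist) and $\vec k\in\mathbb Z_{\ge0}^m$, $p_{\vec k}$ denotes the monic polynomial of smallest possible degree such that $\int p_{\vec k}(x)x^l\,d\mu_j(x)=0$ for $l=0,\dots,k_j-1$ and $j=1,\dots,m$. The system is perfect if $\deg p_{\vec k}=|\vec k|$ for every $\vec k\in\mathbb Z_{\ge0}^m$. For a perfect system there are nearest neighbor recurrence coefficients $a_{\vec k,j}$, $b_{\vec k,j}$ such that $$xp_{\vec k}(x)=p_{\vec k+\vec e_\ell}(x)+b_{\vec k,\ell}\,p_{\vec k}(x)+\sum_{j=1}^m a_{\vec k,j}\,p_{\vec k-\vec e_j}(x)$$ for every $\vec k\in\mathbb Z_{\ge0}^m$ and every $1\le\ell\le m$ (with $a_{\vec k,j}=0$, and the corresponding term absent, when $k_j=0$). Multiple Nevai class: a perfect system is in the multiple Nevai class if for every $j\in\{1,\dots,m\}$ and every $\vec\nu\in[0,1]^m$ with $|\vec\nu|=1$ there exist $a_j(\vec\nu)$, $b_j(\vec\nu)$ such that $a_{\vec k,j}\to a_j(\vec\nu)$ and $b_{\vec k,j}\to b_j(\vec\nu)$ whenever $\vec k/|\vec k|\to\vec\nu$ as $|\vec k|\to\infty$.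 Multiple Orthogonal Polynomial Ensemble (MOPE): for $\vec k$ with $|\vec k|=n$, the probability measure on $\mathbb R^n$ $$\frac1{Z_{\vec k}}\det\big(x_i^{j-1}\big)_{i,j=1}^n\det\big(g_j(x_i)\big)_{i,j=1}^n\prod_{j=1}^n d\mu(x_j),$$ where $g_1,\dots,g_n$ are the functions $w_1(x),xw_1(x),\dots,x^{k_1-1}w_1(x),\dots,w_m(x),xw_m(x),\dots,x^{k_m-1}w_m(x)$ and $Z_{\vec k}$ is the normalizing constant. It is a standing assumption that this expression is non-negative, i.e. defines a probability measure. *)

(* Defs.v *)
From HB Require Import structures.
From mathcomp Require Import all_boot all_order all_algebra.
From mathcomp Require Import all_classical all_reals all_analysis.
From mathcomp Require Import complex.

Set Implicit Arguments.
Unset Strict Implicit.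
Unset Printing Implicit Defensive.

Import Order.TTheory GRing.Theory Num.Theory.
Import numFieldNormedType.Exports.

Local Open Scope classical_set_scope.
Local Open Scope ring_scope.
Local Open Scope complex_scope.

Definition msupport (R : realType) (mu : set R -> \bar R) : set R :=
  [set x | forall U : set R, open U -> U x -> (0 < mu U)%E].

Definition multi_index (m : nat) := {ffun 'I_m -> nat}.

Definition mi_norm (m : nat) (k : multi_index m) : nat := (\sum_(j < m) k j)%N.

Definition mi_incr (m : nat) (k : multi_index m) (l : 'I_m) : multi_index m :=
  [ffun j => (k j + (j == l))%N].

(* Truncated: [mi_decr k l = k] when [k l = 0]. *)
Definition mi_decr (m : nat) (k : multi_index m) (l : 'I_m) : multi_index m :=
  [ffun j => (k j - (j == l))%N].

Section MultipleOrthogonality.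
Context (R : realType) (m : nat).
Variable mus : 'I_m -> {measure set R -> \bar R}.
Implicit Types (k : multi_index m) (p q : {poly R}).

Definition has_moments : Prop :=
  forall (j : 'I_m) (l : nat), (mus j).-integrable setT (fun x => (x ^+ l)%:E).

Definition mop_orthogonal k p : Prop :=
  forall (j : 'I_m) (l : nat), (l < k j)%N ->
    (\int[mus j]_x (p.[x] * x ^+ l)%:E = 0)%E.

Definition is_mop k p : Prop :=
  [/\ p \is monic, mop_orthogonal k p &
      forall q, q \is monic -> mop_orthogonal k q -> (size p <= size q)%N].

(* When the moments exist, exactly one polynomial satisfies [is_mop k]: the
   orthogonality conditions are [mi_norm k] linear equations, and two solutions
   of the same minimal degree would have a difference of smaller degree. *)
Definition mop k : {poly R} := xget 0 [set p | is_mop k p].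

(* [size] is the degree plus one, and [size 0 = 0]. *)
Definition perfect : Prop := forall k, size (mop k) = (mi_norm k).+1.

(* The second conjunct makes the term in which [mi_decr] truncates vanish.
   In a perfect system the two conditions determine [a] and [b]. *)
Definition nn_recurrence (a b : multi_index m -> 'I_m -> R) : Prop :=
  (forall k l, 'X * mop k = mop (mi_incr k l) + b k l *: mop k
                            + \sum_(j < m) a k j *: mop (mi_decr k j)) /\
  (forall k j, k j = 0%N -> a k j = 0).

Definition unit_simplex (nu : 'I_m -> R) : Prop :=
  (forall j, 0 <= nu j <= 1) /\ \sum_(j < m) nu j = 1.

Definition directional_limit (c : multi_index m -> R) (nu : 'I_m -> R) (l : R)
    : Prop :=
  forall kk : nat -> multi_index m,
    (fun n => mi_norm (kk n)) @ \oo --> \oo ->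
    (forall j, (fun n => (kk n j)%:R / (mi_norm (kk n))%:R : R) @ \oo --> nu j) ->
    (fun n => c (kk n)) @ \oo --> l.

Definition multiple_nevai : Prop :=
  perfect /\
  exists a b : multi_index m -> 'I_m -> R, nn_recurrence a b /\
    forall (j : 'I_m) (nu : 'I_m -> R), unit_simplex nu ->
      (exists anu : R, directional_limit (a^~ j) nu anu) /\
      (exists bnu : R, directional_limit (b^~ j) nu bnu).

End MultipleOrthogonality.

Section TuplePower.
Context (R : realType).

Definition tuple_cons (n : nat) (y : R * n.-tuple R) : n.+1.-tuple R :=
  [the n.+1.-tuple R of y.1 :: y.2].

Lemma measurable_tuple_cons (n : nat) : measurable_fun setT (@tuple_cons n).
Proof. exact: measurable_cons. Qed.

(* [pushforward] is a measure only for measurable maps, hence the explicit instance. *)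
Definition mpower_step (n : nat)
    (mu : {sigma_finite_measure set R -> \bar R})
    (nun : {measure set (n.-tuple R) -> \bar R}) :
    {measure set (n.+1.-tuple R) -> \bar R} :=
  measure_function_pushforward__canonical__measure_function_Measure
    (mu \x^ nun)%E (@measurable_tuple_cons n).

Fixpoint mpower (mu : {sigma_finite_measure set R -> \bar R}) (n : nat) :
    {measure set (n.-tuple R) -> \bar R} :=
  match n with
  | 0 => dirac [tuple]
  | n'.+1 => mpower_step mu (mpower mu n')
  end.

End TuplePower.

Section Ensemble.
Context (R : realType) (m : nat).
Variables (mu : {sigma_finite_measure set R -> \bar R}) (w : 'I_m -> R -> R).

Definition mope_functions (k : multi_index m) (x : R) : seq R :=
  [seq x ^+ i * w l x | l <- enum 'I_m, i <- iota 0 (k l)].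

Definition mope_weight (k : multi_index m) (n : nat) (x : n.-tuple R) : R :=
  \det (\matrix_(i < n, j < n) tnth x i ^+ j) *
  \det (\matrix_(i < n, j < n) (mope_functions k (tnth x i))`_j).

Definition mope_const (k : multi_index m) (n : nat) : R :=
  \int[mpower mu n]_x mope_weight k x.

Definition mope_density (k : multi_index m) (n : nat) (x : n.-tuple R) : R :=
  (mope_const k n)^-1 * mope_weight k x.

(* Meaningful for [n = mi_norm k]. The weight itself may be non-positive, in
   which case [mope_const] is negative; only the quotient has to be
   non-negative. *)
Definition is_mope (k : multi_index m) (n : nat)
    (law : set (n.-tuple R) -> \bar R) : Prop :=
  [/\ (mpower mu n).-integrable setT (fun x => (mope_weight k x)%:E),
      mope_const k n != 0,
      {ae mpower mu n, forall x, 0 <= mope_density k x} &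
      forall A : set (n.-tuple R), measurable A ->
        law A = (\int[mpower mu n]_(x in A) (mope_density k x)%:E)%E].

End Ensemble.

(* The library's [normal_prob] takes the standard deviation, and for standard
   deviation 0 it is the uniform law on [0, 1] instead of a point mass. *)
Definition normal_law (R : realType) (mean var : R) :
    probability (measurableTypeR R) R :=
  if var == 0 then (\d_(mean : measurableTypeR R) : probability _ R)
  else (normal_prob mean (Num.sqrt var) : probability _ R).

Definition cvg_in_distribution (R : realType) (d : nat -> measure_display)
    (Omega : forall n, measurableType (d n))
    (P : forall n, probability (Omega n) R) (Y : forall n, Omega n -> R)
    (Q : probability (measurableTypeR R) R) : Prop :=
  forall h : R -> R, continuous h -> (exists M : R, forall x, `|h x| <= M) ->
    (fun n => 'E_(P n)[h \o Y n])%E @ \oo --> (\int[Q]_x (h x)%:E)%E.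

Section Contour.
Context (R : realType).
Implicit Types (g : R -> R[i]) (p : R[i]).

Definition C1_on (c d : R) (x : R -> R) : Prop :=
  {within `[c, d], continuous x} /\
  exists2 x' : R -> R, {within `[c, d], continuous x'} &
    forall t, t \in `]c, d[ -> is_derive t 1 x (x' t).

Definition piecewise_C1 g : Prop :=
  exists s : seq R, [/\ path <%R 0 s, last 0 s = 1 &
    forall i, (i < size s)%N ->
      C1_on (0 :: s)`_i s`_i (fun t => complex.Re (g t)) /\
      C1_on (0 :: s)`_i s`_i (fun t => complex.Im (g t))].

Definition simple_closed_contour g : Prop :=
  [/\ piecewise_C1 g, g 0 = g 1 &
      forall s t, s \in `[0, 1[ -> t \in `[0, 1[ -> g s = g t -> s = t].

Definition contour_derive g (t : R) : R[i] :=
  derive1 (fun s => complex.Re (g s)) t +i* derive1 (fun s => complex.Im (g s)) t.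

Definition contour_integral g (F : R[i] -> R[i]) : R[i] :=
  (\int[lebesgue_measure]_(t in `[0, 1]) complex.Re (F (g t) * contour_derive g t))
  +i*
  (\int[lebesgue_measure]_(t in `[0, 1]) complex.Im (F (g t) * contour_derive g t)).

Definition two_pi_i : R[i] := 0 +i* (2 * pi).

(* For a simple closed contour, winding number 1 says both that [p] lies inside
   and that the orientation is counter-clockwise. *)
Definition winds_once_around g p : Prop :=
  (forall t, t \in `[0, 1] -> g t != p) /\
  two_pi_i^-1 * contour_integral g (fun z => (z - p)^-1) = 1.

Definition laurent_coef (m : nat) (a b : 'I_m -> R) (f : {poly R}) g (l : int)
    : R[i] :=
  two_pi_i^-1 * contour_integral g (fun z =>
    (map_poly (real_complex R) f).[z + \sum_(j < m) (a j)%:C / (z - (b j)%:C)]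
    / z ^ (l + 1)).

End Contour.

(* Main.v *)
Require Import Defs.
From HB Require Import structures.
From mathcomp Require Import all_boot all_order all_algebra all_fingroup.
From mathcomp Require Import all_classical all_reals all_analysis.
From mathcomp Require Import complex measurable_realfun.
From mathcomp Require Import ring lra zify.

Set Implicit Arguments.
Unset Strict Implicit.
Unset Printing Implicit Defensive.

Import Order.TTheory GRing.Theory Num.Theory.
Import numFieldNormedType.Exports.

Local Open Scope classical_set_scope.
Local Open Scope ring_scope.
Local Open Scope complex_scope.

(** The proof computes all moments of the centered statistic and lets n tend to infinity.

    Fix n, let k = k_n, and choose monic polynomials e_0, e_1, ... with deg e_i = i such that
    e_r satisfies the orthogonality conditions of the multi-index k for every r >= n. In this
    basis multiplication by f is an infinite matrix A, banded below the diagonal, which is cut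
    at n into blocks A11, A12, A21, A22. Andreief's identity ([has_integral_Andreief]) and a
    Gram matrix computation ([det_gram_mul]) show that the exponential generating function of
    the moments of sum f(x_j) is det L(t), where (L(t), T(t)) is the upper block row of exp(tA)
    ([linear_stat_moments]). Put X = L^-1 T. Then

      X' = A12 + X A22 - A11 X - X A21 X,   L' = L (A11 + X A21),

    so that (log det L)' = tr (A11 + X A21) by Jacobi's formula ([block_exp_detS]). All of this
    is done with formal power series in t, that is, with sequences of coefficients. The constant
    term of the trace is the mean; removing it centers the statistic and does not change X
    ([riccati_shift], [centered_stat_moments]).

    Choose j0 with nu_j0 > 0 and let e_i, for i close to n, be the multiple orthogonal polynomial
    of index k_n + (i - n) e_j0. The nearest neighbor recurrence makes the entries of A near the
    position (n, n) converge to those of the Toeplitz matrix of a symbol phi: the Laurent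
    coefficients, around b_j0, of f(z + sum_j a_j / (z - b_j)) ([mul_path_cvg]). As A21 has
    finite rank, the trace of X A21 sees only the entries of X next to the corner, and these
    converge to the solution of the Riccati equation with Toeplitz coefficients ([riccati_cvg]).
    That solution is the flow [hankel_flow] driven by the coefficients phi_l with l <= 0
    alone: the identity [hankel_flow_shift] turns the contribution of the coefficients with
    l > 0 to the linear terms into the quadratic term. For this flow the trace is explicit: it
    is sum_l l phi_l phi_-l at first order in t and vanishes at every higher order
    ([hankel_flow_trace]). Hence the limit of log det L is quadratic in t, and the centered
    moments converge to those of a normal law ([moment_recursion_cvg]).

    Convergence of moments gives convergence in distribution without a compactness argument: a
    bounded continuous function is close, up to a multiple of y^2 / T^2, to a Bernstein
    polynomial in sin(y / T), that is, to a combination of sines, and a sine is close to its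
    Taylor polynomials ([moments_cvg_bounded]).

    The variance in the theorem is a sum of products of Laurent coefficients around 0 instead of
    b_j0. Both sums are the integral of F P', where P is the polynomial part of
    F(z) = f(z + sum_j a_j / (z - b_j)), which does not refer to a center
    ([laurent_pairing_center]). The only facts used about the contour are that it integrates
    (z - p)^k to 2 pi i or 0 according to whether k = -1. *)

(** * The Riccati flow of a Toeplitz matrix *)

(** Two ways of bracketing a triple Cauchy product. *)
Lemma sum_cauchy3 (V : nmodType) (F : nat -> nat -> nat -> V) (k : nat) :
  \sum_(i < k.+1) \sum_(s < (k - i).+1) F i s (k - i - s)%N =
  \sum_(r < k.+1) \sum_(i < r.+1) F i (r - i)%N (k - r)%N.
Proof.
rewrite -(big_mkord xpredT (fun i => \sum_(s < (k - i).+1) F i s (k - i - s)%N)).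
rewrite -(big_mkord xpredT (fun r => \sum_(i < r.+1) F i (r - i)%N (k - r)%N)).
transitivity (\sum_(0 <= i < k.+1) \sum_(0 <= r < k.+1 | (i <= r)%N)
                 F i (r - i)%N (k - r)%N).
  rewrite !big_nat; apply: eq_bigr => i /andP[_ ik].
  rewrite -(big_mkord xpredT (fun s => F i s (k - i - s)%N)).
  rewrite -(big_nat_widenl i 0 k.+1 xpredT) //.
  rewrite (big_addn 0 k.+1 i xpredT) subSn //.
  by apply: eq_bigr => s _; rewrite addnK subnDA subnAC.
rewrite (exchange_big_dep_nat xpredT) //=.
rewrite !big_nat; apply: eq_bigr => r /andP[_ rk].
rewrite -(big_mkord xpredT (fun i => F i (r - i)%N (k - r)%N)).
rewrite [RHS](big_nat_widen 0 r.+1 k.+1) //.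
Qed.

Section ToeplitzRiccati.
Variable R : numFieldType.

Section HankelFlow.
Variable beta : nat -> R.

(** The commutator-like expression H B - B^T H for the Toeplitz matrix B with symbol
    sum_l beta_l z^-l: the linear part of the limiting Riccati equation restricted to the
    coefficients of the symbol with nonpositive index. *)
Definition hankel_flow_step (H : nat -> nat -> R) (p q : nat) : R :=
  \sum_(l < q.+1) beta l * H p (q - l)%N - \sum_(l < p.+1) beta l * H (p - l)%N q.

(** Taylor coefficients in t of the solution of H' = [hankel_flow_step] H + (beta_(p+q+1)),
    H(0) = 0. The inhomogeneous term is the Hankel matrix of the symbol. *)
Fixpoint hankel_flow (k : nat) : nat -> nat -> R :=
  if k is k'.+1 then fun p q => (k%:R)^-1 *
    (hankel_flow_step (hankel_flow k') p q + (beta (p + q).+1) *+ (k' == 0)%N)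
  else fun _ _ => 0.
Arguments hankel_flow : simpl never.

Local Notation H := hankel_flow.
Local Notation step := hankel_flow_step.

Lemma hankel_flowS k p q :
  k.+1%:R * H k.+1 p q = step (H k) p q + beta (p + q).+1 *+ (k == 0)%N.
Proof. by rewrite {1}/hankel_flow mulrA divff ?mul1r // pnatr_eq0. Qed.

(** The failure of H(t) to be a Hankel matrix has rank one: with R = H(p,q+1) - H(p+1,q), both
    sides satisfy the same linear equation, since the boundary terms that the shifts of
    [hankel_flow_step] produce are those in the derivative of H(p,0) H(0,q). *)
Lemma hankel_flow_shift1 k p q :
  H k p q.+1 - H k p.+1 q = \sum_(i < k.+1) H i p 0 * H (k - i)%N 0 q.
Proof.
elim: k p q => [|k IH] p q; first by rewrite big_ord1 mul0r subrr.
have k0 : k.+1%:R != 0 :> R by rewrite pnatr_eq0.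
apply: (mulfI k0); rewrite mulrBr !hankel_flowS addnS addSn.
have -> : step (H k) p q.+1 + beta (p + q).+2 *+ (k == 0%N) -
    (step (H k) p.+1 q + beta (p + q).+2 *+ (k == 0%N)) =
    step (H k) p q.+1 - step (H k) p.+1 q by ring.
rewrite /step big_ord_recr /= subnn.
rewrite [X in _ - (_ - X)]big_ord_recr /= subnn.
have -> (a b c a' b' c' : R) : a + b - c - (a' - (b' + c')) =
   b + c' + ((a - a') - (c - b')) by ring.
rewrite -!sumrB.
have Eq (l : 'I_q.+1) : beta l * H k p (q.+1 - l)%N - beta l * H k p.+1 (q - l)%N =
    \sum_(i < k.+1) beta l * (H i p 0 * H (k - i)%N 0 (q - l)%N).
  by rewrite subSn -1?ltnS ?ltn_ord // -mulrBr (IH p (q - l)%N) mulr_sumr.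
have Ep (l : 'I_p.+1) : beta l * H k (p - l)%N q.+1 - beta l * H k (p.+1 - l)%N q =
    \sum_(i < k.+1) beta l * (H i (p - l)%N 0 * H (k - i)%N 0 q).
  by rewrite subSn -1?ltnS ?ltn_ord // -mulrBr (IH (p - l)%N q) mulr_sumr.
rewrite (eq_bigr _ (fun l _ => Eq l)) [X in _ + (_ - X)](eq_bigr _ (fun l _ => Ep l)).
rewrite exchange_big /= [X in _ + (_ - X)]exchange_big /= -sumrB.
transitivity (beta q.+1 * H k p 0 + beta p.+1 * H k 0 q +
  \sum_(i < k.+1) (((k - i).+1%:R * H (k - i).+1 0 q - beta q.+1 *+ (k - i == 0)%N)
     * H i p 0 + (i.+1%:R * H i.+1 p 0 - beta p.+1 *+ (i == 0 :> nat)) * H (k - i)%N 0 q)).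
  congr (_ + _); apply: eq_bigr => i _.
  rewrite !hankel_flowS /step !big_ord1 !subn0 add0n addn0 !addrK.
  have <- : \sum_(l < q.+1) beta l * H (k - i)%N 0%N (q - l)%N * H i p 0%N =
     \sum_(l < q.+1) beta l * (H i p 0%N * H (k - i)%N 0%N (q - l)%N).
    by apply: eq_bigr => l _; ring.
  have <- : \sum_(l < p.+1) beta l * H i (p - l)%N 0%N * H (k - i)%N 0%N q =
     \sum_(l < p.+1) beta l * (H i (p - l)%N 0%N * H (k - i)%N 0%N q).
    by apply: eq_bigr => l _; ring.
  by rewrite -!big_distrl /=; ring.
transitivity (\sum_(i < k.+1) ((k - i).+1%:R * (H i p 0 * H (k - i).+1 0 q))
   + \sum_(i < k.+1) (i.+1%:R * (H i.+1 p 0 * H (k - i)%N 0 q))).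
  rewrite -big_split /=.
  have E (i : 'I_k.+1) : ((k - i).+1%:R * H (k - i).+1 0 q -
      beta q.+1 *+ ((k - i)%N == 0%N)) * H i p 0 +
      (i.+1%:R * H i.+1 p 0 - beta p.+1 *+ (i == 0 :> nat)) * H (k - i)%N 0 q =
    ((k - i).+1%:R * (H i p 0 * H (k - i).+1 0 q)
      + i.+1%:R * (H i.+1 p 0 * H (k - i)%N 0 q)) +
    (- ((beta q.+1 * H i p 0) *+ (k - i == 0)%N)
     - (beta p.+1 * H (k - i)%N 0 q) *+ (i == 0 :> nat)).
    by case: (_ == _); case: (_ == _); rewrite ?mulr0n ?mulr1n; ring.
  rewrite (eq_bigr _ (fun i _ => E i)).
  (* The two correction terms are concentrated on i = k and i = 0,
    where they cancel beta_(q+1) and beta_(p+1). *)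
  rewrite big_split /= addrCA -[RHS]addr0; congr (_ + _).
  rewrite big_split /= !sumrN big_ord_recr [X in _ - X]big_ord_recl /= subnn subn0.
  rewrite !big1 ?eqxx ?mulr1n; first by ring.
  - by move=> i _; rewrite mulr0n.
  - by move=> i _; rewrite subn_eq0 leqNgt ltn_ord mulr0n.
have -> : \sum_(i < k.+1) ((k - i).+1%:R * (H i p 0%N * H (k - i).+1 0%N q)) =
   \sum_(i < k.+2) ((k.+1 - i)%:R * (H i p 0%N * H (k.+1 - i)%N 0%N q)).
  rewrite [RHS]big_ord_recr /= subnn mul0r addr0; apply: eq_bigr => i _.
  by rewrite subSn // -ltnS ltn_ord.
have -> : \sum_(i < k.+1) (i.+1%:R * (H i.+1 p 0%N * H (k - i)%N 0%N q)) =
   \sum_(i < k.+2) (i%:R * (H i p 0%N * H (k.+1 - i)%N 0%N q)).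
  by rewrite [RHS]big_ord_recl /= mul0r add0r.
rewrite -big_split big_distrr /=; apply: eq_bigr => i _.
by rewrite -mulrDl -natrD subnK // -ltnS ltn_ord.
Qed.

(** The shift by [l] is the sum of [l] unit shifts; the mixed products that arise are
    reassembled with [hankel_flow_shift1]. *)
Lemma hankel_flow_shift k l p q :
  H k p (q + l)%N - H k (p + l)%N q =
  \sum_(i < k.+1) \sum_(s < l) H i p s * H (k - i)%N (l - s.+1)%N q.
Proof.
elim: l k p q => [|l IH] k p q.
  by rewrite !addn0 subrr big1 // => i _; rewrite big_ord0.
have -> : H k p (q + l.+1)%N - H k (p + l.+1)%N q =
   (H k p (q.+1 + l)%N - H k (p + l)%N q.+1) +
   (H k (p + l)%N q.+1 - H k (p + l).+1 q) by rewrite !addnS !addSn; ring.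
rewrite IH hankel_flow_shift1 -big_split /=.
transitivity (\sum_(i < k.+1) (\sum_(s < l) H i p s * (H (k - i)%N (l - s)%N q) +
   (\sum_(s < l) H i p s * \sum_(j < (k - i).+1) H j (l - s.+1)%N 0 * H (k - i - j)%N 0 q
   + H i (p + l)%N 0%N * H (k - i)%N 0%N q))).
  apply: eq_bigr => i _; rewrite addrA -big_split /=; congr (_ + _).
  apply: eq_bigr => s _; rewrite -mulrDr -hankel_flow_shift1 subnSK //.
  by rewrite addrC subrK.
rewrite big_split /= [X in _ + X]big_split /=.
under [X in _ + (X + _)]eq_bigr => i _ do (under eq_bigr => s _ do rewrite big_distrr /=;
   rewrite exchange_big /=).
rewrite (sum_cauchy3 (fun i s j => \sum_(i0 < l) H i p i0 * (H s (l - i0.+1)%N 0%N * H j 0%N q))).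
rewrite -big_split -big_split /=; apply: eq_bigr => i _.
rewrite [RHS]big_ord_recr /= subnn; congr +%R.
rewrite (_ : H i p l = H i (p + l)%N 0 + (H i p (0 + l)%N - H i (p + l)%N 0)); last first.
  by rewrite add0n; ring.
rewrite IH mulrDl addrC; congr (_ + _); rewrite big_distrl /=; apply: eq_bigr => j _.
by rewrite big_distrl /=; apply: eq_bigr => s _; rewrite mulrA.
Qed.

(** Summed along an antidiagonal, the two halves of [hankel_flow_step] cancel, so only the
    inhomogeneous term survives and the flow stops after the first order. *)
Lemma hankel_flow_diag k s :
  \sum_(p < s.+1) H k p (s - p)%N = (if k == 1%N then s.+1%:R * beta s.+1 else 0).
Proof.
case: k => [|k]; first by rewrite big1.
have k0 : k.+1%:R != 0 :> R by rewrite pnatr_eq0.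
apply: (mulfI k0); rewrite big_distrr /=.
have E (p : 'I_s.+1) : k.+1%:R * H k.+1 p (s - p)%N =
    step (H k) p (s - p)%N + beta s.+1 *+ (k == 0)%N.
  by rewrite hankel_flowS subnKC // -ltnS ltn_ord.
rewrite (eq_bigr _ (fun p _ => E p)).
rewrite big_split /= sumrB.
rewrite (sum_cauchy3 (fun p l q => beta l * H k p q)).
have -> : \sum_(i < s.+1) \sum_(l < i.+1) beta l * H k (i - l)%N (s - i)%N =
   \sum_(r < s.+1) \sum_(i < r.+1) beta (r - i)%N * H k i (s - r)%N.
  apply: eq_bigr => i _; rewrite (reindex_inj rev_ord_inj) /=; apply: eq_bigr => l _.
  by rewrite subSS subKn // -ltnS ltn_ord.
rewrite subrr add0r sumr_const card_ord; case: k k0 {E} => [|k] _ /=.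
  by rewrite mul1r mulr_natl.
by rewrite mul0rn mulr0.
Qed.

End HankelFlow.

Section Limit.
Variables (phi : int -> R) (d : nat).
Hypothesis phi_band : forall l : nat, (d < l)%N -> phi l%:Z = 0.
Let beta (l : nat) := phi (- l%:Z).
Local Notation H := (hankel_flow beta).

(** Splits a row of the Toeplitz matrix at its diagonal. *)
Lemma sum_band_split (G : nat -> R) q :
  \sum_(r < (q + d).+1) G r * phi (r%:Z - q%:Z) =
  \sum_(l < q.+1) beta l * G (q - l)%N + \sum_(l < d) phi l.+1%:Z * G (q + l.+1)%N.
Proof.
rewrite -addSn big_split_ord /=; congr (_ + _).
  rewrite (reindex_inj rev_ord_inj) /=; apply: eq_bigr => l _.
  have lq : (l <= q)%N by rewrite -ltnS ltn_ord.
  rewrite mulrC subSS; congr (_ * _); rewrite /beta; congr phi.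
  by rewrite -subzn // addrAC subrr add0r.
apply: eq_bigr => l _; rewrite mulrC addSnnS; congr (_ * _); congr phi.
by rewrite PoszD addrAC subrr add0r.
Qed.

Lemma sum_band_square (G : nat -> nat -> R) :
  \sum_(q < d) \sum_(p < d) phi (q + p).+1%:Z * G p q =
  \sum_(l < d) phi l.+1%:Z * \sum_(s < l.+1) G (l - s)%N s.
Proof.
under [RHS]eq_bigr => l _ do rewrite big_distrr /=.
rewrite -(big_mkord xpredT (fun l => \sum_(s < l.+1) phi l.+1%:Z * G (l - s)%N s)).
rewrite -(big_mkord xpredT (fun q => \sum_(p < d) phi (q + p).+1%:Z * G p q)).
transitivity (\sum_(0 <= l < d) \sum_(0 <= s < d | (s <= l)%N) phi l.+1%:Z * G (l - s)%N s).
  rewrite (exchange_big_dep_nat xpredT) //= !big_nat; apply: eq_bigr => q /andP[_ qd].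
  rewrite -(big_nat_widenl q 0 d xpredT) // (big_addn 0 d q xpredT).
  under [RHS]eq_bigr do rewrite addnK addnC.
  rewrite -(big_mkord xpredT (fun p => phi (q + p).+1%:Z * G p q)).
  rewrite (big_cat_nat (leq0n (d - q)) (leq_subr q d)) /= [X in _ + X]big_nat [X in _
    + X]big1 ?addr0 //.
  by move=> p /andP[h _]; rewrite phi_band ?mul0r // ltnS -leq_subLR.
rewrite !big_nat; apply: eq_bigr => l /andP[_ ld].
rewrite -(big_mkord xpredT (fun s => phi l.+1%:Z * G (l - s)%N s)).
by rewrite (big_nat_widen 0 l.+1 d).
Qed.

(** The flow driven by the nonpositive part of the symbol solves the full Riccati equation: in
    the difference of the two linear terms, the coefficient phi_l with l > 0 multiplies
    H(p,q+l) - H(p+l,q), which by [hankel_flow_shift] is what the quadratic term contributes. *)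
Lemma hankel_flow_riccati k p q :
  k.+1%:R * H k.+1 p q =
  phi (- (p + q).+1%:Z) *+ (k == 0)%N
  + \sum_(r < (q + d).+1) H k p r * phi (r%:Z - q%:Z)
  - \sum_(r < (p + d).+1) H k r q * phi (r%:Z - p%:Z)
  - \sum_(i < k.+1) \sum_(r < d) \sum_(s < d)
       phi (r + s).+1%:Z * (H i p r * H (k - i)%N s q).
Proof.
rewrite hankel_flowS /hankel_flow_step !sum_band_split.
have E (i : 'I_k.+1) :
    \sum_(r < d) \sum_(s < d) phi (r + s).+1%:Z * (H i p r * H (k - i)%N s q) =
    \sum_(l < d) phi l.+1%:Z * \sum_(s < l.+1) H i p s * H (k - i)%N (l - s)%N q.
  exact: (sum_band_square (fun s r => H i p r * H (k - i)%N s q)).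
rewrite [X in _ = _ - X](eq_bigr _ (fun i _ => E i)).
rewrite [X in _ = _ - X]exchange_big /=.
under [X in _ = _ - X]eq_bigr => l _ do rewrite -big_distrr /= -hankel_flow_shift mulrBr.
rewrite (sum_band_split (fun r => H k r q) p) sumrB /beta; ring.
Qed.

(** Vanishing for k >= 2 is the reason why all cumulants from the third on disappear in the
    limit. *)
Lemma hankel_flow_trace k :
  \sum_(r < d) \sum_(s < d) phi (r + s).+1%:Z * H k s r =
  (if k == 1%N then \sum_(l < d) l.+1%:R * phi l.+1%:Z * phi (- l.+1%:Z) else 0).
Proof.
rewrite sum_band_square.
have E (l : 'I_d) : \sum_(s < l.+1) H k (l - s)%N s =
   (if k == 1%N then l.+1%:R * beta l.+1 else 0).
  rewrite -hankel_flow_diag [RHS](reindex_inj rev_ord_inj) /=.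
  by apply: eq_bigr => s _; rewrite subSS subKn // -ltnS ltn_ord.
under eq_bigr => l _ do rewrite E.
case: ifP => _; last by rewrite big1 // => l _; rewrite mulr0.
by apply: eq_bigr => l _; rewrite mulrCA mulrA.
Qed.

End Limit.
End ToeplitzRiccati.

(** * Determinant of a corner block of a matrix exponential *)

Section StrongRec.
Variables (T : Type) (x0 : T) (F : nat -> (nat -> T) -> T).

(** Course-of-values recursion: [F k g] may use [g 0], ..., [g k]. The table is copied at each
    step, and [strong_rec] reads its last entry. *)
Fixpoint strong_rec_upto (k : nat) : nat -> T :=
  if k is k'.+1 then
    let g := strong_rec_upto k' in fun i => if (i <= k')%N then g i else F k' g
  else fun=> x0.

Definition strong_rec (k : nat) : T := strong_rec_upto k k.

Hypothesis F_ext : forall k g h, (forall i, (i <= k)%N -> g i = h i) -> F k g = F k h.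

Lemma strong_recS k : strong_rec k.+1 = F k strong_rec.
Proof.
have st j i : (i <= j)%N -> strong_rec_upto j i = strong_rec i.
  elim: j i => [|j IH] i; first by rewrite leqn0 => /eqP ->.
  rewrite leq_eqVlt => /predU1P[-> //|]; rewrite ltnS => ij.
  by rewrite /= ij IH.
by rewrite {1}/strong_rec /= ltnn; apply: F_ext => i; apply: st.
Qed.
End StrongRec.

Section Jacobi.
Variable R : comNzRingType.

Lemma deriv_prod (I : finType) (F : I -> {poly R}) :
  (\prod_i F i)^`() = \sum_i (F i)^`() * \prod_(j | j != i) F j.
Proof.
have dP (s : seq I) : uniq s -> (\prod_(i <- s) F i)^`() =
    \sum_(i <- s) (F i)^`() * \prod_(j <- s | j != i) F j.
  elim: s => [|x s IH] /=; first by rewrite !big_nil derivC.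
  case/andP=> xs us; rewrite !big_cons derivM IH // eqxx /=; congr (_ * _ + _).
    rewrite [RHS]big_seq_cond [LHS]big_seq; apply: eq_bigl => j.
    by case: (boolP (j \in s)) => //= js; apply/esym; apply: contraNneq xs => <-.
  rewrite big_distrr /= !big_seq; apply: eq_bigr => i si.
  rewrite big_cons ifT; first by rewrite mulrCA.
  by apply: contraNneq xs => ->.
by rewrite dP // index_enum_uniq.
Qed.

(** Jacobi's formula. Differentiating the Leibniz expansion row by row gives one determinant
    per row, and expanding each along the differentiated row produces the cofactors. *)
Lemma deriv_det n (M : 'M[{poly R}]_n) :
  (\det M)^`() = \tr (map_mx (@deriv R) M *m \adj M).
Proof.
rewrite /mxtrace; under [RHS]eq_bigr => i _ do rewrite mxE.
pose N i := \matrix_(a, b) (if a == i then (M i b)^`() else M a b).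
transitivity (\sum_i \det (N i)).
  rewrite /determinant raddf_sum exchange_big /=; apply: eq_bigr => s _.
  have -> (e : bool) (p : {poly R}) : ((-1) ^+ e * p)^`() = (-1) ^+ e * p^`().
    by case: e; rewrite ?expr0 ?expr1 ?mul1r ?mulN1r ?derivN.
  rewrite deriv_prod big_distrr /=; apply: eq_bigr => i _; congr (_ * _).
  rewrite [RHS](bigD1 i) //= mxE eqxx; congr (_ * _).
  by apply: eq_bigr => j ji; rewrite mxE (negbTE ji).
apply: eq_bigr => i _; rewrite (expand_det_row _ i); apply: eq_bigr => j _.
rewrite !mxE eqxx; congr (_ * _); rewrite /cofactor; congr (_ * \det _).
by apply/matrixP => a b; rewrite !mxE eq_sym (negbTE (neq_lift _ _)).
Qed.
End Jacobi.

Section DetFlow.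
Variables (R : comNzRingType) (n : nat) (L Y : nat -> 'M[R]_n).
Hypothesis L0 : L 0 = 1%:M.
Hypothesis LS : forall k, k.+1%:R *: L k.+1 = \sum_(i < k.+1) L i *m Y (k - i)%N.

Definition mx_series (A : nat -> 'M[R]_n) (K : nat) : 'M[{poly R}]_n :=
  \matrix_(i, j) \poly_(k < K) A k i j.

(** Here L' = L Y and L(0) = 1 as power series in t, and [mx_series] truncates them; Jacobi's
    formula then reads (det L)' = det L tr Y. *)
Lemma det_flow0 K : (\det (mx_series L K.+1))`_0 = 1.
Proof.
rewrite -horner_coef0 -horner_evalE -det_map_mx -[RHS](det1 R n); congr (\det _).
by apply/matrixP => i j; rewrite mxE /= /horner_eval mxE horner_coef0 coef_poly ltn0Sn L0 mxE.
Qed.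

(** The truncated series satisfy M' = M Y modulo X^K only; the error is 'X^K times a matrix, so
    it does not reach the coefficients below K. *)
Lemma det_flowS K k : (k < K)%N ->
  k.+1%:R * (\det (mx_series L K.+1))`_k.+1 =
  \sum_(i < k.+1) (\det (mx_series L K.+1))`_i * \tr (Y (k - i)%N).
Proof.
move=> kK; set M := mx_series L K.+1.
pose YK := mx_series Y K.
pose Z := map_mx (@deriv R) M - M *m YK.
pose W := \matrix_(i, j) (drop_poly K (Z i j)).
have ZW : Z = 'X^K *: W.
  apply/matrixP => i j; rewrite [RHS]mxE [X in _ * X]mxE.
  rewrite -{1}(poly_take_drop K (Z i j)) mulrC -[RHS]add0r; congr (_ + _).
  apply/polyP => l; rewrite coef_take_poly coef0; case: ltnP => // lK.
  rewrite /Z !mxE coefB coef_deriv coef_poly ltnS lK coef_sum.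
  have := congr1 (fun A : 'M[R]_n => A i j) (LS l); rewrite mxE summxE mulr_natl => ->.
  under [X in _ - X]eq_bigr => r _ do rewrite coefM !mxE.
  rewrite [X in _ - X]exchange_big /= -sumrB big1 // => t _.
  rewrite mxE -sumrB big1 // => r _.
  have tl : (t <= l)%N by rewrite -ltnS.
  rewrite !coef_poly (leq_ltn_trans tl (leq_trans lK (leqnSn K))).
  by rewrite (leq_ltn_trans (leq_subr _ _) lK) subrr.
have dM : (\det M)^`() = \det M * \tr YK + 'X^K * \tr (W *m \adj M).
  rewrite deriv_det -[map_mx _ M](subrK (M *m YK)) -/Z ZW mulmxDl mxtraceD addrC.
  congr (_ + _); last by rewrite -scalemxAl mxtraceZ.
  rewrite mxtrace_mulC mulmxA mul_adj_mx mul_scalar_mx mxtraceZ //.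
have := congr1 (fun p : {poly R} => p`_k) dM.
rewrite coef_deriv coefD coefXnM kK addr0 mulr_natl => ->.
rewrite coefM; apply: eq_bigr => i _; congr (_ * _).
rewrite coef_sum; apply: eq_bigr => j _; rewrite mxE coef_poly.
by rewrite (leq_ltn_trans (leq_subr _ _) kK).
Qed.
End DetFlow.

Section Riccati.
Variables (R : numFieldType) (n d : nat).
Variables (A11 : 'M[R]_n) (A12 : nat -> 'cV[R]_n) (A21 : nat -> 'rV[R]_n).
Variable A22 : nat -> nat -> R.

(** Row (L, T) times A, divided by k + 1. The blocks A12, A21, A22 have infinitely many rows or
    columns, but column q of A22 has at most q + d + 1 entries and only d rows of A21 are
    nonzero, so that all sums are finite. *)
Definition block_exp_step (k : nat) (E : 'M[R]_n * (nat -> 'cV[R]_n)) :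
    'M[R]_n * (nat -> 'cV[R]_n) :=
  (k.+1%:R^-1 *: (E.1 *m A11 + \sum_(r < d) E.2 r *m A21 r),
   fun q => k.+1%:R^-1 *:
     (E.1 *m A12 q + \sum_(r < (q + d).+1) A22 r q *: E.2 r)).

Fixpoint block_exp (k : nat) : 'M[R]_n * (nat -> 'cV[R]_n) :=
  if k is k'.+1 then block_exp_step k' (block_exp k') else (1%:M, fun=> 0).

Local Notation L k := (block_exp k).1.
Local Notation T k := (block_exp k).2.

Definition riccati_step (k : nat) (X : nat -> nat -> 'cV[R]_n) (q : nat) : 'cV[R]_n :=
  k.+1%:R^-1 *: (A12 q *+ (k == 0)%N + \sum_(r < (q + d).+1) A22 r q *: X k r
    - A11 *m X k q
    - \sum_(i < k.+1) \sum_(r < d) X i r *m (A21 r *m X (k - i)%N q)).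

(** Taylor coefficients of X = L^-1 T, defined by the Riccati equation that X satisfies; that
    T = L X is [block_exp_factor]. *)
Definition riccati : nat -> nat -> 'cV[R]_n :=
  strong_rec (fun=> 0) riccati_step.

Local Notation X := riccati.

(** Taylor coefficients of the logarithmic derivative A11 + X A21 of L. *)
Definition riccati_gen (k : nat) : 'M[R]_n :=
  A11 *+ (k == 0)%N + \sum_(r < d) X k r *m A21 r.

Let nz k : k.+1%:R != 0 :> R. Proof. by rewrite pnatr_eq0. Qed.

Lemma riccati0 q : X 0 q = 0. Proof. by []. Qed.

Lemma riccatiS k q : k.+1%:R *: X k.+1 q =
  A12 q *+ (k == 0)%N + \sum_(r < (q + d).+1) A22 r q *: X k r
    - A11 *m X k q
    - \sum_(i < k.+1) \sum_(r < d) X i r *m (A21 r *m X (k - i)%N q).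
Proof.
rewrite {1}/riccati strong_recS => [|j g h gh].
  by rewrite /riccati_step scalerA divff // scale1r.
apply/boolp.funext => r; rewrite /riccati_step gh //; congr (_ *: (_ - _)).
apply: eq_bigr => i _; apply: eq_bigr => u _.
by rewrite !gh // ?leq_subr // -ltnS.
Qed.

Lemma block_expS1 k :
  k.+1%:R *: L k.+1 = L k *m A11 + \sum_(r < d) T k r *m A21 r.
Proof. by rewrite /= scalerA divff // scale1r. Qed.

Lemma block_expS2 k q :
  k.+1%:R *: T k.+1 q = L k *m A12 q + \sum_(r < (q + d).+1) A22 r q *: T k r.
Proof. by rewrite /= scalerA divff // scale1r. Qed.

(** Both sides solve the linear recursion of T: substituting the Riccati equation into the
    derivative of L X, the quadratic term cancels against the part of L' that contains T. *)
Lemma block_exp_factor k q : T k q = \sum_(i < k.+1) L i *m X (k - i)%N q.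
Proof.
elim/ltn_ind: k q => -[|k] IH q; first by rewrite big_ord1 mulmx0.
apply: (scalerI (nz k)); rewrite block_expS2 scaler_sumr.
transitivity (\sum_(i < k.+2) (i%:R *: (L i *m X (k.+1 - i)%N q)) +
    \sum_(i < k.+2) ((k.+1 - i)%:R *: (L i *m X (k.+1 - i)%N q))); last first.
  rewrite -big_split /=; apply: eq_bigr => i _.
  by rewrite -scalerDl -natrD subnKC // -ltnS.
rewrite [X in _ = X + _]big_ord_recl scale0r add0r [X in _ = _
  + X]big_ord_recr /= subnn scale0r addr0.
have E1 (i : 'I_k.+1) : i.+1%:R *: (L i.+1 *m X (k.+1 - i.+1)%N q) =
    L i *m (A11 *m X (k - i)%N q) +
    \sum_(s < i.+1) \sum_(r < d) L s *m (X (i - s)%N r *m (A21 r *m X (k - i)%N q)).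
  rewrite scalemxAl block_expS1 subSS mulmxDl mulmxA; congr (_ + _).
  rewrite mulmx_suml exchange_big /=; apply: eq_bigr => r _.
  rewrite IH // mulmx_suml mulmx_suml; apply: eq_bigr => s _.
  by rewrite -!mulmxA.
have E2 (i : 'I_k.+1) : (k.+1 - i)%:R *: (L i *m X (k.+1 - i)%N q) =
    L i *m A12 q *+ (k - i == 0)%N
     + \sum_(r < (q + d).+1) A22 r q *: (L i *m X (k - i)%N r)
     - L i *m (A11 *m X (k - i)%N q) -
    \sum_(s < (k - i).+1) \sum_(r < d) L i *m (X s r *m (A21 r *m X (k - i - s)%N q)).
  have ik : (i <= k)%N by rewrite -ltnS.
  rewrite subSn // scalemxAr riccatiS !mulmxBr mulmxDr (raddfMn (mulmx _)); congr (_ + _ - _ - _).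
  - by rewrite mulmx_sumr; apply: eq_bigr => r _; rewrite scalemxAr.
  - by rewrite mulmx_sumr; apply: eq_bigr => s _; rewrite mulmx_sumr.
rewrite (eq_bigr _ (fun i _ => E1 i)) (eq_bigr _ (fun i _ => E2 i)).
rewrite !sumrB !big_split /=.
rewrite -(sum_cauchy3 (fun s j i => \sum_(r < d) L s *m (X j r *m (A21 r *m X i q)))).
have -> (V : zmodType) (a b c e : V) : a + b + (c + e - a - b) = c + e.
  by rewrite -[c + e - a - b]addrA -opprD [LHS]addrC subrK.
congr (_ + _).
  rewrite big_ord_recr /= subnn mulr1n big1 ?add0r // => i _.
  by rewrite subn_eq0 leqNgt ltn_ord mulr0n.
rewrite exchange_big /=; apply: eq_bigr => r _.
by rewrite IH // scaler_sumr.
Qed.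

(** L' = L A11 + T A21 with T = L X. *)
Lemma block_exp_flow k :
  k.+1%:R *: L k.+1 = \sum_(i < k.+1) L i *m riccati_gen (k - i)%N.
Proof.
rewrite block_expS1 /riccati_gen.
under [RHS]eq_bigr => i _ do rewrite mulmxDr (raddfMn (mulmx _)) mulmx_sumr.
rewrite big_split /= [X in _ = X + _]big_ord_recr /= subnn mulr1n.
rewrite [X in _ = X + _ + _]big1 ?add0r => [|i _]; last by rewrite subn_eq0 leqNgt ltn_ord mulr0n.
congr (_ + _); rewrite exchange_big /=; apply: eq_bigr => r _.
rewrite block_exp_factor mulmx_suml; apply: eq_bigr => i _.
by rewrite mulmxA.
Qed.

Definition block_exp_det (K : nat) : {poly R} := \det (mx_series (fun k => L k) K.+1).

Lemma block_exp_det0 K : (block_exp_det K)`_0 = 1.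
Proof. by apply: (@det_flow0 _ _ (fun k => L k)). Qed.

Lemma block_exp_detS K k : (k < K)%N ->
  k.+1%:R * (block_exp_det K)`_k.+1 =
  \sum_(i < k.+1) (block_exp_det K)`_i * \tr (riccati_gen (k - i)%N).
Proof. by apply: det_flowS => // j; exact: block_exp_flow. Qed.

(** Each product X A21 is a column times a row, whose trace is the scalar product. *)
Lemma mxtrace_riccati_gen k :
  \tr (riccati_gen k) = \tr A11 *+ (k == 0)%N + \sum_(r < d) (A21 r *m X k r) 0 0.
Proof.
rewrite /riccati_gen mxtraceD raddf_sum /= raddfMn /=; congr (_ + _).
apply: eq_bigr => r _; rewrite mxtrace_mulC.
by rewrite /mxtrace big_ord1.
Qed.

End Riccati.
Opaque riccati.

(** * Passage to the limit in the Riccati flow *)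

Lemma cvg_sum_fin (R : realType) (I : finType) (f : I -> nat -> R) (l : I -> R) :
  (forall i, f i n @[n --> \oo] --> l i) ->
  \sum_i f i n @[n --> \oo] --> \sum_i l i.
Proof.
move=> fl; elim: (index_enum I) => [|i s IH].
  under eq_fun do rewrite big_nil; rewrite big_nil; exact: cvg_cst.
by under eq_fun do rewrite big_cons; rewrite big_cons; apply: cvgD.
Qed.

(** The sum is indexed from the end, because limits are taken at a fixed distance from the
    corner n of the matrix. *)
Lemma sum_tail (V : nmodType) (n M : nat) (G : nat -> V) : (M <= n)%N ->
  (forall j, (j + M < n)%N -> G j = 0) ->
  \sum_(j < n) G j = \sum_(r < M) G (n.-1 - r)%N.
Proof.
move=> Mn G0; rewrite (reindex_inj rev_ord_inj) /=.
rewrite -(big_mkord xpredT (fun i => G (n - i.+1)%N)).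
rewrite (big_cat_nat (leq0n M) Mn) /= [X in _ + X]big_nat [X in _ + X]big1 ?addr0.
  by rewrite big_mkord; apply: eq_bigr => i _; rewrite subnS -subn1 subnAC subn1.
by move=> i /andP[Mi ni]; apply: G0; lia.
Qed.

Lemma cvg_eventually_eq (R : realType) (N : nat) (f g : nat -> R) (l : R) :
  (forall n, (N <= n)%N -> f n = g n) -> f n @[n --> \oo] --> l ->
  g n @[n --> \oo] --> l.
Proof.
by move=> fg; apply: cvg_trans; apply: near_eq_cvg; exists N => // n /= /fg.
Qed.

(** The position of an entry counted from the bottom is an ordinal of a type depending on n;
    reading 0 outside the range makes it a sequence in n. *)
Definition col_at (R : nmodType) (n : nat) (v : 'cV[R]_n) (i : nat) : R :=
  if insub i is Some i' then v i' 0 else 0.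

Lemma col_at_ord (R : nmodType) n (v : 'cV[R]_n) (i : 'I_n) : col_at v i = v i 0.
Proof. by rewrite /col_at valK. Qed.

Section RiccatiLimit.
Variables (R : realType) (d : nat) (phi : int -> R) (alpha : nat -> nat -> nat -> R).
Hypothesis phi_band : forall l : nat, (d < l)%N -> phi l%:Z = 0.
Hypothesis alpha_band : forall n i j, (j + d < i)%N -> alpha n i j = 0.
Hypothesis alpha_cvg : forall s u v : nat,
  alpha n (n + u - s)%N (n + v - s)%N @[n --> \oo] --> phi (u%:Z - v%:Z).

Let A11 n : 'M[R]_n := \matrix_(i, j) alpha n i j.
Let A12 n (q : nat) : 'cV[R]_n := \col_i alpha n i (n + q)%N.
Let A21 n (r : nat) : 'rV[R]_n := \row_j alpha n (n + r)%N j.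
Let A22 n (r q : nat) : R := alpha n (n + r)%N (n + q)%N.
Definition block_riccati n := riccati d (A11 n) (A12 n) (A21 n) (A22 n).
Local Notation X := block_riccati.
Let beta (l : nat) := phi (- l%:Z).
Local Notation H := (hankel_flow beta).

Let xx n k p q := col_at (X n k q) (n.-1 - p)%N.

Let alpha_cvg11 p p' : alpha n (n.-1 - p)%N (n.-1 - p')%N @[n --> \oo] --> phi (p'%:Z - p%:Z).
Proof.
refine (cvg_eventually_eq (N := (p + p').+1) _ (@alpha_cvg (p + p').+1 p' p)) => n pn.
by congr alpha; lia.
Qed.

Let alpha_cvg12 p q : alpha n (n.-1 - p)%N (n + q)%N @[n --> \oo] --> phi (- (p + q).+1%:Z).
Proof.
have := @alpha_cvg p.+1 0 (p + q).+1; rewrite sub0r.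
by move=> h; refine (cvg_eventually_eq (N := p.+1) _ h) => n pn; congr alpha; lia.
Qed.

Let alpha_cvg21 r s : alpha n (n + r)%N (n.-1 - s)%N @[n --> \oo] --> phi (r + s).+1%:Z.
Proof.
have := @alpha_cvg s.+1 (r + s).+1 0; rewrite subr0.
by move=> h; refine (cvg_eventually_eq (N := s.+1) _ h) => n pn; congr alpha; lia.
Qed.

Let alpha_cvg22 r q : alpha n (n + r)%N (n + q)%N @[n --> \oo] --> phi (r%:Z - q%:Z).
Proof. by refine (cvg_eventually_eq (N := 0) _ (@alpha_cvg 0 r q)) => n _; rewrite !subn0. Qed.

(** A row of A in the first block column that vanishes except near the corner meets the column
    X only in its last M entries. *)
Let row_tail n (f : nat -> R) (v : 'cV[R]_n) M : (M <= n)%N ->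
  (forall j, (j + M < n)%N -> f j = 0) ->
  \sum_(j < n) f j * v j 0 = \sum_(r < M) f (n.-1 - r)%N * col_at v (n.-1 - r)%N.
Proof.
move=> Mn f0; rewrite -(sum_tail (G := fun j => f j * col_at v j)) //.
  by apply: eq_bigr => j _; rewrite col_at_ord.
by move=> j /f0 ->; rewrite mul0r.
Qed.

(** Near the corner every sum in the Riccati equation has a number of terms independent of n,
    thanks to the lower band width d. *)
Let xx_rec n k p q : (p + d < n)%N ->
  k.+1%:R * xx n k.+1 p q =
  alpha n (n.-1 - p)%N (n + q)%N *+ (k == 0)%N
  + \sum_(r < (q + d).+1) xx n k p r * alpha n (n + r)%N (n + q)%N
  - \sum_(r < (p + d).+1) xx n k r q * alpha n (n.-1 - p)%N (n.-1 - r)%N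
  - \sum_(i < k.+1) \sum_(r < d) \sum_(s < d)
       alpha n (n + r)%N (n.-1 - s)%N * (xx n i p r * xx n (k - i)%N s q).
Proof.
move=> pn; have pn' : (n.-1 - p < n)%N by lia.
pose u := Ordinal pn'.
have xu j r : xx n j p r = X n j r u 0 by rewrite /xx -[(n.-1 - p)%N]/(val u) col_at_ord.
have := congr1 (fun M : 'cV_n => M u 0) (riccatiS d (A11 n) (A12 n) (A21 n) (A22 n) k q).
rewrite xu -/(X n) mxE => ->.
have -> (a b c e : 'cV[R]_n) : (a + b - c - e) u 0 = a u 0 + b u 0 - c u 0 - e u 0.
  by rewrite !mxE.
congr (_ + _ - _ - _).
- by rewrite mulmxnE mxE.
- by rewrite summxE; apply: eq_bigr => r _; rewrite mxE mulrC xu.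
- have -> : (A11 n *m X n k q) u 0 = \sum_(j < n) alpha n u j * X n k q j 0.
    by rewrite mxE; apply: eq_bigr => j _; rewrite mxE.
  rewrite (@row_tail n (alpha n u) _ (p + d).+1) //.
    by apply: eq_bigr => r _; rewrite mulrC.
  by move=> j jn; apply: alpha_band => /=; lia.
- rewrite summxE; apply: eq_bigr => i _; rewrite summxE; apply: eq_bigr => r _.
  rewrite mxE big_ord1 -xu.
  have -> : (A21 n r *m X n (k - i)%N q) 0 0 =
      \sum_(j < n) alpha n (n + r)%N j * X n (k - i)%N q j 0.
    by rewrite mxE; apply: eq_bigr => j _; rewrite mxE.
  rewrite (@row_tail n (alpha n (n + r)%N) _ d); first 1 last.
  + by lia.
  + by move=> j jn; apply: alpha_band; lia.
  by rewrite mulr_sumr; apply: eq_bigr => s _; rewrite mulrCA.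
Qed.

(** Induction on the order k: each coefficient is a polynomial expression, of a size
    independent of n, in coefficients of lower order and entries of A near the corner. *)
Lemma riccati_cvg k p q : col_at (X n k q) (n.-1 - p)%N @[n --> \oo] --> H k p q.
Proof.
elim/ltn_ind: k p q => -[|k] IH p q.
  rewrite [H 0 p q]/(0 : R); refine (cvg_eventually_eq (N := 0) _ (cvg_cst (0 : R))) => n _.
  by rewrite /col_at /X riccati0; case: insubP => // i _ _; rewrite mxE.
have k0 : k.+1%:R != 0 :> R by rewrite pnatr_eq0.
(* The recursion determines (k + 1) times the coefficient. *)
suff : k.+1%:R * xx n k.+1 p q @[n --> \oo] --> k.+1%:R * H k.+1 p q.
  move/(@cvgMl_tmp _ _ _ _ _ k.+1%:R^-1); rewrite mulKf // => h.
  by refine (cvg_eventually_eq (N := 0) _ h) => n _; rewrite /= mulKf.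
rewrite (hankel_flow_riccati phi_band).
refine (cvg_eventually_eq (N := (p + d).+1) (f := fun n =>
  alpha n (n.-1 - p)%N (n + q)%N *+ (k == 0)%N
  + \sum_(r < (q + d).+1) xx n k p r * alpha n (n + r)%N (n + q)%N
  - \sum_(r < (p + d).+1) xx n k r q * alpha n (n.-1 - p)%N (n.-1 - r)%N
  - \sum_(i < k.+1) \sum_(r < d) \sum_(s < d)
       alpha n (n + r)%N (n.-1 - s)%N * (xx n i p r * xx n (k - i)%N s q)) _ _).
  by move=> n pn; rewrite xx_rec.
apply: cvgB; [apply: cvgB; [apply: cvgD|]|].
- by case: (k == 0%N); [exact: alpha_cvg12|exact: cvg_cst].
- apply: cvg_sum_fin => r.
  by apply: cvgM; [exact: IH|exact: alpha_cvg22].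
- apply: cvg_sum_fin => r.
  by apply: cvgM; [exact: IH|exact: alpha_cvg11].
- apply: cvg_sum_fin => i.
  apply: cvg_sum_fin => r.
  apply: cvg_sum_fin => s.
  apply: cvgM; [exact: alpha_cvg21|apply: cvgM; apply: IH => //].
  by case: i => i ik; rewrite /= ltnS leq_subr.
Qed.

Lemma riccati_gen_trace_cvg k :
  \tr (riccati_gen d (A11 n) (A12 n) (A21 n) (A22 n) k.+1) @[n --> \oo] -->
  (if k == 0%N then \sum_(l < d) l.+1%:R * phi l.+1%:Z * phi (- l.+1%:Z) else 0).
Proof.
rewrite -(hankel_flow_trace phi_band k.+1).
refine (cvg_eventually_eq (N := d) (f := fun n => \sum_(r < d) \sum_(s < d)
    alpha n (n + r)%N (n.-1 - s)%N * xx n k.+1 s r) _ _).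
  move=> n dn; rewrite mxtrace_riccati_gen mulr0n add0r; apply: eq_bigr => r _.
  rewrite mxE -(row_tail (f := alpha n (n + r)%N)) //.
    by apply: eq_bigr => j _; rewrite mxE.
  by move=> j jd; apply: alpha_band; lia.
apply: cvg_sum_fin => r.
apply: cvg_sum_fin => s.
by apply: cvgM; [exact: alpha_cvg21|exact: riccati_cvg].
Qed.
End RiccatiLimit.

(** * Densities and product integrals *)

Section Density.
Local Open Scope ereal_scope.
Context d (T : measurableType d) (R : realType).
Variables (mu nu : {measure set T -> \bar R}) (rho : T -> R).
Hypotheses (mrho : measurable_fun setT rho) (rho0 : forall x, (0 <= rho x)%R).
Hypothesis nuE : forall A, measurable A -> nu A = \int[mu]_(x in A) (rho x)%:E.

Import HBNNSimple.

(** Approximation of f from below by simple functions. *)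
Lemma ge0_integral_density (f : T -> \bar R) :
  measurable_fun setT f -> (forall x, 0 <= f x) ->
  \int[nu]_x f x = \int[mu]_x (f x * (rho x)%:E).
Proof.
move=> mf f0.
pose f_ := nnsfun_approx measurableT mf.
have f_cvg x : EFin \o f_^~ x @ \oo --> f x by exact: cvg_nnsfun_approx.
have mfr n : measurable_fun setT (fun x => (f_ n x)%:E * (rho x)%:E).
  by apply: emeasurable_funM; exact/measurable_EFinP.
transitivity (lim (\int[nu]_x (f_ n x)%:E @[n --> \oo])).
  rewrite -monotone_convergence//=.
  - by apply: eq_integral => x _; apply/esym/cvg_lim => //=; exact: f_cvg.
  - by move=> n; exact/measurable_EFinP.
  - by move=> n x _; rewrite lee_fin.
  - by move=> x _ i j ij; rewrite lee_fin; exact/lefP/nd_nnsfun_approx.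
rewrite [RHS](_ : _ = lim (\int[mu]_x ((f_ n x)%:E * (rho x)%:E) @[n --> \oo])); last first.
  rewrite -monotone_convergence//=.
  - apply: eq_integral => x _; apply/esym/cvg_lim => //=.
    by apply: cvgeZr; [ |exact: f_cvg].
  - by move=> n x _; rewrite -EFinM lee_fin mulr_ge0.
  - by move=> x _ i j ij; rewrite -!EFinM lee_fin ler_wpM2r //; exact/lefP/nd_nnsfun_approx.
apply: congr_lim; apply/funext => n /=.
have EFinf x : (f_ n x)%:E =
    \sum_(k \in range (f_ n)) k%:E * (\1_(f_ n @^-1` [set k]) x)%:E.
  by rewrite fsumEFin //= fimfunE.
under eq_integral do rewrite EFinf.
rewrite ge0_integral_fsum //=; last 2 first.
  - by move=> r; exact/measurable_EFinP/measurableT_comp.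
  - by move=> r x _; exact: nnfun_muleindic_ge0.
under [RHS]eq_integral => x _.
  rewrite EFinf ge0_mule_fsuml; last by move=> k; exact: nnfun_muleindic_ge0.
  over.
rewrite ge0_integral_fsum //=; last 2 first.
  - move=> r; apply: emeasurable_funM; last exact/measurable_EFinP.
    exact/measurable_EFinP/measurableT_comp.
  - by move=> r x _; rewrite mule_ge0 ?lee_fin //; exact: nnfun_muleindic_ge0.
apply: eq_fsbigr => k; rewrite inE => -[x _ <-].
rewrite ge0_integralZl//=; last 2 first.
  - exact/measurable_EFinP.
  - by rewrite lee_fin.
under [RHS]eq_integral do rewrite -muleA.
rewrite ge0_integralZl//=; last 3 first.
  - by apply: emeasurable_funM; exact/measurable_EFinP.
  - by move=> y _; rewrite -EFinM lee_fin mulr_ge0.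
  - by rewrite lee_fin.
rewrite integral_indic // setIT nuE; last exact: measurable_funPTI.
congr (_ * _); rewrite integral_mkcond /=; apply: eq_integral => y _.
rewrite patchE indicE; case: (_ \in _); by rewrite ?mul1e ?mul0e.
Qed.

Lemma integrable_density (f : T -> R) : measurable_fun setT f ->
  mu.-integrable setT (fun x => (f x * rho x)%:E) ->
  nu.-integrable setT (EFin \o f).
Proof.
move=> mf /integrableP[_ h]; apply/integrableP; split; first exact/measurable_EFinP.
rewrite ge0_integral_density //=.
  apply: le_lt_trans h; rewrite le_eqVlt; apply/orP; left; apply/eqP.
  by apply: eq_integral => x _; rewrite /= normrM (ger0_norm (rho0 x)).
by apply/measurable_EFinP; exact: measurableT_comp.
Qed.

Lemma integrable_densityP (f : T -> R) : measurable_fun setT f ->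
  nu.-integrable setT (EFin \o f) ->
  mu.-integrable setT (fun x => (f x * rho x)%:E).
Proof.
move=> mf /integrableP[_ h]; apply/integrableP; split.
  by apply/measurable_EFinP; exact: measurable_funM.
move: h; rewrite ge0_integral_density //=.
  apply: le_lt_trans; rewrite le_eqVlt; apply/orP; left; apply/eqP.
  by apply: eq_integral => x _; rewrite /= normrM (ger0_norm (rho0 x)).
by apply/measurable_EFinP; exact: measurableT_comp.
Qed.

Lemma integral_density (f : T -> R) : measurable_fun setT f ->
  \int[nu]_x (f x)%:E = \int[mu]_x (f x * rho x)%:E.
Proof.
move=> mf; rewrite integralE [RHS]integralE.
have mE : measurable_fun setT (EFin \o f) by exact/measurable_EFinP.
congr (_ - _); rewrite ge0_integral_density //.
- by apply: eq_integral => x _; rewrite !funeposE -!EFin_max -EFinM maxr_pMl // mul0r.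
- exact: measurable_funepos.
- apply: eq_integral => x _.
  by rewrite !funenegE -!EFinN -!EFin_max -EFinM maxr_pMl // mul0r mulNr.
- exact: measurable_funeneg.
Qed.
End Density.

Section ProductIntegral.
Local Open Scope ereal_scope.
Context d1 d2 (T1 : measurableType d1) (T2 : measurableType d2) (R : realType).
Variable m1 : {sigma_finite_measure set T1 -> \bar R}.
Variable m2 : {measure set T2 -> \bar R}.
Hypothesis sf2 : sigma_finite setT m2.

(** The product in the definition of [mpower] integrates the first measure of the sections over
    the second factor, which is a bare measure; its sigma-finiteness has to be carried along. *)
Lemma sigma_finite_product2 : sigma_finite setT (m1 \x^ m2).
Proof.
have [F FT Ffin] := sigma_finiteT m1.
have [G GT Gfin] := sf2.
exists (fun k => if unpickle k is Some (i, j) then F i `*` G j else set0).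
  apply/seteqP; split => // -[x y] _.
  have : setT x by []. rewrite FT => -[i _ Fi].
  have : setT y by []. rewrite GT => -[j _ Gj].
  by exists (pickle (i, j)) => //; rewrite pickleK.
move=> k; case: (unpickle k) => [[i j]|]; last by rewrite measure0.
have [mF fF] := Ffin i; have [mG fG] := Gfin j.
split; first exact: measurableX.
by rewrite product_measure2E // lte_mul_pinfty // ge0_fin_numE.
Qed.

(** Fubini's theorem for the product of two functions of one variable each. Uniqueness of the
    product measure transfers it to the product used by [mpower]. *)
Lemma integral_product2 (g : T1 -> R) (h : T2 -> R) :
  m1.-integrable setT (EFin \o g) -> m2.-integrable setT (EFin \o h) ->
  (m1 \x^ m2).-integrable setT (fun z => (g z.1 * h z.2)%:E) /\
  \int[m1 \x^ m2]_z (g z.1 * h z.2)%:E = \int[m1]_x (g x)%:E * \int[m2]_y (h y)%:E.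
Proof.
move=> ig ih.
(* Fubini is applied to m2 bundled with its sigma-finiteness. *)
pose sfm := isSFinite.Build _ _ _ (Measure.sort m2) (sfinite_measure_sigma_finite sf2).
pose sgm := isSigmaFinite.Build _ _ _ (Measure.sort m2) sf2.
pose m2' := HB.pack_for (SigmaFiniteMeasure.type T2 R) (Measure.sort m2) sfm sgm.
have mg : measurable_fun setT g by apply/measurable_EFinP; exact: measurable_int ig.
have mh : measurable_fun setT h by apply/measurable_EFinP; exact: measurable_int ih.
have mgh : measurable_fun setT (fun z : T1 * T2 => (g z.1 * h z.2)%:E).
  by apply/measurable_EFinP; apply: measurable_funM; exact: measurableT_comp.
have m12 A : measurable A -> A `<=` setT -> (m1 \x m2') A = (m1 \x^ m2) A.
  move=> mA _; apply: product_measure_unique => // B C mB mC.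
  exact: product_measure2E.
have ih' : \int[m2']_y `|h y|%:E < +oo by have /integrableP[] := ih.
have ig' : \int[m1]_x `|g x|%:E < +oo by have /integrableP[] := ig.
have i1 : (m1 \x m2').-integrable setT (fun z : T1 * T2 => (g z.1 * h z.2)%:E).
  apply/(integrable12ltyP m1 m2') => //=.
  under eq_integral => x _.
    under eq_integral => y _ do rewrite normrM EFinM.
    rewrite ge0_integralZl //=; last first.
      by apply/measurable_EFinP; exact: measurableT_comp.
    over.
  rewrite /= ge0_integralZr //=.
  - rewrite lte_mul_pinfty //; last by rewrite ge0_fin_numE // integral_ge0.
    by rewrite integral_ge0.
  - by apply/measurable_EFinP; exact: measurableT_comp.
  - by rewrite integral_ge0.
split.
  apply/integrableP; split => //.
  have /integrableP[_] := i1; rewrite (eq_measure_integral (m1 \x^ m2)%E) //.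
rewrite -(eq_measure_integral _ m12) -(integral12_prod_meas1 i1) /fubini_F /=.
under [LHS]eq_integral => x _.
  under eq_integral => y _ do rewrite EFinM.
  rewrite integralZl //; over.
have fh : \int[m2]_y (h y)%:E \is a fin_num by exact: (integrable_fin_num measurableT ih).
by rewrite /= -(fineK fh) integralZr.
Qed.
End ProductIntegral.

Section Mpower.
Variables (R : realType) (mu : {sigma_finite_measure set R -> \bar R}).

Lemma sigma_finite_mpower n : sigma_finite setT (mpower mu n).
Proof.
elim: n => [|n IH].
  by apply: fin_num_fun_sigma_finite; [rewrite measure0|exact: fin_num_measure].
have [F FT Ffin] := sigma_finite_product2 mu IH.
pose uncons (t : n.+1.-tuple R) : R * n.-tuple R := (thead t, [tuple of behead t]).
have unconsK : cancel (@tuple_cons R n) uncons.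
  by move=> [x t]; rewrite /uncons theadE; congr pair; apply: val_inj.
have muncons : measurable_fun setT uncons.
  apply/measurable_fun_pairP; split => /=.
    exact: measurable_tnth.
  apply/measurable_fun_tnthP => i /=.
  rewrite (_ : _ \o _ = (fun t : n.+1.-tuple R => tnth t (lift ord0 i))).
    exact: measurable_tnth.
  by apply/funext => t; rewrite /= /uncons /= !(tnth_nth 0) /= nth_behead.
exists (fun i => uncons @^-1` F i).
  by rewrite -preimage_bigcup -FT preimage_setT.
move=> i; have [mF fF] := Ffin i; split.
  by rewrite -[X in measurable X]setTI; exact: muncons.
rewrite /= /pushforward -comp_preimage.
by rewrite (_ : uncons \o _ = id) //; apply/funext => y /=; rewrite unconsK.
Qed.

Lemma integral_mpower_prod n (h : 'I_n -> R -> R) :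
  (forall i, mu.-integrable setT (EFin \o h i)) ->
  (mpower mu n).-integrable setT (fun x => (\prod_(i < n) h i (tnth x i))%:E) /\
  (\int[mpower mu n]_x (\prod_(i < n) h i (tnth x i))%:E =
   (\prod_(i < n) \int[mu]_x h i x)%:E)%E.
Proof.
elim: n h => [|n IH] h ih.
  split.
    apply: (eq_integrable measurableT (cst 1%E)) => //.
      by move=> x _; rewrite big_ord0.
    exact: finite_measure_integrable_cst.
  under eq_integral do rewrite big_ord0.
  by rewrite big_ord0 integral_cst //= diracT mule1.
have [iP eP] := IH (fun i => h (lift ord0 i)) (fun i => ih _).
have [iG eG] := integral_product2 (sigma_finite_mpower n) (ih ord0) iP.
have hE (z : R * n.-tuple R) : \prod_(i < n.+1) h i (tnth (tuple_cons z) i) =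
    h ord0 z.1 * \prod_(i < n) h (lift ord0 i) (tnth z.2 i).
  rewrite big_ord_recl; congr (h _ _ * _); apply: eq_bigr => i _.
  by rewrite !(tnth_nth 0).
have mH : measurable_fun setT (fun x : n.+1.-tuple R => (\prod_(i < n.+1) h i (tnth x i))%:E).
  apply/measurable_EFinP; apply: measurable_prod => i _.
  apply: (measurableT_comp (f := h i)); last exact: measurable_tnth.
  by apply/measurable_EFinP; exact: measurable_int (ih i).
have iH : ((mu \x^ mpower mu n)%E).-integrable setT
   ((fun x : n.+1.-tuple R => (\prod_(i < n.+1) h i (tnth x i))%:E) \o @tuple_cons R n).
  by apply: eq_integrable iG => // z _ /=; rewrite hE.
split.
  have := @integrable_pushforward _ _ _ _ R _ (@measurable_tuple_cons R n) _ setT _ mH iH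
    measurableT.
  exact.
rewrite /= integral_pushforward //=.
  under eq_integral => z _ do rewrite hE.
  rewrite eG eP big_ord_recl EFinM /Rintegral fineK //.
  - exact: (integrable_fin_num measurableT (ih ord0)).
  - exact: measurable_tuple_cons.
Qed.
End Mpower.

(** * Andreief identity *)

Section HasIntegral.
Context d (T : measurableType d) (R : realType) (mu : {measure set T -> \bar R}).
Implicit Types (f g : T -> R) (u v : R).

Definition has_integral f v :=
  mu.-integrable setT (EFin \o f) /\ \int[mu]_x f x = v.

Lemma has_integral_ext f g v : f =1 g -> has_integral f v -> has_integral g v.
Proof. by move=> /funext ->. Qed.

Lemma has_integralZ c f v : has_integral f v -> has_integral (fun x => c * f x) (c * v).
Proof.
move=> [fi <-]; split; last by rewrite RintegralZl.
have := integrableZl measurableT c fi.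
by apply: eq_integrable => // x _.
Qed.

Lemma has_integral_sum (I : Type) (s : seq I) (P : pred I) (f : I -> T -> R) (v : I -> R) :
  (forall i, P i -> has_integral (f i) (v i)) ->
  has_integral (fun x => \sum_(i <- s | P i) f i x) (\sum_(i <- s | P i) v i).
Proof.
move=> h; have iF : mu.-integrable setT (fun x => \sum_(i <- s | P i) (f i x)%:E)%E.
  by apply: integrable_sum => // i Pi; have [] := h i Pi.
split; first by apply: eq_integrable iF => // x _; rewrite /= sumEFin.
elim: s {iF} => [|i s IH].
  by under eq_Rintegral do rewrite big_nil; rewrite big_nil Rintegral_cst // mul0r.
under eq_Rintegral do rewrite big_cons; rewrite big_cons.
case: ifPn => // Pi; rewrite RintegralD //.
- by rewrite IH; have [_ ->] := h i Pi.
- by have [] := h i Pi.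
have : mu.-integrable setT (fun x => \sum_(i <- s | P i) (f i x)%:E)%E.
  by apply: integrable_sum => // k Pk; have [] := h k Pk.
by apply: eq_integrable => // x _; rewrite /= sumEFin.
Qed.
End HasIntegral.

Section AndreiefAlgebra.
Variable R : comNzRingType.

Lemma det_pair_expand n (A B : 'M[R]_n) (h : 'I_n -> R) :
  (\prod_i h i) * (\det A * \det B) =
  \sum_(s : 'S_n) \sum_(t : 'S_n) ((-1) ^+ s * (-1) ^+ t) *
    \prod_i (A i (s i) * B i (t i) * h i).
Proof.
rewrite /determinant mulrC big_distrl /= big_distrl /=; apply: eq_bigr => s _.
rewrite big_distrr /= big_distrl /=; apply: eq_bigr => t _.
by rewrite !big_split /= mulrACA -!mulrA.
Qed.

(** Every permutation s contributes the same determinant, after the rows are permuted. *)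
Lemma sum_perm_pair n (C : 'M[R]_n) :
  \sum_(s : 'S_n) \sum_(t : 'S_n) ((-1) ^+ s * (-1) ^+ t) * \prod_i C (s i) (t i) =
  (\det C) *+ n`!.
Proof.
transitivity (\sum_(s : 'S_n) \det C); last by rewrite sumr_const card_Sn.
apply: eq_bigr => s _.
under eq_bigr do rewrite -mulrA; rewrite -mulr_sumr.
have -> : \sum_(t : 'S_n) (-1) ^+ t * \prod_i C (s i) (t i) = \det (row_perm s C).
  by apply: eq_bigr => t _; congr (_ * _); apply: eq_bigr => i _; rewrite mxE.
by rewrite row_permE det_mulmx det_perm mulrA -expr2 sqrr_sign mul1r.
Qed.

Lemma coef_prod_poly n K (h : 'I_n -> nat -> R) k :
  (\prod_i \poly_(a < K) h i a)`_k =
  \sum_(kap : {ffun 'I_n -> 'I_K} | (\sum_i kap i)%N == k) \prod_i h i (kap i).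
Proof.
under eq_bigr do rewrite poly_def; rewrite bigA_distr_bigA /= coef_sum.
rewrite [RHS]big_mkcond; apply: eq_bigr => kap _.
under eq_bigr do rewrite -mul_polyC.
rewrite big_split /= -rmorph_prod -expr_sum mul_polyC coefZ coefXn.
by rewrite eq_sym; case: ifP; rewrite ?mulr1 ?mulr0.
Qed.
End AndreiefAlgebra.

Section Andreief.
Variables (R : realType) (mu : {sigma_finite_measure set R -> \bar R}).
Variables (n K : nat) (u g : 'I_n -> R -> R) (h : nat -> R -> R).
Variable c : nat -> 'I_n -> 'I_n -> R.
Hypothesis cE : forall k a b, (k < K)%N ->
  has_integral mu (fun x => u a x * g b x * h k x) (c k a b).

(** Andreief's identity for all coefficients of a generating function at once: both
    determinants are expanded, the integral factorizes over the coordinates, and the double sum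
    over permutations is n! times a determinant. *)
Lemma has_integral_Andreief k :
  has_integral (mpower mu n)
    (fun x => (\prod_i \poly_(a < K) h a (tnth x i))`_k *
       (\det (\matrix_(i, j) u j (tnth x i)) * \det (\matrix_(i, j) g j (tnth x i))))
    ((\det (\matrix_(i, j) \poly_(a < K) c a i j))`_k *+ n`!).
Proof.
have E x : (\prod_i \poly_(a < K) h a (tnth x i))`_k *
       (\det (\matrix_(i, j) u j (tnth x i)) * \det (\matrix_(i, j) g j (tnth x i))) =
   \sum_(kap : {ffun 'I_n -> 'I_K} | (\sum_i kap i)%N == k)
   \sum_(s : 'S_n) \sum_(t : 'S_n) ((-1) ^+ s * (-1) ^+ t) *
    \prod_i (u (s i) (tnth x i) * g (t i) (tnth x i) * h (kap i) (tnth x i)).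
  rewrite (coef_prod_poly _ (fun i a => h a (tnth x i))) mulr_suml.
  apply: eq_bigr => kap _; rewrite det_pair_expand.
  apply: eq_bigr => s _; apply: eq_bigr => t _; congr (_ * _).
  by apply: eq_bigr => i _; rewrite !mxE.
apply: has_integral_ext (fun x => esym (E x)) _.
have -> : (\det (\matrix_(i, j) \poly_(a < K) c a i j))`_k *+ n`! =
   \sum_(kap : {ffun 'I_n -> 'I_K} | (\sum_i kap i)%N == k)
   \sum_(s : 'S_n) \sum_(t : 'S_n) ((-1) ^+ s * (-1) ^+ t) *
    \prod_i c (kap i) (s i) (t i).
  rewrite -coefMn -sum_perm_pair coef_sum exchange_big /=; apply: eq_bigr => s _.
  rewrite coef_sum exchange_big /=; apply: eq_bigr => t _.
  rewrite -signr_addb -mulr_sumr.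
  have -> (e : bool) (p : {poly R}) : ((-1) ^+ e * p)`_k = (-1) ^+ e * p`_k.
    by case: e; rewrite ?expr0 ?expr1 ?mul1r ?mulN1r ?coefN.
  rewrite -(coef_prod_poly _ (fun i a => c a (s i) (t i))) signr_addb.
  by congr (_ * (polyseq _)`_k); apply: eq_bigr => i _; rewrite mxE.
apply: has_integral_sum => kap _; apply: has_integral_sum => s _.
apply: has_integral_sum => t _; apply: has_integralZ.
have := @integral_mpower_prod R mu n
  (fun i x => u (s i) x * g (t i) x * h (kap i) x) (fun i => (cE _ _ (ltn_ord (kap i))).1).
move=> [iP eP]; split => //; rewrite /Rintegral eP /=.
by apply: eq_bigr => i _; have [_ ->] := cE (s i) (t i) (ltn_ord (kap i)).
Qed.
End Andreief.

(** exp(t s_1) ... exp(t s_n) = exp(t (s_1 + ... + s_n)) for exponentials truncated at order K. *)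
Lemma coef_prod_exp (F : numFieldType) (I : Type) (r : seq I) (s : I -> F) K k : (k < K)%N ->
  (\prod_(i <- r) \poly_(a < K) (s i ^+ a / a`!%:R))`_k =
  (\sum_(i <- r) s i) ^+ k / k`!%:R.
Proof.
elim: r k => [|i r IH] k kK.
  rewrite !big_nil coef1 expr0n; case: k {kK} => [|k] /=.
    by rewrite fact0 divr1.
  by rewrite mul0r.
rewrite !big_cons coefM addrC exprDn mulr_suml; apply: eq_bigr => a _.
have ak : (a <= k)%N by rewrite -ltnS.
rewrite coef_poly (leq_ltn_trans ak kK) IH ?(leq_ltn_trans (leq_subr _ _) kK) //.
rewrite -(bin_fact ak) !natrM -mulr_natr.
have n0 (b : nat) : b`!%:R != 0 :> F by rewrite pnatr_eq0 -lt0n fact_gt0.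
have b0 : 'C(k, a)%:R != 0 :> F by rewrite pnatr_eq0 -lt0n bin_gt0.
by field; rewrite !n0 b0.
Qed.

(** * Multiplication operators in a basis of monic polynomials *)

Section Coordinates.
Variables (R : numFieldType) (e : nat -> {poly R}).
Hypothesis e_monic : forall i, e i \is monic.
Hypothesis e_size : forall i, size (e i) = i.+1.

(** Successive elimination of the leading coefficient. *)
Fixpoint coord_upto (N : nat) (p : {poly R}) : nat -> R :=
  if N is N'.+1 then
    fun i => if i == N' then p`_N' else coord_upto N' (p - p`_N' *: e N') i
  else fun=> 0.

Definition coord (p : {poly R}) : nat -> R := coord_upto (size p) p.

Let e_lead i : (e i)`_i = 1.
Proof. by have /monicP := e_monic i; rewrite lead_coefE e_size. Qed.

Lemma coord_uptoE N (p : {poly R}) : (size p <= N)%N ->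
  p = \sum_(i < N) coord_upto N p i *: e i.
Proof.
elim: N p => [|N IH] p pN.
  by rewrite big_ord0; apply/eqP; rewrite -size_poly_leq0.
rewrite big_ord_recr /= eqxx -[LHS](subrK (p`_N *: e N)); congr (_ + _).
rewrite {1}[p - _]IH.
  by apply: eq_bigr => i _; rewrite (ltn_eqF (ltn_ord i)).
apply/leq_sizeP => j; rewrite leq_eqVlt => /predU1P[<-|Nj].
  by rewrite coefB coefZ e_lead mulr1 subrr.
by rewrite coefB coefZ [p`_j]nth_default ?[(e N)`_j]nth_default ?mulr0 ?subrr ?e_size //
  (leq_trans pN).
Qed.

Lemma coord_upto_out N (p : {poly R}) i : (N <= i)%N -> coord_upto N p i = 0.
Proof.
elim: N p => [|N IH] p //= Ni; rewrite gtn_eqF // IH //; exact: ltnW.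
Qed.

Lemma basis_free N (c : nat -> R) : \sum_(i < N) c i *: e i = 0 ->
  forall i, (i < N)%N -> c i = 0.
Proof.
elim: N => [//|N IH] sum0 i.
have cN : c N = 0.
  have := congr1 (fun p : {poly R} => p`_N) sum0.
  rewrite big_ord_recr /= coefD coef0 coef_sum big1 ?add0r.
    by rewrite coefZ e_lead mulr1.
  by move=> j _; rewrite coefZ nth_default ?mulr0 // e_size.
rewrite ltnS leq_eqVlt => /predU1P[-> //|]; apply: IH.
by rewrite -[RHS]sum0 big_ord_recr /= cN scale0r addr0.
Qed.

Lemma coordE N (p : {poly R}) : (size p <= N)%N -> p = \sum_(i < N) coord p i *: e i.
Proof.
move=> pN; rewrite {1}(coord_uptoE (leqnn (size p))).
rewrite (big_ord_widen_cond N xpredT (fun i => coord_upto (size p) p i *: e i)) //.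
rewrite big_mkcond; apply: eq_bigr => i _ /=; case: ltnP => // pi.
by rewrite /coord coord_upto_out // scale0r.
Qed.

Lemma coord_out (p : {poly R}) i : (size p <= i)%N -> coord p i = 0.
Proof. exact: coord_upto_out. Qed.

Lemma coord_sum N (c : nat -> R) i : (i < N)%N -> coord (\sum_(j < N) c j *: e j) i = c i.
Proof.
move=> iN; set p := \sum_(j < N) _.
have pN : (size p <= N)%N.
  apply: (leq_trans (size_sum _ _ _)); apply/bigmax_leqP => j _.
  by apply: (leq_trans (size_scale_leq _ _)); rewrite e_size.
apply/eqP; rewrite -subr_eq0; apply/eqP.
apply: (basis_free (c := fun i => coord p i - c i)) iN.
under eq_bigr do rewrite scalerBl.
by rewrite sumrB -coordE // subrr.
Qed.

Lemma coord_linear (I : Type) (r : seq I) (c : I -> R) (p : I -> {poly R}) i :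
  coord (\sum_(j <- r) c j *: p j) i = \sum_(j <- r) c j * coord (p j) i.
Proof.
pose N := maxn i.+1 (\max_(j <- r) size (p j)).
have rN (s : seq I) : (\max_(j <- s) size (p j) <= N)%N ->
    \sum_(j <- s) c j *: p j = \sum_(b < N) (\sum_(j <- s) c j * coord (p j) b) *: e b.
  move=> sN; rewrite (eq_bigr (fun b : 'I_N => \sum_(j <- s) (c j * coord (p j) b) *: e b)).
    rewrite exchange_big /=; elim: s sN => [|j s IH]; first by rewrite !big_nil.
    rewrite !big_cons geq_max => /andP[jN sN]; rewrite -IH //; congr (_ + _).
    rewrite {1}(coordE jN) scaler_sumr; apply: eq_bigr => b _; by rewrite scalerA.
  by move=> b _; rewrite scaler_suml.
rewrite rN ?leq_maxr // (coord_sum (fun b => \sum_(j <- r) c j * coord (p j) b)) //.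
by rewrite leq_max ltnSn.
Qed.

Lemma coordD p q i : coord (p + q) i = coord p i + coord q i.
Proof.
have := coord_linear [:: p; q] (fun=> 1) id i.
by rewrite !big_cons !big_nil !scale1r !mul1r !addr0.
Qed.

Lemma coord_basis j i : coord (e j) i = (i == j)%:R.
Proof.
have [ij|ij] := leqP j.+1 i.
  by rewrite coord_out ?e_size // gtn_eqF.
have {1}-> : e j = \sum_(b < j.+1) ((b : nat) == j)%:R *: e b.
  rewrite (bigD1 ord_max) //= eqxx scale1r big1 ?addr0 // => b bj.
  by rewrite -(inj_eq val_inj) /= in bj; rewrite (negbTE bj) scale0r.
by rewrite (coord_sum (fun b => (b == j)%:R)).
Qed.

Section Multiplication.
Variables (f : {poly R}) (n : nat).
Local Notation d := (size f).-1.

Definition mul_coord (i j : nat) : R := coord (f * e j) i.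

Lemma size_mul_basis j : (size (f * e j)%R <= (j + d).+1)%N.
Proof. by apply: (leq_trans (size_polyMleq _ _)); rewrite e_size; lia. Qed.

Lemma mul_coord_band i j : (j + d < i)%N -> mul_coord i j = 0.
Proof. by move=> ij; apply: coord_out; apply: leq_trans ij; exact: size_mul_basis. Qed.

Lemma mul_coordE N j : (j + d < N)%N -> f * e j = \sum_(i < N) mul_coord i j *: e i.
Proof. by move=> jN; apply: coordE; apply: leq_trans jN; exact: size_mul_basis. Qed.

Definition mul_block11 : 'M[R]_n := \matrix_(i, j) mul_coord i j.
Definition mul_block12 (q : nat) : 'cV[R]_n := \col_i mul_coord i (n + q)%N.
Definition mul_block21 (r : nat) : 'rV[R]_n := \row_j mul_coord (n + r)%N j.
Definition mul_block22 (r q : nat) : R := mul_coord (n + r)%N (n + q)%N.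
Local Notation bexp := (block_exp d mul_block11 mul_block12 mul_block21 mul_block22).
Local Notation bdet := (block_exp_det d mul_block11 mul_block12 mul_block21 mul_block22).

Lemma coord_mul_step k i N j : (j + d < N)%N ->
  coord (f ^+ k.+1 * e j) i = \sum_(b < N) coord (f ^+ k * e b) i * mul_coord b j.
Proof.
move=> jN; rewrite exprSr -mulrA (mul_coordE jN) mulr_sumr.
under eq_bigr do rewrite -scalerAr.
by rewrite coord_linear; apply: eq_bigr => b _; rewrite mulrC.
Qed.

(** The coordinates of f^k e_j are the entries of the k-th power of the multiplication matrix,
    so the upper block row of its exponential is given by them. *)
Lemma block_expE k :
  (forall i j : 'I_n, (bexp k).1 i j = coord (f ^+ k * e j) i / k`!%:R) /\
  (forall q (i : 'I_n), (bexp k).2 q i 0 = coord (f ^+ k * e (n + q)%N) i / k`!%:R).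
Proof.
have fS (k' : nat) (x : R) : k'.+1%:R^-1 * (x / k'`!%:R) = x / k'.+1`!%:R.
  by rewrite factS natrM invfM mulrCA.
elim: k => [|k [IH1 IH2]].
  split=> [i j|q i]; rewrite /= expr0 mul1r fact0 divr1 coord_basis mxE //.
  by rewrite ltn_eqF // (leq_trans (ltn_ord i)) // leq_addr.
split=> [i j|q i] /=.
- rewrite mxE -fS; congr (_ * _); rewrite (@coord_mul_step _ _ (n + d)%N) ?ltn_add2r //.
  rewrite big_split_ord /= mulrDl 2!mxE summxE !mulr_suml; congr (_ + _).
    by apply: eq_bigr => b _; rewrite IH1 !mxE mulrAC.
  by apply: eq_bigr => b _; rewrite mxE big_ord1 IH2 !mxE mulrAC.
- rewrite mxE -fS; congr (_ * _).
  have jN : (n + q + d < n + (q + d).+1)%N by lia.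
  rewrite (coord_mul_step _ _ jN).
  rewrite big_split_ord /= mulrDl 2!mxE summxE !mulr_suml; congr (_ + _).
    by apply: eq_bigr => b _; rewrite IH1 !mxE mulrAC.
  by apply: eq_bigr => b _; rewrite mxE IH2 mulrA [_ * coord _ _]mulrC.
Qed.

Variable Psi : 'I_n -> {poly R} -> R.
Hypothesis Psi_sum : forall j N (c : nat -> R) (p : nat -> {poly R}),
  Psi j (\sum_(r < N) c r *: p r) = \sum_(r < N) c r * Psi j (p r).
Hypothesis Psi_orth : forall j r, (n <= r)%N -> Psi j (e r) = 0.

(** Coordinates of index at least n are killed by the forms Psi, so the Gram matrix of the
    functions exp(t f) e_i is L(t)^T times the Gram matrix of the e_i. Passing from e_i to
    monomials is unitriangular and does not change determinants. *)
Lemma det_gram_mul K :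
  \det (\matrix_(a, j) \poly_(k < K.+1) (Psi j ('X^a * f ^+ k) / k`!%:R)) =
  bdet K * (\det (\matrix_(a, j) Psi j 'X^a))%:P.
Proof.
set C := \matrix_(a, j) \poly_(k < _) _; set G := \matrix_(a, j) Psi j _.
pose U : 'M[R]_n := \matrix_(i, a) (e i)`_a.
have detU : \det U = 1.
  rewrite det_trig; first by rewrite big1 // => i _; rewrite mxE e_lead.
  by apply/is_trig_mxP => i j ij; rewrite mxE nth_default // e_size.
have eX i : (i < n)%N -> e i = \sum_(a < n) (e i)`_a *: 'X^a.
  move=> im; rewrite -[LHS]coefK poly_def e_size.
  rewrite (big_ord_widen_cond n xpredT (fun a => (e i)`_a *: 'X^a)) //.
  rewrite big_mkcond; apply: eq_bigr => a _ /=; case: ltnP => // ia.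
  by rewrite nth_default ?e_size // scale0r.
have key : map_mx polyC U *m C =
    (mx_series (fun k => (bexp k).1) K.+1)^T *m map_mx polyC (U *m G).
  apply/matrixP => i j; rewrite !mxE; apply/polyP => k; rewrite !coef_sum.
  under eq_bigr => a _ do rewrite !mxE coefCM coef_poly.
  under [RHS]eq_bigr => r _ do rewrite !mxE coefMC coef_poly.
  case: ltnP => kK; last by rewrite !big1 // => r _; rewrite ?mul0r ?mulr0.
  transitivity (Psi j (f ^+ k * e i) / k`!%:R).
    rewrite {2}(eX i) // mulr_sumr; under [X in Psi j X]eq_bigr do rewrite -scalerAr.
    rewrite (Psi_sum j n (fun a => (e i)`_a) (fun a => f ^+ k * 'X^a)) mulr_suml.
    by apply: eq_bigr => a _; rewrite mulrA [f ^+ k * _]mulrC.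
  pose N := (n + size (f ^+ k * e i)%R)%N.
  rewrite (coordE (N := N) (p := f ^+ k * e i)) ?leq_addl // Psi_sum.
  rewrite /N big_split_ord /= [X in _ + X]big1 ?addr0; last first.
    by move=> r _; rewrite Psi_orth ?mulr0 // leq_addr.
  rewrite mulr_suml; apply: eq_bigr => r _.
  have [-> _] := block_expE k; rewrite mulrAC; congr (_ * _).
  by rewrite {1}(eX r) // Psi_sum; apply: eq_bigr => a _; rewrite !mxE.
have := congr1 determinant key.
rewrite !det_mulmx det_tr !det_map_mx !det_mulmx detU.
by rewrite /= !mul1r.
Qed.
End Multiplication.
End Coordinates.

(** * Moments of linear statistics *)

Section MopeIndex.
Variables (m : nat) (k : multi_index m).

(** The pairs (l, i) that label the functions x^i w_l in the order of [mope_functions]. *)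
Definition mope_index_seq : seq ('I_m * nat) :=
  [seq (l, i) | l <- enum 'I_m, i <- iota 0 (k l)].

Lemma size_mope_index : size mope_index_seq == mi_norm k.
Proof.
rewrite size_allpairs_dep sumnE big_map big_enum /=.
by apply/eqP; apply: eq_bigr => l _; rewrite size_iota.
Qed.

Definition mope_index : (mi_norm k).-tuple ('I_m * nat) := Tuple size_mope_index.

Lemma mope_index_lt b : ((tnth mope_index b).2 < k (tnth mope_index b).1)%N.
Proof.
have := mem_tnth b mope_index; move/allpairsPdep => [l [i [_ + ->]]].
by rewrite mem_iota.
Qed.

Lemma mope_functionsE (R : realType) (w : 'I_m -> R -> R) x (b : 'I_(mi_norm k)) :
  (mope_functions w k x)`_b =
  x ^+ (tnth mope_index b).2 * w (tnth mope_index b).1 x.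
Proof.
have -> : mope_functions w k x =
    [seq x ^+ p.2 * w p.1 x | p <- mope_index_seq] by rewrite map_allpairs.
rewrite (nth_map (tnth mope_index b)) ?(eqP size_mope_index) //.
by rewrite -[mope_index_seq]/(tval mope_index) -tnth_nth.
Qed.
End MopeIndex.

Section MopeMoments.
Variables (R : realType) (m : nat) (mu : {sigma_finite_measure set R -> \bar R}).
Variables (w : 'I_m -> R -> R) (mus : 'I_m -> {measure set R -> \bar R}).
Hypotheses (w_meas : forall j, measurable_fun setT (w j)) (w_ge0 : forall j x, 0 <= w j x).
Hypothesis musE : forall j (A : set R), measurable A ->
  mus j A = (\int[mu]_(x in A) (w j x)%:E)%E.
Hypothesis mus_mom : has_moments mus.

Lemma measurable_horner (p : {poly R}) : measurable_fun setT (horner p).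
Proof. by apply: continuous_measurable_fun; exact: continuous_horner. Qed.

Lemma has_integral_horner j (p : {poly R}) :
  has_integral (mus j) (horner p) (\sum_(i < size p) p`_i * \int[mus j]_x (x ^+ i)).
Proof.
apply: (has_integral_ext (f := fun x : R => \sum_(i < size p) p`_i * x ^+ i)).
  by move=> x; rewrite horner_coef.
by apply: has_integral_sum => i _; apply: has_integralZ; split => //; exact: mus_mom.
Qed.

Lemma has_integral_weight j (p : {poly R}) :
  has_integral mu (fun x => p.[x] * w j x) (\int[mus j]_x p.[x]).
Proof.
have [pi _] := has_integral_horner j p.
have mp := measurable_horner p; split.
  exact: (integrable_densityP (w_meas j) (w_ge0 j) (@musE j) mp pi).
by rewrite /Rintegral -(integral_density (w_meas j) (w_ge0 j) (@musE j) mp).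
Qed.

Lemma Rintegral_horner_sum j N (c : nat -> R) (p : nat -> {poly R}) :
  \int[mus j]_x (\sum_(r < N) c r *: p r).[x] = \sum_(r < N) c r * \int[mus j]_x (p r).[x].
Proof.
have [_ <-] : has_integral (mus j) (fun x => \sum_(r < N) c r * (p r).[x])
    (\sum_(r < N) c r * \int[mus j]_x (p r).[x]).
  apply: has_integral_sum => r _; apply: has_integralZ; split => //.
  by have [] := has_integral_horner j (p r).
by apply: eq_Rintegral => x _; rewrite horner_sum; apply: eq_bigr => r _; rewrite hornerZ.
Qed.

Variable k : multi_index m.
Local Notation n := (mi_norm k).

(** The orthogonality conditions of the multi-index k, listed as n linear forms. *)
Definition mope_form (b : 'I_n) (p : {poly R}) : R :=
  \int[mus (tnth (mope_index k) b).1]_x (p * 'X^((tnth (mope_index k) b).2)).[x].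

Lemma mope_form_sum b N (c : nat -> R) (p : nat -> {poly R}) :
  mope_form b (\sum_(r < N) c r *: p r) = \sum_(r < N) c r * mope_form b (p r).
Proof.
rewrite /mope_form mulr_suml; under eq_Rintegral do under eq_bigr do rewrite -scalerAl.
exact: (Rintegral_horner_sum _ _ c (fun r => p r * 'X^((tnth (mope_index k) b).2))).
Qed.

Lemma mope_form_orth b p : mop_orthogonal mus k p -> mope_form b p = 0.
Proof.
move=> /(_ _ _ (mope_index_lt b)) h; rewrite /mope_form /Rintegral.
by under eq_integral do rewrite hornerM hornerXn; rewrite h.
Qed.

Lemma has_integral_mope_form f q a (b : 'I_n) :
  has_integral mu (fun x => x ^+ a * (mope_functions w k x)`_b * (f.[x] ^+ q / q`!%:R))
    (mope_form b ('X^a * f ^+ q) / q`!%:R).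
Proof.
rewrite mulrC; apply: (has_integral_ext (f := fun x : R => q`!%:R^-1 *
   (('X^a * f ^+ q * 'X^((tnth (mope_index k) b).2)).[x] * w (tnth (mope_index k) b).1 x))).
  have E (i a' g p w' : R) : i * (a' * g * p * w') = a' * (p * w') * (g * i) by ring.
  by move=> x; rewrite mope_functionsE !hornerM !hornerXn horner_exp E.
by apply: has_integralZ; exact: has_integral_weight.
Qed.

Variable e : nat -> {poly R}.
Hypothesis e_monic : forall i, e i \is monic.
Hypothesis e_size : forall i, size (e i) = i.+1.
Hypothesis e_orth : forall r, (n <= r)%N -> mop_orthogonal mus k (e r).

(** det L(t), truncated at order K. *)
Definition stat_det (f : {poly R}) (K : nat) : {poly R} :=
  block_exp_det (size f).-1 (mul_block11 e f n) (mul_block12 e f n)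
    (mul_block21 e f n) (mul_block22 e f n) K.

(** Andreief's identity with the functions x^a, the functions of the ensemble and exp(t f),
    followed by [det_gram_mul]. *)
Lemma has_integral_mope_weight (f : {poly R}) K q : (q <= K)%N ->
  has_integral (mpower mu n)
    (fun x => (\sum_(i < n) f.[tnth x i]) ^+ q / q`!%:R * mope_weight w k x)
    ((stat_det f K)`_q * (\det (\matrix_(a < n, b < n) mope_form b 'X^a) *+ n`!)).
Proof.
move=> qK.
have := @has_integral_Andreief R mu n K.+1 (fun a x => x ^+ a)
  (fun b x => (mope_functions w k x)`_b) (fun q x => f.[x] ^+ q / q`!%:R)
  (fun q a b => mope_form b ('X^a * f ^+ q) / q`!%:R)
  (fun q a b _ => has_integral_mope_form f q a b) q.
rewrite (det_gram_mul e_monic e_size f mope_form_sum); last first.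
  by move=> j r nr; apply/mope_form_orth/e_orth.
rewrite coefMC mulrnAr; apply: has_integral_ext => x.
by rewrite coef_prod_exp.
Qed.

Lemma mope_constE : has_integral (mpower mu n) (@mope_weight R m w k n)
  (\det (\matrix_(a < n, b < n) mope_form b 'X^a) *+ n`!).
Proof.
have := @has_integral_mope_weight 0 0 0 (leqnn 0).
have -> : (stat_det 0 0)`_0 = 1 by exact: block_exp_det0.
rewrite mul1r; apply: has_integral_ext => x.
by rewrite expr0 fact0 divr1 mul1r.
Qed.

Lemma has_integral_mope_density (f : {poly R}) K q : (q <= K)%N ->
  mope_const mu w k n != 0 ->
  has_integral (mpower mu n)
    (fun x => (\sum_(i < n) f.[tnth x i]) ^+ q / q`!%:R * mope_density mu w k x)
    (stat_det f K)`_q.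
Proof.
move=> qK Z0.
have ZE : mope_const mu w k n = \det (\matrix_(a < n, b < n) mope_form b 'X^a) *+ n`!.
  by have [_ <-] := mope_constE.
have := has_integralZ (mope_const mu w k n)^-1 (has_integral_mope_weight f qK).
rewrite -ZE mulrCA mulVf // mulr1.
by apply: has_integral_ext => x; rewrite /mope_density mulrCA.
Qed.

End MopeMoments.

Section Transfer.
Variables (R : realType) (m : nat) (mu : {sigma_finite_measure set R -> \bar R}).
Variables (w : 'I_m -> R -> R) (k : multi_index m) (n : nat).
Context d (Omega : measurableType d) (P : probability Omega R).
Variable X : {RV P >-> n.-tuple R}.
Hypothesis X_mope : is_mope mu w k (distribution P X).

(** The density is nonnegative only almost everywhere, so it is first replaced by its positive
    part. *)
Lemma mope_transfer (F : n.-tuple R -> R) v : measurable_fun setT F ->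
  has_integral (mpower mu n) (fun x => F x * mope_density mu w k x) v ->
  has_integral P (F \o X) v.
Proof.
move=> mF [Fi <-].
have [Wi _ rho_ae lawE] := X_mope.
have mW : measurable_fun setT (@mope_weight R m w k n).
  by apply/measurable_EFinP; exact: measurable_int Wi.
have mD : measurable_fun setT (@mope_density R m mu w k n).
  by apply: measurable_funM => //; exact: measurable_cst.
pose rho (x : n.-tuple R) := Num.max (mope_density mu w k x) 0.
have mrho : measurable_fun setT rho by apply: measurable_maxr => //; exact: measurable_cst.
have rho0 x : 0 <= rho x by rewrite /rho le_max lexx orbT.
have lawE' A : measurable A -> distribution P X A = (\int[mpower mu n]_(x in A) (rho x)%:E)%E.
  move=> mA; rewrite lawE //; apply: ae_eq_integral => //.
  - by apply: measurable_funTS; exact/measurable_EFinP.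
  - by apply: measurable_funTS; exact/measurable_EFinP.
  - by apply: filterS rho_ae => x x0 _; rewrite /rho max_l.
have Fri : (mpower mu n).-integrable setT (fun x => (F x * rho x)%:E).
  apply: le_integrable Fi => //.
    by apply/measurable_EFinP; exact: measurable_funM.
  move=> x _; rewrite lee_fin (normrM (F x) (rho x)) (normrM (F x)) ler_wpM2l // /rho.
  by case: (leP (mope_density mu w k x) 0) => _; rewrite ?normr0 ?normr_ge0 ?lexx.
have Fl : (distribution P X).-integrable setT (EFin \o F).
  exact: (integrable_density mrho rho0 lawE' mF Fri).
have FX : P.-integrable setT (EFin \o (F \o X)).
  apply/integrableP; split; first by apply/measurable_EFinP; exact: measurableT_comp.
  have /integrableP[_] := Fl; rewrite ge0_integral_distribution //.
  by apply: measurableT_comp => //; exact/measurable_EFinP.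
split => //; rewrite /Rintegral; congr fine.
transitivity (\int[distribution P X]_x (F x)%:E)%E.
  by rewrite integral_distribution //; exact/measurable_EFinP.
rewrite (integral_density mrho rho0 lawE' mF); apply: ae_eq_integral => //.
- by apply/measurable_EFinP; exact: measurable_funM.
- by apply/measurable_EFinP; exact: measurable_funM.
- by apply: filterS rho_ae => x x0 _; rewrite /rho max_l.
Qed.
End Transfer.

(** * Recurrence coefficients along a path of multi-indices *)

Section MultiIndex.
Variable m : nat.
Implicit Types k : multi_index m.

Lemma mi_norm_incr k l : mi_norm (mi_incr k l) = (mi_norm k).+1.
Proof.
rewrite /mi_norm; under eq_bigr do rewrite ffunE; rewrite big_split /= -addn1; congr addn.
by rewrite (bigD1 l) //= eqxx big1 // => j /negbTE ->.
Qed.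

Lemma mi_decrK k l : (0 < k l)%N -> mi_incr (mi_decr k l) l = k.
Proof. by move=> kl; apply/ffunP => j; rewrite !ffunE; case: eqP => [->|_] /=; lia. Qed.

Lemma mi_norm_decr k l : (0 < k l)%N -> (mi_norm (mi_decr k l)).+1 = mi_norm k.
Proof. by move=> kl; rewrite -(mi_norm_incr _ l) mi_decrK. Qed.

Lemma mi_norm_close k k' C : (forall j, k j <= k' j + C)%N ->
  (mi_norm k <= mi_norm k' + m * C)%N.
Proof.
move=> kC; rewrite /mi_norm -[m in (m * C)%N]card_ord -sum_nat_const -big_split /=.
exact: leq_sum.
Qed.
End MultiIndex.

Section Direction.
Variables (R : realType) (m : nat) (kk : nat -> multi_index m) (nu : 'I_m -> R).
Hypothesis kk_norm : forall n, mi_norm (kk n) = n.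
Hypothesis kk_nu : forall j, (fun n => (kk n j)%:R / n%:R : R) @ \oo --> nu j.

Lemma cvg_bounded_div (x : nat -> R) C :
  (forall n, `|x n| <= C) -> x n / n%:R @[n --> \oo] --> (0 : R).
Proof.
move=> xC; apply/cvgr0Pnorm_le => e e0.
have C0 : 0 <= C by apply: le_trans (xC 0%N).
near=> n.
have n0 : C / e < n%:R by near: n; exact: nbhs_infty_gtr.
have n1 : 0 < n%:R :> R by apply: le_lt_trans n0; rewrite divr_ge0 // ltW.
rewrite normrM normfV (ger0_norm (ltW n1)) ltW // ltr_pdivrMr //.
by apply: le_lt_trans (xC n) _; rewrite mulrC -ltr_pdivrMr.
Unshelve. all: by end_near. Qed.

(** Changing the entries of the multi-indices by a bounded amount does not change their
    direction. *)
Lemma directional_limit_close (c : multi_index m -> R) l (k' : nat -> multi_index m) C :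
  directional_limit c nu l ->
  (forall n j, (kk n j <= k' n j + C)%N /\ (k' n j <= kk n j + C)%N) ->
  c (k' n) @[n --> \oo] --> l.
Proof.
move=> cl kC.
have k'n n : (n <= mi_norm (k' n) + m * C)%N.
  by rewrite -{1}(kk_norm n); apply: mi_norm_close => j; have [] := kC n j.
have nk' n : (mi_norm (k' n) <= n + m * C)%N.
  by rewrite -{2}(kk_norm n); apply: mi_norm_close => j; have [] := kC n j.
apply: cl.
  apply/cvgnyPge => A; near=> n.
  have nA : (A + m * C <= n)%N by near: n; exact: nbhs_infty_ge.
  have := k'n n; lia.
have nat_dist (p q r : nat) : (p <= q + r)%N -> (q <= p + r)%N -> `|p%:R - q%:R| <= r%:R :> R.
  rewrite -!(ler_nat R) !natrD => h1 h2; rewrite ler_norml; apply/andP; split; lra.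
move=> j.
pose num n : R := (kk n j)%:R / n%:R + ((k' n j)%:R - (kk n j)%:R) / n%:R.
pose den n : R := 1 + ((mi_norm (k' n))%:R - n%:R) / n%:R.
have num_cvg : num n @[n --> \oo] --> nu j.
  rewrite -[nu j]addr0; apply: cvgD; first exact: kk_nu.
  by apply: (@cvg_bounded_div _ C%:R) => n; apply: nat_dist; have [] := kC n j.
have den_cvg : den n @[n --> \oo] --> (1 : R).
  rewrite -[1 in X in _ --> X]addr0; apply: cvgD; first exact: cvg_cst.
  by apply: (@cvg_bounded_div _ (m * C)%:R) => n; apply: nat_dist.
have q_cvg : num n / den n @[n --> \oo] --> nu j.
  rewrite -[nu j]divr1; apply: cvgM => //.
  by apply: cvgV => //; exact: oner_neq0.
refine (cvg_eventually_eq (N := (m * C).+1) _ q_cvg) => n nC.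
have n0 : n%:R != 0 :> R by rewrite pnatr_eq0; lia.
have k0 : (mi_norm (k' n))%:R != 0 :> R by rewrite pnatr_eq0; have := k'n n; lia.
rewrite /num /den; field; rewrite n0 /=.
by rewrite [X in X != 0](_ : _ = (mi_norm (k' n))%:R) ?k0 //; ring.
Unshelve. all: by end_near. Qed.
End Direction.

Section Recurrence.
Variables (R : realType) (m : nat) (mus : 'I_m -> {measure set R -> \bar R}).
Hypothesis mus_perfect : perfect mus.
Variables a b : multi_index m -> 'I_m -> R.
Hypothesis ab_nn : nn_recurrence mus a b.
Local Notation mop := (mop mus).
Implicit Types k : multi_index m.

(** In a perfect system [mop] is never the default value 0, whose size would be 0. *)
Lemma mopP k : is_mop mus k (mop k).
Proof.
rewrite /Defs.mop; case: xgetP => [p -> //|none].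
have := mus_perfect k; rewrite /Defs.mop; case: xgetP => [p _ pP|_].
  by case: (none p pP).
by rewrite size_poly0.
Qed.

Lemma mop_monic k : mop k \is monic. Proof. by case: (mopP k). Qed.
Lemma size_mop k : size (mop k) = (mi_norm k).+1. Proof. exact: mus_perfect. Qed.

Lemma mop_orth_le k k' : (forall j, k j <= k' j)%N -> mop_orthogonal mus k (mop k').
Proof. by move=> kk' j l lk; case: (mopP k') => _ + _; apply; apply: leq_trans (kk' j). Qed.

(** Subtracting the recurrences in the directions i and j. *)
Lemma mop_incr_diff k i j : mop (mi_incr k i) = mop (mi_incr k j) + (b k j - b k i) *: mop k.
Proof.
have [rec _] := ab_nn; have := rec k i; rewrite (rec k j) => /addIr.
by rewrite scalerBl addrA => ->; rewrite addrK.
Qed.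

Variable j0 : 'I_m.
(** k - t e_j0, truncated at 0. *)
Definition mi_down (k : multi_index m) (t : nat) : multi_index m :=
  [ffun j => (k j - t * (j == j0))%N].

Lemma mi_norm_down k t : (t <= k j0)%N -> mi_norm (mi_down k t) = (mi_norm k - t)%N.
Proof.
move=> tk; rewrite /mi_norm (bigD1 j0) //= [in RHS](bigD1 j0) //= ffunE eqxx muln1.
rewrite addnBAC //; congr (_ + _ - _)%N; apply: eq_bigr => j /negbTE jj0.
by rewrite ffunE jj0 muln0 subn0.
Qed.

Definition nn_prod (k : multi_index m) (j : 'I_m) (l : nat) : R :=
  \prod_(t < l) (b (mi_decr (mi_down k t.+1) j) j - b (mi_decr (mi_down k t.+1) j) j0).

(** [mop_incr_diff] at k - e_j - e_j0 expresses the polynomial of index k - e_j through those of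
    indices k - e_j0 and k - e_j - e_j0;
      iterating it L times moves everything to the line k - t e_j0, up to a
    remainder of degree |k| - L - 1. *)
Lemma mop_decr_expand k j L : (0 < k j)%N -> (L < k j0)%N ->
  mop (mi_decr k j) = \sum_(l < L) nn_prod k j l *: mop (mi_down k l.+1)
    + nn_prod k j L *: mop (mi_decr (mi_down k L) j).
Proof.
move=> kj; elim: L => [|L IH] kL.
  rewrite big_ord0 add0r /nn_prod big_ord0 scale1r; congr (mop (mi_decr _ j)).
  by apply/ffunP => i; rewrite ffunE mul0n subn0.
rewrite {}IH 1?ltnW // big_ord_recr /= -addrA; congr (_ + _).
rewrite /nn_prod big_ord_recr /= -/(nn_prod k j L) -scalerA -scalerDr; congr (_ *: _).
set kap := mi_decr (mi_down k L.+1) j.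
have -> : mi_decr (mi_down k L) j = mi_incr kap j0.
  apply/ffunP => i; rewrite !ffunE; move: kL kj; case: (eqVneq i j0) => [->|_] /=;
    case: (eqVneq _ j) => [<-|_] /=; lia.
rewrite (mop_incr_diff _ j0 j); congr (mop _ + _).
apply/ffunP => i; rewrite !ffunE; move: kL kj; case: (eqVneq i j0) => [->|_] /=;
    case: (eqVneq _ j) => [<-|_] /=; lia.
Qed.

(** Coefficient of x times the polynomial of index k on the one of index k + (1 - p) e_j0. *)
Definition nn_band (k : multi_index m) (p : nat) : R :=
  match p with
  | 0 => 1
  | 1 => b k j0
  | l.+2 => \sum_j a k j * nn_prod k j l
  end.

(** Only L + 2 coefficients are extracted, because the expansion stops when the multi-index
    reaches the boundary in the direction j0; the remainder has low degree. *)
Lemma mul_X_mop k L : (L < k j0)%N -> exists2 q : {poly R}, (size q <= mi_norm k - L)%N &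
  'X * mop k = mop (mi_incr k j0) + \sum_(p < L.+1) nn_band k p.+1 *: mop (mi_down k p) + q.
Proof.
move=> kL; have [rec a0] := ab_nn.
have k0 : mi_down k 0 = k by apply/ffunP => i; rewrite ffunE mul0n subn0.
exists (\sum_j (a k j * nn_prod k j L) *: mop (mi_decr (mi_down k L) j)).
  apply: (leq_trans (size_sum _ _ _)); apply/bigmax_leqP => j _.
  have [kj|] := posnP (k j); first by rewrite a0 // mul0r scale0r size_poly0.
  move=> kj; apply: (leq_trans (size_scale_leq _ _)); rewrite size_mop mi_norm_decr.
    by rewrite mi_norm_down // ltnW.
  by rewrite ffunE; case: (eqVneq j j0) => [->|_] /=; lia.
rewrite (rec k j0) big_ord_recl /= k0 -!addrA; congr (_ + (_ + _)).
under [X in _ = X + _]eq_bigr => p _ do rewrite scaler_suml.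
rewrite exchange_big -big_split /=; apply: eq_bigr => j _.
have [kj|kj] := posnP (k j).
  rewrite a0 // scale0r mul0r scale0r addr0 big1 // => p _.
  by rewrite mul0r scale0r.
rewrite (mop_decr_expand kj kL) scalerDr scalerA; congr (_ + _).
by rewrite scaler_sumr; apply: eq_bigr => p _; rewrite scalerA.
Qed.
End Recurrence.

Section Path.
Variables (R : realType) (m : nat) (mus : 'I_m -> {measure set R -> \bar R}).
Hypothesis mus_perfect : perfect mus.
Variables a b : multi_index m -> 'I_m -> R.
Hypothesis ab_nn : nn_recurrence mus a b.
Variables (kk : nat -> multi_index m) (nu : 'I_m -> R).
Hypothesis kk_norm : forall n, mi_norm (kk n) = n.
Hypothesis kk_nu : forall j, (fun n => (kk n j)%:R / n%:R : R) @ \oo --> nu j.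
Variables (anu bnu : 'I_m -> R).
Hypothesis a_lim : forall j, directional_limit (a^~ j) nu (anu j).
Hypothesis b_lim : forall j, directional_limit (b^~ j) nu (bnu j).
Variable j0 : 'I_m.
Hypothesis nu_j0 : 0 < nu j0.
Local Notation mop := (mop mus).

Definition path_index (n i : nat) : multi_index m :=
  [ffun j => if j == j0 then (kk n j + i - n)%N else kk n j].

(** Multiple orthogonal polynomials on the line k_n + Z e_j0. Below degree n - k_n(j0) the line
    leaves the set of multi-indices, and any monic polynomial will do. *)
Definition path_basis (n i : nat) : {poly R} :=
  if (n <= i + kk n j0)%N then mop (path_index n i) else 'X^i.

Lemma mi_norm_path n i : (n <= i + kk n j0)%N -> mi_norm (path_index n i) = i.
Proof.
have E k : mi_norm k = (k j0 + \sum_(j | j != j0) k j)%N by rewrite /mi_norm (bigD1 j0).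
move=> ni; have := kk_norm n; rewrite !E ffunE eqxx.
have -> : (\sum_(j | j != j0) path_index n i j = \sum_(j | j != j0) kk n j)%N.
  by apply: eq_bigr => j /negbTE jj0; rewrite ffunE jj0.
by lia.
Qed.

Lemma path_basis_monic n i : path_basis n i \is monic.
Proof. by rewrite /path_basis; case: ifP => _; [exact: mop_monic|exact: monicXn]. Qed.

Lemma size_path_basis n i : size (path_basis n i) = i.+1.
Proof.
rewrite /path_basis; case: ifP => h; last by rewrite size_polyXn.
by rewrite size_mop // mi_norm_path.
Qed.

(** For r >= n the index is at least k_n in every entry. *)
Lemma path_basis_orth n r : (n <= r)%N -> mop_orthogonal mus (kk n) (path_basis n r).
Proof.
move=> nr; rewrite /path_basis (leq_trans nr) ?leq_addr //.
by apply: mop_orth_le => // j; rewrite ffunE; case: eqP => // ->; lia.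
Qed.

(** Laurent coefficients of z + sum_j a_j / (z - b_j) around b_j0: the value at [p] is the
    coefficient of (z - b_j0)^(1 - p). *)
Definition nn_symbol (p : nat) : R :=
  match p with
  | 0 => 1
  | 1 => bnu j0
  | l.+2 => \sum_j anu j * (bnu j - bnu j0) ^+ l
  end.

(** This is where nu_j0 > 0 enters: arbitrarily many steps down in the direction j0 are
    possible once n is large. *)
Lemma kk_j0_large M : exists N, forall n, (N <= n)%N -> (M <= kk n j0)%N.
Proof.
have h : \forall n \near \oo, nu j0 / 2 < (kk n j0)%:R / n%:R.
  have lt2 : nu j0 / 2 < nu j0 by rewrite ltr_pdivrMr // mulr_natr mulr2n ltrDl.
  exact: (cvgr_gt _ (@kk_nu j0) _ lt2).
have h2 : \forall n \near \oo, M%:R / (nu j0 / 2) < n%:R :> R by exact: nbhs_infty_gtr.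
have [N _ NP] : \forall n \near \oo, (M <= kk n j0)%N.
  near=> n.
  have h1 : nu j0 / 2 < (kk n j0)%:R / n%:R by near: n.
  have h3 : M%:R / (nu j0 / 2) < n%:R :> R by near: n.
  have n0 : 0 < n%:R :> R by apply: le_lt_trans h3; rewrite divr_ge0 // ltW // divr_gt0.
  rewrite -(ler_nat R) ltW //.
  move: h1 h3; rewrite ltr_pdivlMr // ltr_pdivrMr ?divr_gt0 //.
  by move=> h1 h3; apply: lt_trans h3 _; rewrite mulrC.
by exists N => n Nn; apply: NP.
Unshelve. all: by end_near. Qed.

Lemma nn_band_cvg (k' : nat -> multi_index m) C p :
  (forall n j, (kk n j <= k' n j + C)%N /\ (k' n j <= kk n j + C)%N) ->
  nn_band a b j0 (k' n) p @[n --> \oo] --> nn_symbol p.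
Proof.
move=> kC; case: p => [|[|l]] /=.
- exact: cvg_cst.
- exact (directional_limit_close kk_norm kk_nu (@b_lim j0) kC).
apply: cvg_sum_fin => j; apply: cvgM.
  exact (directional_limit_close kk_norm kk_nu (@a_lim j) kC).
rewrite /nn_prod; elim: l => [|l IH].
  by under eq_fun do rewrite big_ord0; rewrite expr0; exact: cvg_cst.
under eq_fun do rewrite big_ord_recr; rewrite exprSr /=.
apply: cvgM; first exact: IH.
have kC' n i : (kk n i <= mi_decr (mi_down j0 (k' n) l.+1) j i + (C + l.+2))%N /\
    (mi_decr (mi_down j0 (k' n) l.+1) j i <= kk n i + (C + l.+2))%N.
  have [h1 h2] := kC n i; rewrite !ffunE.
  by case: (_ == j0); case: (_ == j); split; lia.
by apply: cvgB;
  [exact (directional_limit_close kk_norm kk_nu (@b_lim j) kC')|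
   exact (directional_limit_close kk_norm kk_nu (@b_lim j0) kC')].
Qed.

Local Notation acoord n := (coord (path_basis n)).

Lemma mul_X_path n j L p : (p <= L.+1)%N -> (n + L < j + kk n j0)%N ->
  acoord n ('X * path_basis n j) (j.+1 - p)%N = nn_band a b j0 (path_index n j) p.
Proof.
move=> pL njL.
have bas i : (n <= i + kk n j0)%N -> path_basis n i = mop (path_index n i).
  by move=> h; rewrite /path_basis h.
have kj0 : path_index n j j0 = (kk n j0 + j - n)%N by rewrite ffunE eqxx.
have kn : (kk n j0 <= n)%N.
  by rewrite -{2}(kk_norm n) /mi_norm (bigD1 j0) //= leq_addr.
have Lk : (L < path_index n j j0)%N by rewrite kj0; lia.
have [q qs E] := mul_X_mop mus_perfect ab_nn Lk.
have nj : (n <= j + kk n j0)%N by lia.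
rewrite bas // {}E mi_norm_path // in qs *.
have -> : mop (mi_incr (path_index n j) j0) = path_basis n j.+1.
  rewrite bas; last by lia.
  congr mop; apply/ffunP => i; rewrite !ffunE; case: (eqVneq i j0) => [->|_] /=; lia.
have -> : \sum_(p0 < L.+1) nn_band a b j0 (path_index n j) p0.+1 *: mop
  (mi_down j0 (path_index n j) p0)
    = \sum_(p0 < L.+1) nn_band a b j0 (path_index n j) p0.+1 *: path_basis n (j - p0)%N.
  apply: eq_bigr => i _; have iL : (i <= L)%N by rewrite -ltnS.
  rewrite bas; last by lia.
  congr (_ *: mop _); apply/ffunP => l; rewrite !ffunE; case: (eqVneq l j0) => [->|_] /=; lia.
have mon := path_basis_monic n. have sz := size_path_basis n.
have -> : path_basis n j.+1
  + \sum_(p0 < L.+1) nn_band a b j0 (path_index n j) p0.+1 *: path_basis n (j - p0)%N =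
   \sum_(p0 < L.+2) nn_band a b j0 (path_index n j) p0 *: path_basis n (j.+1 - p0)%N.
  by rewrite [RHS]big_ord_recl /= scale1r subn0.
rewrite coordD // [X in _ + X]coord_out ?addr0; last by apply: leq_trans qs _; lia.
rewrite coord_linear // (bigD1 (Ordinal (pL : p < L.+2)%N)) //= coord_basis // eqxx mulr1.
rewrite big1 ?addr0 // => i ip; rewrite coord_basis // (_ : _ == _ = false) ?mulr0 //.
apply/negbTE; apply: contra ip => /eqP h; apply/eqP/val_inj => /=.
by case: i h => i /= iL; lia.
Qed.

Lemma mul_X_path_cvg s v p :
  acoord n ('X * path_basis n (n + v - s)%N) (n + v.+1 - (s + p))%N @[n --> \oo] -->
  nn_symbol p.
Proof.
have [N NP] := kk_j0_large (s + p).+2.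
have close n i : (kk n i <= path_index n (n + v - s) i + (s + v))%N /\
    (path_index n (n + v - s) i <= kk n i + (s + v))%N.
  by rewrite ffunE; case: eqP => [->|_]; lia.
refine (cvg_eventually_eq (N := N) _ (nn_band_cvg close)) => n Nn.
have kn : (kk n j0 <= n)%N.
  by rewrite -{2}(kk_norm n) /mi_norm (bigD1 j0) //= leq_addr.
have := NP n Nn => large.
have -> : (n + v.+1 - (s + p) = (n + v - s).+1 - p)%N by lia.
by rewrite (@mul_X_path _ _ p) //; lia.
Qed.

(** Laurent coefficient of index t of the r-th power of the symbol. It vanishes for t > r, so
    that the Cauchy product with [nn_symbol] is a finite sum. *)
Fixpoint symbol_power (r : nat) : int -> R :=
  if r is r'.+1 then fun t =>
    \sum_(p < (absz (r%:Z - t)%R).+1) nn_symbol p * symbol_power r' (t - 1 + p%:Z)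
  else fun t => (t == 0)%:R.

Lemma symbol_power_band r (t : int) : (r%:Z < t)%R -> symbol_power r t = 0.
Proof.
clear nu_j0; elim: r t => [|r IH] t rt /=; first by rewrite gt_eqF.
by rewrite big1 // => p _; rewrite IH ?mulr0 //; lia.
Qed.

(** The matrix of multiplication by x^(r+1) is a product of two matrices that are banded below
    the diagonal, so an entry near the corner is a sum of boundedly many products of such
    entries. *)
Lemma mul_Xn_path_cvg r s u v :
  acoord n ('X^r * path_basis n (n + v - s)%N) (n + u - s)%N @[n --> \oo] -->
  symbol_power r (u%:Z - v%:Z).
Proof.
elim: r s u v => [|r IH] s u v.
  refine (cvg_eventually_eq (N := s.+1) _ (cvg_cst ((u%:Z - v%:Z == 0)%:R : R))) => n ns.
  rewrite expr0 mul1r coord_basis; [|exact: path_basis_monic|exact: size_path_basis].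
  by congr ((_ : bool)%:R); apply/eqP/eqP => h; lia.
pose M := absz (r.+1%:Z - (u%:Z - v%:Z))%R.
have C : \sum_(p < M.+1) acoord n ('X * path_basis n (n + v - s)%N) (n + v.+1 - (s + p))%N
     * acoord n ('X^r * path_basis n (n + v.+1 - (s + p))%N) (n + (u + p) - (s + p))%N
   @[n --> \oo] --> symbol_power r.+1 (u%:Z - v%:Z).
  apply: cvg_sum_fin => p; apply: cvgM; first exact: mul_X_path_cvg.
  have := @IH (s + p)%N (u + p)%N v.+1.
  have -> // : (u + p)%N%:Z - v.+1%:Z = u%:Z - v%:Z - 1 + p%:Z :> int by lia.
refine (cvg_eventually_eq (N := (s + M).+2) _ C) => n nsM.
have mon := path_basis_monic n. have sz := size_path_basis n.
set j := (n + v - s)%N; set i := (n + u - s)%N.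
have jN : (j + (size ('X : {poly R})).-1 < j.+2)%N by rewrite size_polyX; lia.
rewrite (coord_mul_step mon sz r i jN).
rewrite (sum_tail (M := M.+1) (G := fun c => acoord n ('X^r * path_basis n c) i
    * mul_coord (path_basis n) 'X c j)); last 2 first.
- by rewrite /j; lia.
- move=> b' bM; rewrite coord_out ?mul0r //.
  by apply: (leq_trans (size_polyMleq _ _)); rewrite size_polyXn sz /i; move: bM; rewrite /j /M;
    lia.
apply: eq_bigr => p _; rewrite mulrC /mul_coord; congr (_ * _); congr (acoord n _ _).
- by congr (_ * path_basis n _); rewrite /j; lia.
- by rewrite /i; lia.
- by rewrite /j; lia.
Qed.

Definition symbol_poly (f : {poly R}) (t : int) : R :=
  \sum_(r < size f) f`_r * symbol_power r t.

Lemma mul_path_cvg (f : {poly R}) s u v :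
  mul_coord (path_basis n) f (n + u - s)%N (n + v - s)%N @[n --> \oo] -->
  symbol_poly f (u%:Z - v%:Z).
Proof.
rewrite /mul_coord /symbol_poly.
have C : \sum_(r < size f) f`_r * acoord n ('X^r * path_basis n (n + v - s)%N) (n + u - s)%N
   @[n --> \oo] --> \sum_(r < size f) f`_r * symbol_power r (u%:Z - v%:Z).
  by apply: cvg_sum_fin => r; apply: cvgM; [exact: cvg_cst|exact: mul_Xn_path_cvg].
refine (cvg_eventually_eq (N := 0) _ C) => n _.
rewrite -coord_linear; [|exact: path_basis_monic|exact: size_path_basis].
congr (acoord n _ _); rewrite -[in RHS](coefK f) poly_def mulr_suml.
by apply: eq_bigr => r _; rewrite scalerAl.
Qed.

Lemma symbol_poly_band (f : {poly R}) (l : nat) : ((size f).-1 < l)%N -> symbol_poly f l%:Z = 0.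
Proof.
clear nu_j0; move=> fl; rewrite /symbol_poly big1 // => r _.
by rewrite symbol_power_band ?mulr0 //; have := ltn_ord r; lia.
Qed.
End Path.

(** * Centered linear statistics *)

Section Shift.
Variables (R : numFieldType) (n d : nat) (c : R).
Variables (A11 : 'M[R]_n) (A12 : nat -> 'cV[R]_n) (A21 : nat -> 'rV[R]_n).
Variable A22 : nat -> nat -> R.

Let A11' := A11 - c%:M.
Let A22' r q := A22 r q - c * (r == q)%:R.

(** Adding a scalar to A changes X A22 and A11 X by the same amount. *)
Lemma riccati_shift k q : riccati d A11' A12 A21 A22' k q = riccati d A11 A12 A21 A22 k q.
Proof.
have XS' := riccatiS d A11' A12 A21 A22'; have XS := riccatiS d A11 A12 A21 A22.
have X0' := riccati0 d A11' A12 A21 A22'; have X0 := riccati0 d A11 A12 A21 A22.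
move: (riccati d A11' _ _ _) (riccati d A11 _ _ _) XS' XS X0' X0 => X' X XS' XS X0' X0.
elim/ltn_ind: k q => -[|k] IH q; first by rewrite X0 X0'.
have k0 : k.+1%:R != 0 :> R by rewrite pnatr_eq0.
apply: (scalerI k0); rewrite XS XS'.
have -> : \sum_(r < (q + d).+1) A22' r q *: X' k r =
    \sum_(r < (q + d).+1) A22 r q *: X k r - c *: X k q.
  under eq_bigr => r _ do rewrite IH // /A22' scalerBl.
  rewrite sumrB; congr (_ - _).
  have qd : (q < (q + d).+1)%N by rewrite ltnS leq_addr.
  rewrite (bigD1 (Ordinal qd)) //= eqxx mulr1 big1 ?addr0 // => r rq.
  rewrite (_ : ((r : nat) == q) = false) ?mulr0 ?scale0r //.
  by apply/negbTE; apply: contra rq => /eqP h; apply/eqP/val_inj.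
have -> : A11' *m X' k q = A11 *m X k q - c *: X k q.
  by rewrite IH // /A11' mulmxBl mul_scalar_mx.
have -> : \sum_(i < k.+1) \sum_(r < d) X' i r *m (A21 r *m X' (k - i)%N q) =
    \sum_(i < k.+1) \sum_(r < d) X i r *m (A21 r *m X (k - i)%N q).
  apply: eq_bigr => i _; apply: eq_bigr => r _.
  by rewrite (IH i) // (IH (k - i)%N) // ltnS leq_subr.
have -> (V : zmodType) (x y z u v : V) : x + (y - z) - (u - z) - v = x + y - u - v.
  by rewrite addrA opprB addrA subrK.
by [].
Qed.

Lemma mxtrace_riccati_gen_shift k :
  \tr (riccati_gen d A11' A12 A21 A22' k) =
  \tr (riccati_gen d A11 A12 A21 A22 k) - (c *+ n) *+ (k == 0)%N.
Proof.
rewrite !mxtrace_riccati_gen.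
under eq_bigr => r _ do rewrite riccati_shift.
by rewrite /A11' raddfB /= mxtrace_scalar mulrnBl addrAC.
Qed.
End Shift.

Section ShiftBlocks.
Variables (R : numFieldType) (e : nat -> {poly R}) (f : {poly R}) (c : R) (n : nat).
Hypothesis e_monic : forall i, e i \is monic.
Hypothesis e_size : forall i, size (e i) = i.+1.
Local Notation f' := (f - c%:P).

Lemma size_subC : (size f').-1 = (size f).-1.
Proof.
have [f1|f1] := leqP (size f) 1.
  have f'1 : (size f' <= 1)%N.
    by apply: (leq_trans (size_polyD _ _)); rewrite geq_max f1 size_polyN size_polyC_leq1.
  by case: (size f) (size f') f1 f'1 => [|[|?]] [|[|?]].
by rewrite size_polyDl // size_polyN; apply: leq_ltn_trans f1; exact: size_polyC_leq1.
Qed.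

Lemma mul_coord_subC i j : mul_coord e f' i j = mul_coord e f i j - c * (i == j)%:R.
Proof.
rewrite /mul_coord mulrBl mul_polyC coordD //; congr (_ + _).
rewrite -scaleNr; have := coord_linear e_monic e_size [:: e j] (fun=> - c) id i.
by rewrite !big_cons !big_nil !addr0 coord_basis // => ->; rewrite mulNr.
Qed.

Lemma mxtrace_gen_subC k :
  \tr (riccati_gen (size f').-1 (mul_block11 e f' n) (mul_block12 e f' n)
    (mul_block21 e f' n) (mul_block22 e f' n) k) =
  \tr (riccati_gen (size f).-1 (mul_block11 e f n) (mul_block12 e f n)
    (mul_block21 e f n) (mul_block22 e f n) k) - (c *+ n) *+ (k == 0)%N.
Proof.
rewrite -mxtrace_riccati_gen_shift size_subC /=; congr (\tr (riccati_gen _ _ _ _ _ _)).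
- by apply/matrixP => i j; rewrite !mxE mul_coord_subC mulr_natr.
- apply/funext => q; apply/matrixP => i j; rewrite !mxE mul_coord_subC.
  by rewrite ltn_eqF ?mulr0 ?subr0 // (leq_trans (ltn_ord i)) // leq_addr.
- apply/funext => q; apply/matrixP => i j; rewrite !mxE mul_coord_subC.
  by rewrite gtn_eqF ?mulr0 ?subr0 // (leq_trans (ltn_ord j)) // leq_addr.
- by apply/funext => r; apply/funext => q; rewrite /mul_block22 mul_coord_subC eqn_add2l.
Qed.
End ShiftBlocks.

Section GaussianMoments.
Variable R : realType.

(** Moments of the centered normal law of variance v; the recursion is integration by parts. *)
Fixpoint gaussian_moment (v : R) (q : nat) : R :=
  if q is q'.+1 then
    if q' is q''.+1 then q'%:R * v * gaussian_moment v q'' else 0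
  else 1.

Lemma gaussian_momentSS v q :
  gaussian_moment v q.+2 = q.+1%:R * v * gaussian_moment v q.
Proof. by []. Qed.

(** The recursion says that tau is the logarithmic derivative of the generating function of y.
    In the limit this derivative is v t, so the generating function tends to exp(v t^2 / 2). *)
Lemma moment_recursion_cvg (N : nat) (v : R) (y tau : nat -> nat -> R) :
  (forall n, (N <= n)%N -> y n 0 = 1) ->
  (forall n k, (N <= n)%N -> k.+1%:R * y n k.+1 = \sum_(i < k.+1) y n i * tau n (k - i)%N) ->
  (forall n, (N <= n)%N -> tau n 0 = 0) ->
  (forall k, tau n k.+1 @[n --> \oo] --> (if k == 0%N then v else 0)) ->
  forall k, y n k * k`!%:R @[n --> \oo] --> gaussian_moment v k.
Proof.
move=> y0 yS tau0 tau_cvg.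
have n0 (k : nat) : k.+1%:R != 0 :> R by rewrite pnatr_eq0.
have f0 (k : nat) : k`!%:R != 0 :> R by rewrite pnatr_eq0 -lt0n fact_gt0.
suff yc k : y n k @[n --> \oo] --> gaussian_moment v k / k`!%:R.
  move=> k; rewrite -[X in _ --> X](divfK (f0 k)).
  by apply: cvgM; [exact: yc|exact: cvg_cst].
elim/ltn_ind: k => -[|k] IH.
  by rewrite fact0 divr1; refine (cvg_eventually_eq (N := N) _ (cvg_cst (1 : R))) => n /y0.
pose t (j : nat) : R := if j == 1%N then v else 0.
have tc j : tau n j @[n --> \oo] --> t j.
  case: j => [|j]; last exact: tau_cvg.
  by refine (cvg_eventually_eq (N := N) _ (cvg_cst (0 : R))) => n /tau0.
have C : k.+1%:R^-1 * (\sum_(i < k.+1) y n i * tau n (k - i)%N) @[n --> \oo] -->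
   k.+1%:R^-1 * (\sum_(i < k.+1) gaussian_moment v i / i`!%:R * t (k - i)%N).
  apply: cvgM; first exact: cvg_cst.
  by apply: cvg_sum_fin => i; apply: cvgM; [exact: IH|exact: tc].
have -> : gaussian_moment v k.+1 / k.+1`!%:R =
   k.+1%:R^-1 * (\sum_(i < k.+1) gaussian_moment v i / i`!%:R * t (k - i)%N).
  case: k {IH C} => [|k].
    by rewrite big_ord1 /t /= mulr0 mulr0 mul0r.
  rewrite (bigD1 (inord k)) //= inordK // subSn // subnn /t eqxx big1 ?addr0.
    rewrite !factS !natrM; field.
    by rewrite f0 !lt0r_neq0 // ltr_pwDl.
  move=> i /eqP ik; case: eqP; rewrite ?mulr0 // => h; case: ik; apply/val_inj.
  by rewrite /= inordK //; have := ltn_ord i; lia.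
refine (cvg_eventually_eq (N := N) _ C) => n Nn.
by rewrite -yS // mulKf.
Qed.
End GaussianMoments.

Definition linear_stat (R : realType) (n : nat) (g : {poly R}) (x : n.-tuple R) : R :=
  \sum_(j < n) g.[tnth x j].

Lemma measurable_linear_stat (R : realType) (n : nat) (g : {poly R}) :
  measurable_fun setT (@linear_stat R n g).
Proof.
apply: measurable_sum => j; apply: (measurableT_comp (f := horner g)).
  exact: measurable_horner.
exact: measurable_tnth.
Qed.

(** Coefficients of the logarithmic derivative of the generating function of the moments. *)
Definition stat_gen (R : realType) (e : nat -> {poly R}) (n : nat) (g : {poly R}) (j : nat) : R :=
  \tr (riccati_gen (size g).-1 (mul_block11 e g n) (mul_block12 e g n)
    (mul_block21 e g n) (mul_block22 e g n) j).

Section CenteredMoments.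
Variables (R : realType) (m : nat) (mu : {sigma_finite_measure set R -> \bar R}).
Variables (w : 'I_m -> R -> R) (mus : 'I_m -> {measure set R -> \bar R}).
Hypotheses (w_meas : forall j, measurable_fun setT (w j)) (w_ge0 : forall j x, 0 <= w j x).
Hypothesis musE : forall j (A : set R), measurable A ->
  mus j A = (\int[mu]_(x in A) (w j x)%:E)%E.
Hypothesis mus_mom : has_moments mus.
Variables (k : multi_index m) (e : nat -> {poly R}).
Hypothesis e_monic : forall i, e i \is monic.
Hypothesis e_size : forall i, size (e i) = i.+1.

(** The coefficients of det L(t) do not depend on the truncation order, so they define one
    sequence. *)
Lemma linear_stat_moments n (kn : mi_norm k = n)
    (e_orth : forall r, (n <= r)%N -> mop_orthogonal mus k (e r))
    d (Omega : measurableType d) (P : probability Omega R)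
    (X : {RV P >-> n.-tuple R}) (X_mope : is_mope mu w k (distribution P X))
    (g : {poly R}) :
  exists y : nat -> R,
  [/\ y 0 = 1,
      forall q, q.+1%:R * y q.+1 = \sum_(i < q.+1) y i * stat_gen e n g (q - i)%N &
      forall q, has_integral P (fun o => linear_stat g (X o) ^+ q) (y q * q`!%:R)].
Proof.
case: n / kn e_orth X X_mope => e_orth X X_mope; set n := mi_norm k.
pose D K := stat_det k e g K.
have DS K q : (q < K)%N -> q.+1%:R * (D K)`_q.+1 =
    \sum_(i < q.+1) (D K)`_i * stat_gen e n g (q - i)%N.
  by move=> qK; rewrite block_exp_detS.
have DK K q : (q <= K)%N -> (D K)`_q = (D q)`_q.
  elim/ltn_ind: q K => -[|q] IH K qK; first by rewrite /D /stat_det !block_exp_det0.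
  apply: (@mulfI _ q.+1%:R); first by rewrite pnatr_eq0.
  rewrite !DS //; apply: eq_bigr => i _; congr (_ * _).
  have iq : (i <= q)%N by rewrite -ltnS.
  by rewrite (IH i) // ?(leq_trans iq) 1?ltnW // (IH i) // ltnW.
exists (fun q => (D q)`_q); split.
- exact: block_exp_det0.
- move=> q; rewrite DS //; apply: eq_bigr => i _; congr (_ * _).
  by rewrite DK // ltnW.
move=> q; have [_ Z0 _ _] := X_mope.
have H := has_integral_mope_density w_meas w_ge0 musE mus_mom e_monic e_size e_orth g
  (leqnn q) Z0.
have mF : measurable_fun setT (fun x : n.-tuple R => (linear_stat g x) ^+ q / q`!%:R).
  apply: measurable_funM; last exact: measurable_cst.
  by apply: measurable_funX; exact: measurable_linear_stat.
have := has_integralZ q`!%:R (mope_transfer X_mope mF H).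
rewrite mulrC; apply: has_integral_ext => o /=.
by rewrite mulrC divfK // pnatr_eq0 -lt0n fact_gt0.
Qed.

(** Apply the previous lemma to f - c, where c is the mean divided by n: only the constant term
    of the logarithmic derivative changes. *)
Lemma centered_stat_moments n (kn : mi_norm k = n)
    (e_orth : forall r, (n <= r)%N -> mop_orthogonal mus k (e r))
    d (Omega : measurableType d) (P : probability Omega R)
    (X : {RV P >-> n.-tuple R}) (X_mope : is_mope mu w k (distribution P X))
    (f : {poly R}) : (0 < n)%N ->
  let S := fun o => linear_stat f (X o) in
  exists y : nat -> R,
  [/\ y 0 = 1,
      forall q, q.+1%:R * y q.+1 =
        \sum_(i < q.+1) y i * (if (q - i)%N == 0%N then 0 else stat_gen e n f (q - i)%N) &
      forall q, has_integral P (fun o => (S o - fine ('E_P[S])%E) ^+ q) (y q * q`!%:R)].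
Proof.
move=> n0 S.
have [y [y0 yS yI]] := linear_stat_moments kn e_orth X_mope f.
have ES : fine ('E_P[S])%E = stat_gen e n f 0.
  have [_] := yI 1; rewrite factS fact0 muln1 mulr1.
  have -> : y 1 = stat_gen e n f 0.
    by have := yS 0; rewrite big_ord1 y0 !mul1r.
  move=> <-; rewrite unlock /Rintegral; congr fine.
pose c := stat_gen e n f 0 / n%:R.
have cn : c *+ n = stat_gen e n f 0.
  by rewrite -mulr_natr divfK // pnatr_eq0 -lt0n.
have [z [z0 zS zI]] := linear_stat_moments kn e_orth X_mope (f - c%:P).
exists z; split => //.
- move=> q; rewrite zS; apply: eq_bigr => i _; congr (_ * _).
  rewrite /stat_gen mxtrace_gen_subC // cn; case: eqP => [->|_].
    by rewrite mulr1n subrr.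
  by rewrite mulr0n subr0.
- move=> q; have := zI q; apply: has_integral_ext => o; congr (_ ^+ _).
  rewrite ES -cn /S /linear_stat -[X in _ - c *+ X]card_ord -sumr_const -sumrB.
  by apply: eq_bigr => j _; rewrite !hornerE.
Qed.
End CenteredMoments.

(** * Convergence of moments implies convergence in distribution *)

Section Bernstein.
Variable R : realType.
Implicit Types (F G : nat -> R) (x y c : R).

(** Bernstein operators, by de Casteljau's recursion: [bernstein n F x] is the expectation of
    F(S) for a binomial variable S with parameters n and x. *)
Fixpoint bernstein n F x : R :=
  if n is n'.+1 then (1 - x) * bernstein n' F x + x * bernstein n' (F \o S) x else F 0%N.

Lemma bernstein_linear n F G c x :
  bernstein n (fun k => c * F k + G k) x = c * bernstein n F x + bernstein n G x.
Proof.
elim: n F G => [|n IH] F G //=.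
by rewrite IH -[_ \o S]/(fun k => c * (F \o S) k + (G \o S) k) IH; ring.
Qed.

Lemma bernstein_le n F G x : 0 <= x <= 1 ->
  (forall k, (k <= n)%N -> F k <= G k) -> bernstein n F x <= bernstein n G x.
Proof.
move=> /andP[x0 x1]; elim: n F G => [|n IH] F G FG /=; first exact: FG.
apply: lerD; apply: ler_wpM2l => //; rewrite ?subr_ge0 //; apply: IH => k kn.
  by apply: FG; rewrite (leq_trans kn).
exact: FG.
Qed.

Lemma bernstein_cst n c x : bernstein n (fun=> c) x = c.
Proof. by elim: n => //= n IH; rewrite -[_ \o S]/(fun=> c) IH; ring. Qed.

(** Second moment of a binomial variable around c. *)
Lemma bernstein_var n c x :
  bernstein n (fun k => (k%:R - c) ^+ 2) x = n%:R * x * (1 - x) + (n%:R * x - c) ^+ 2.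
Proof.
elim: n c => [|n IH] c /=; first by ring.
have -> : (fun k : nat => (k%:R - c) ^+ 2) \o S = (fun k : nat => (k%:R - (c - 1)) ^+ 2 : R).
  by apply/funext => k /=; rewrite -natr1; congr (_ ^+ 2); ring.
by rewrite !IH -natr1; ring.
Qed.

Lemma uniformly_continuous_01 (g : R -> R) eps : continuous g -> 0 < eps ->
  exists2 delta, 0 < delta &
    forall x y, 0 <= x <= 1 -> `|x - y| < delta -> `|g x - g y| < eps.
Proof.
move=> gc e0; have := @segment_compact R 0 1 => /compact_near_coveringP.
move=> /(_ R (0^'+) (fun (delta x : R) => forall y, `|x - y| < delta -> `|g x - g y| < eps) _).
case.
  move=> x _; have e20 : 0 < eps / 2 by rewrite divr_gt0.
  have /cvgrPdist_lt /(_ _ e20) := gc x.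
  move=> /nbhs_ballP [eta /= eta0 H].
  exists (ball x (eta / 2), [set t : R | t < eta / 2]) => /=.
    split; first by apply: nbhsx_ballx; rewrite divr_gt0.
    by apply: nbhs_right_lt; rewrite divr_gt0.
  move=> [x' t] /= [xx' teta] y x'y.
  have h1 : `|g x - g x'| < eps / 2.
    by apply: H; apply: lt_trans xx' _; rewrite ltr_pdivrMr // ltr_pMr // ltr1n.
  have h2 : `|g x - g y| < eps / 2.
    apply: H; rewrite /ball /= (_ : x - y = (x - x') + (x' - y)); last by ring.
    apply: le_lt_trans (ler_normD _ _) _; rewrite [ltRHS]splitr ltrD //.
    exact: lt_trans teta.
  rewrite (_ : g x' - g y = (g x - g y) - (g x - g x')); last by ring.
  by apply: le_lt_trans (ler_normB _ _) _; rewrite [ltRHS]splitr ltrD.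
move=> e /= e0' H; exists (e / 2); first by rewrite divr_gt0.
move=> x y x01 xy; apply: (H (e / 2)) => //=.
- by rewrite sub0r normrN gtr0_norm ?divr_gt0 // ltr_pdivrMr // ltr_pMr // ltr1n.
- by rewrite divr_gt0.
Qed.

(** Chebyshev's argument: |g(y) - g(x)| <= eps / 2 + K (y - x)^2, and the operator is positive,
    fixes constants and sends the square to x (1 - x) / n. *)
Lemma bernstein_approx (g : R -> R) M eps : continuous g -> (forall x, `|g x| <= M) -> 0 < eps ->
  exists n, forall x, 0 <= x <= 1 ->
    `|bernstein n (fun k => g (k%:R / n%:R)) x - g x| <= eps.
Proof.
move=> gc gM e0.
have e20 : 0 < eps / 2 by rewrite divr_gt0.
have [delta d0 gd] := uniformly_continuous_01 gc e20.
have M0 : 0 <= M by apply: le_trans (gM 0).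
have K0 : 0 <= 2 * M / delta ^+ 2 by rewrite divr_ge0 ?mulr_ge0 ?exprn_ge0 // ltW.
set K := 2 * M / delta ^+ 2 in K0.
(* The variance term is at most K / n. *)
pose n := (Num.truncn (K / (eps / 2))).+1.
have n0 : 0 < n%:R :> R by rewrite ltr0n.
have nK : K / n%:R <= eps / 2.
  rewrite ler_pdivrMr // mulrC -ler_pdivrMr //; apply: ltW; exact: truncnS_gt.
exists n => x x01; have /andP[x0 x1] := x01.
have key k : `|g (k%:R / n%:R) - g x| <=
    K / n%:R ^+ 2 * (k%:R - n%:R * x) ^+ 2 + eps / 2.
  have -> : K / n%:R ^+ 2 * (k%:R - n%:R * x) ^+ 2 = K * (k%:R / n%:R - x) ^+ 2.
    by field; rewrite lt0r_neq0.
  case: (ltP `|x - k%:R / n%:R| delta) => h.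
    rewrite distrC; apply: le_trans (ltW (gd _ _ x01 h)) _.
    by rewrite lerDr mulr_ge0 // sqr_ge0.
  apply: (@le_trans _ _ (2 * M)).
    by apply: le_trans (ler_normB _ _) _; rewrite mulr2n mulrDl mul1r lerD.
  rewrite -[leLHS]addr0 lerD ?(ltW e20) // /K mulrAC ler_pdivlMr ?exprn_gt0 //.
  apply: ler_wpM2l; first by rewrite mulr_ge0.
  rewrite -(real_normK (num_real (k%:R / n%:R - x))) distrC.
  by rewrite lerXn2r // nnegrE // ltW.
pose V := fun k : nat => K / n%:R ^+ 2 * (k%:R - n%:R * x) ^+ 2 + eps / 2.
have VE : bernstein n V x <= eps.
  rewrite /V bernstein_linear bernstein_cst bernstein_var subrr expr0n /= addr0.
  rewrite [leRHS]splitr lerD2r.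
  have -> : K / n%:R ^+ 2 * (n%:R * x * (1 - x)) = K / n%:R * (x * (1 - x)).
    by field; rewrite lt0r_neq0.
  apply: le_trans nK; rewrite -[leRHS]mulr1; apply: ler_wpM2l; first by rewrite divr_ge0 // ltW.
  by rewrite mulr_ile1 // ?subr_ge0 // gerBl.
rewrite -{1}(bernstein_cst n (g x) x) ler_norml.
set A := fun k : nat => g (k%:R / n%:R).
have lin1 : bernstein n (fun k => -1 * g x + A k) x = bernstein n A x - g x.
  by rewrite (bernstein_linear n (fun=> g x)) bernstein_cst mulN1r addrC.
rewrite (_ : bernstein n A x - _ = bernstein n (fun k => -1 * g x + A k) x); last first.
  by rewrite lin1 bernstein_cst.
apply/andP; split.
  rewrite lerNl.
  have -> : - bernstein n (fun k => -1 * g x + A k) x =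
    bernstein n (fun k => -1 * (-1 * g x + A k) + 0) x.
    have := bernstein_linear n (fun k => -1 * g x + A k) (fun=> 0) (-1) x.
    by move=> ->; rewrite bernstein_cst; ring.
  apply: le_trans VE; apply: bernstein_le => // k _.
  have -> : -1 * (-1 * g x + A k) + 0 = - (g (k%:R / n%:R) - g x) by rewrite /A; ring.
  by rewrite lerNl; have := key k; rewrite ler_norml => /andP[].
apply: le_trans VE; apply: bernstein_le => // k _.
have -> : -1 * g x + A k = g (k%:R / n%:R) - g x by rewrite /A; ring.
by have := key k; rewrite ler_norml => /andP[].
Qed.
End Bernstein.

Section SinTaylor.
Variable R : realType.
Implicit Types (th s t y : R).

(** The k-th derivative of the sine is its translate by k pi / 2. The factor [s] is the sign of
    the variable, which reduces the remainder estimate to [y >= 0]. *)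
Definition sin_taylor K th s y : R :=
  \sum_(k < K) s ^+ k * sin (th + k%:R * (pi / 2)) * (y ^+ k / k`!%:R).

Lemma is_derive_monomial k y :
  is_derive y 1 (fun y => y ^+ k.+1 / k.+1`!%:R : R) (y ^+ k / k`!%:R).
Proof.
have -> : (fun y => y ^+ k.+1 / k.+1`!%:R : R) = (k.+1`!%:R)^-1 \*: (fun y => y ^+ k.+1).
  by apply/funext => z /=; rewrite mulrC.
have h : is_derive y 1 (fun y : R => y ^+ k.+1) (k.+1%:R * y ^+ k).
  have := is_deriveX k.+1 (is_derive_id y (1 : R)).
  rewrite /GRing.scale /= mulr1; have -> // : id ^+ k.+1 = (fun y : R => y ^+ k.+1).
  by apply/funext => z; rewrite exprfctE.
apply: is_derive_eq; rewrite /GRing.scale /= factS natrM.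
have : k`!%:R != 0 :> R by rewrite pnatr_eq0 -lt0n fact_gt0.
have : k.+1%:R != 0 :> R by rewrite pnatr_eq0.
by move=> h1 h2; rewrite invfM mulrACA mulVf // mul1r mulrC.
Qed.

Lemma is_derive_sin_taylor K th s y :
  is_derive y 1 (sin_taylor K.+1 th s) (s * sin_taylor K (th + pi / 2) s y).
Proof.
have -> : sin_taylor K.+1 th s = cst (sin th) +
   \sum_(k < K) (s ^+ k.+1 * sin (th + k.+1%:R * (pi / 2))) \*: (fun y => y ^+ k.+1 / k.+1`!%:R).
  apply/funext => z; rewrite /sin_taylor big_ord_recl /= expr0 mul0r addr0 mul1r mul1r divr1.
  by rewrite /= fctE fct_sumE.
have h (k : 'I_K) := is_derive_monomial k y.
apply: is_derive_eq; rewrite add0r /sin_taylor mulr_sumr; apply: eq_bigr => k _.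
rewrite /GRing.scale /= exprS -natr1 !mulrA; congr (_ * _ * sin _ * _ / _); last by ring.
Qed.

(** The derivative of the remainder of order K + 1 is s times the remainder of order K, so the
    bound integrates. *)
Lemma sin_taylor_bound_pos K th s y : `|s| <= 1 -> 0 <= y ->
  `|sin (th + s * y) - sin_taylor K th s y| <= y ^+ K / K`!%:R.
Proof.
move=> s1; elim: K th y => [|K IH] th y y0.
  by rewrite /sin_taylor big_ord0 subr0 divr1 ler_norml sin_geN1 sin_le1.
have mono (D : R -> R) (D' : R -> R) : (forall z : R, is_derive z 1 D (D' z)) ->
    (forall z, 0 <= z -> 0 <= D' z) -> D 0 = 0 -> 0 <= D y.
  move=> DD D'0 <-.
  have := @ger0_derive1_ndecry R D 0.
  have Dd (z : R) : derivable D z 1 by [].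
  move=> /(_ (fun z _ => Dd z)); apply => //.
  - move=> z; rewrite in_itv /= andbT => z0; rewrite derive1E derive_val; exact: D'0 (ltW z0).
  - by apply: continuous_subspaceT => z; apply/differentiable_continuous/derivable1_diffP.
pose D z := sin (th + s * z) - sin_taylor K.+1 th s z.
have DD (z : R) : is_derive z 1 D (s
  * (sin (th + pi / 2 + s * z) - sin_taylor K (th + pi / 2) s z)).
  have h := is_derive_sin_taylor K th s z.
  have h2 : is_derive z 1 (fun z => sin (th + s * z)) (s * cos (th + s * z)).
    apply: is_derive_eq; rewrite add0r /GRing.scale /= mulr1.
    by rewrite mulrC mul1r.
  by apply: is_derive_eq; rewrite mulrBr addrAC sinDpihalf.
have D0 : D 0 = 0.
  rewrite /D /sin_taylor big_ord_recl big1 ?addr0.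
    by rewrite !expr0 !mul0r !addr0 divr1 mulr0 addr0 mul1r mulr1 subrr.
  by move=> i _; rewrite expr0n /= mul0r mulr0.
have DB z : 0 <= z ->
    `|s * (sin (th + pi / 2 + s * z) - sin_taylor K (th + pi / 2) s z)| <= z ^+ K / K`!%:R.
  by move=> z0; rewrite normrM -[leRHS]mul1r ler_pM // IH.
rewrite ler_norml; apply/andP; split.
  rewrite -subr_ge0 opprK.
  apply: (mono (fun z => D z + z ^+ K.+1 / K.+1`!%:R)
    (fun z => s * (sin (th + pi / 2 + s * z) - sin_taylor K (th + pi / 2) s z) + z ^+ K / K`!%:R)).
  - by move=> z; have h := is_derive_monomial K z; exact: is_deriveD.
  - by move=> z /DB; rewrite ler_norml => /andP[h _]; rewrite -lerBlDr sub0r.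
  - by rewrite D0 expr0n /= mul0r addr0.
rewrite -subr_ge0.
apply: (mono (fun z => z ^+ K.+1 / K.+1`!%:R - D z)
  (fun z => z ^+ K / K`!%:R - s * (sin (th + pi / 2 + s * z) - sin_taylor K (th + pi / 2) s z))).
- by move=> z; have h := is_derive_monomial K z; exact: is_deriveB.
- by move=> z /DB; rewrite ler_norml => /andP[_ h]; rewrite subr_ge0.
- by rewrite D0 expr0n /= mul0r subr0.
Qed.

Lemma sin_taylor_bound K th t y :
  `|sin (th + t * y) - sin_taylor K th 1 (t * y)| <= `|t * y| ^+ K / K`!%:R.
Proof.
set z := t * y; have := @sin_taylor_bound_pos K th (Num.sg z) `|z| _ (normr_ge0 _).
rewrite -numEsg; have -> : sin_taylor K th (Num.sg z) `|z| = sin_taylor K th 1 z.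
  apply: eq_bigr => k _; rewrite expr1n mul1r {3}(numEsg z) exprMn.
  by rewrite !mulrA; congr (_ * _ / _); rewrite mulrC.
by apply; rewrite normr_sg; case: (_ != 0).
Qed.
End SinTaylor.

Section MomentMethod.
Variable R : realType.
Implicit Types (F G : R -> R) (E : (R -> R) -> R).

(** Powers of 1 + y^2 are monotone in the exponent, which makes sums and products immediate. *)
Definition tame F := continuous F /\ exists C q, forall y, `|F y| <= C * (1 + y ^+ 2) ^+ q.

Lemma le1_weight (y : R) : 1 <= 1 + y ^+ 2. Proof. by rewrite lerDl sqr_ge0. Qed.

Lemma tame_bounded F M : continuous F -> (forall y, `|F y| <= M) -> tame F.
Proof. by move=> Fc FM; split => //; exists M, 0 => y; rewrite expr0 mulr1. Qed.

Lemma tame_cst c : tame (fun=> c).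
Proof. by apply: (@tame_bounded _ `|c|) => // y; exact: cvg_cst. Qed.

Lemma tame_id : tame id.
Proof.
split; first by move=> y; exact: cvg_id.
exists 1, 1 => y; rewrite mul1r expr1 -[y ^+ 2]real_normK ?num_real //.
have := sqr_ge0 (`|y| - 1); have := sqr_ge0 `|y|; rewrite /=; nra.
Qed.

Lemma tameM F G : tame F -> tame G -> tame (fun y => F y * G y).
Proof.
move=> [Fc [C [p FC]]] [Gc [D [q GD]]]; split; first by move=> y; apply: cvgM;
  [exact: Fc|exact: Gc].
exists (C * D), (p + q)%N => y; rewrite normrM exprD mulrACA.
by apply: ler_pM.
Qed.

Lemma tameX F k : tame F -> tame (fun y => F y ^+ k).
Proof.
move=> tF; elim: k => [|k IH].
  by under [X in tame X]eq_fun do rewrite expr0; exact: tame_cst.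
by under [X in tame X]eq_fun do rewrite exprS; exact: tameM.
Qed.

Lemma tameD F G : tame F -> tame G -> tame (fun y => F y + G y).
Proof.
move=> [Fc [C [p FC]]] [Gc [D [q GD]]]; split; first by move=> y; apply: cvgD;
  [exact: Fc|exact: Gc].
have C0 : 0 <= C by have := le_trans (normr_ge0 _) (FC 0); rewrite expr0n addr0 expr1n mulr1.
have D0 : 0 <= D by have := le_trans (normr_ge0 _) (GD 0); rewrite expr0n addr0 expr1n mulr1.
exists (C + D), (p + q)%N => y; apply: le_trans (ler_normD _ _) _.
rewrite mulrDl lerD //; [apply: le_trans (FC y) _|apply: le_trans (GD y) _].
  by rewrite ler_wpM2l // ler_weXn2l ?le1_weight // leq_addr.
by rewrite ler_wpM2l // ler_weXn2l ?le1_weight // leq_addl.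
Qed.

Lemma tameZ c F : tame F -> tame (fun y => c * F y).
Proof. by move=> tF; apply: tameM => //; exact: tame_cst. Qed.

Lemma tame_sin th t : tame (fun y => sin (th + t * y)).
Proof.
apply: (@tame_bounded _ 1) => y; last by rewrite ler_norml sin_geN1 sin_le1.
apply: continuous_comp; last exact: continuous_sin.
by apply: cvgD; [exact: cvg_cst|apply: cvgM; [exact: cvg_cst|exact: cvg_id]].
Qed.

(** The properties of F |-> E F(Y), for a random variable Y with moments of all orders, that
    the method of moments uses. *)
Record expectation_like E : Prop := ExpectationLike {
  expect1 : E (fun=> 1) = 1;
  expect_linear : forall c F G, tame F -> tame G -> E (fun y => c * F y + G y) = c * E F + E G;
  expect_le : forall F G, tame F -> tame G -> (forall y, F y <= G y) -> E F <= E G }.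

Section OneFunctional.
Variables (E : (R -> R) -> R) (EE : expectation_like E).

Lemma expect_cst c : E (fun=> c) = c.
Proof.
have E0 : E (fun=> 0) = 0.
  have <- : (fun=> -1 * 1 + 1) = (fun=> 0) :> (R -> R) by apply/funext => y; ring.
  by rewrite (expect_linear EE) ?(expect1 EE); [ring|exact: tame_cst..].
have := expect_linear EE c (tame_cst 1) (tame_cst 0).
rewrite (expect1 EE) E0.
have -> : (fun=> c * 1 + 0) = (fun=> c) :> (R -> R) by apply/funext => y; ring.
by move=> ->; ring.
Qed.

Lemma expectZ c F : tame F -> E (fun y => c * F y) = c * E F.
Proof.
move=> tF; have := expect_linear EE c tF (tame_cst 0).
by rewrite expect_cst addr0; under eq_fun do rewrite addr0.
Qed.

Lemma expect_dist F G B : tame F -> tame G -> tame B -> (forall y, `|F y - G y| <= B y) ->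
  `|E F - E G| <= E B.
Proof.
move=> tF tG tB FGB; rewrite ler_norml; apply/andP; split.
  rewrite lerNl opprB lerBlDr -[E F]mul1r addrC -(expect_linear EE) //.
  apply: (expect_le EE) => // [|y]; first by apply: tameD => //; exact: tameZ.
  by have := FGB y; rewrite ler_norml mul1r => /andP[+ _]; rewrite lerNl opprB lerBlDr addrC.
rewrite lerBlDr -[E G]mul1r addrC -(expect_linear EE) //.
apply: (expect_le EE) => // [|y]; first by apply: tameD => //; exact: tameZ.
by have := FGB y; rewrite ler_norml mul1r => /andP[_]; rewrite lerBlDr addrC.
Qed.
End OneFunctional.

Variables (En : nat -> (R -> R) -> R) (Q : (R -> R) -> R).
Hypotheses (EnE : forall n, expectation_like (En n)) (QE : expectation_like Q).
Hypothesis moments_cvg : forall q, En n (fun y => y ^+ q) @[n --> \oo] --> Q (fun y => y ^+ q).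
Hypothesis moments_growth : forall t eps : R, 0 < eps -> exists r,
  `|t| ^+ (2 * r) * Q (fun y => y ^+ (2 * r)) / (2 * r)`!%:R < eps.

Let good F := tame F /\ En n F @[n --> \oo] --> Q F.

(** It suffices to approximate F by functions whose expectations converge, with an error
    controlled by such functions. *)
Lemma cvg_expect_approx F : tame F ->
  (forall eps, 0 < eps -> exists G B, [/\ good G, good B, Q B < eps &
     forall y, `|F y - G y| <= B y]) ->
  En n F @[n --> \oo] --> Q F.
Proof.
move=> tF app; apply/cvgrPdist_lt => eps e0.
have e30 : 0 < eps / 3 by rewrite divr_gt0.
have [G [B [[tG cG] [tB cB] QB FGB]]] := app _ e30.
have hQ := expect_dist QE tF tG tB FGB.
have h1 : \forall n \near \oo, `|Q G - En n G| < eps / 3.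
  by move/cvgrPdist_lt : cG; apply.
have h2 : \forall n \near \oo, `|Q B - En n B| < eps / 3 - Q B.
  by move/cvgrPdist_lt : cB; apply; rewrite subr_gt0.
near=> n.
have hE := expect_dist (EnE n) tF tG tB FGB.
have := near h1 n _; have := near h2 n _.
move=> /(_ _)/wrap[//|]; rewrite ltr_norml => /andP[h2' _] /(_ _)/wrap[//|] h1'.
have -> : Q F - En n F = (Q F - Q G) + (Q G - En n G) - (En n F - En n G) by ring.
apply: le_lt_trans (ler_normB _ _) _; apply: le_lt_trans (lerD (ler_normD _ _) (lexx _)) _.
lra.
Unshelve. all: end_near. Qed.

Lemma good_lin c F G : good F -> good G -> good (fun y => c * F y + G y).
Proof.
move=> [tF cF] [tG cG]; split; first by apply: tameD => //; exact: tameZ.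
under eq_fun do rewrite (expect_linear (EnE _)) //; rewrite (expect_linear QE) //.
by apply: cvgD => //; apply: cvgM => //; exact: cvg_cst.
Qed.

Lemma good_cst c : good (fun=> c).
Proof.
split; first exact: tame_cst.
by under eq_fun do rewrite (expect_cst (EnE _)); rewrite (expect_cst QE); exact: cvg_cst.
Qed.

Lemma goodZ c F : good F -> good (fun y => c * F y).
Proof.
move=> gF; have := good_lin c gF (good_cst 0).
by under eq_fun do rewrite addr0.
Qed.

Lemma good_pow q : good (fun y => y ^+ q).
Proof. by split; [exact: tameX tame_id|exact: moments_cvg]. Qed.

Lemma good_sum K (F : nat -> R -> R) : (forall k, good (F k)) ->
  good (fun y => \sum_(k < K) F k y).
Proof.
move=> gF; elim: K => [|K IH].
  by under [X in good X]eq_fun do rewrite big_ord0; exact: good_cst.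
under [X in good X]eq_fun do rewrite big_ord_recr /= addrC -[F _ _]mul1r.
exact: good_lin.
Qed.

(** The Taylor remainder is dominated by a moment, which is small by [moments_growth]. *)
Lemma good_sin th t : good (fun y => sin (th + t * y)).
Proof.
split; first exact: tame_sin.
apply: cvg_expect_approx; first exact: tame_sin.
move=> eps e0; have [r hr] := moments_growth t e0.
exists (fun y => sin_taylor (2 * r) th 1 (t * y)),
  (fun y => `|t| ^+ (2 * r) / (2 * r)`!%:R * y ^+ (2 * r)).
split.
- apply: (@good_sum _ (fun k y =>
  1 ^+ k * sin (th + k%:R * (pi / 2)) * ((t * y) ^+ k / k`!%:R))) => k.
  have -> : (fun y => 1 ^+ k * sin (th + k%:R * (pi / 2)) * ((t * y) ^+ k / k`!%:R)) =
    (fun y => (sin (th + k%:R * (pi / 2)) * t ^+ k / k`!%:R) * y ^+ k).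
    by apply/funext => y; rewrite expr1n mul1r exprMn -!mulrA; congr (_ * (_ * _)); rewrite mulrC.
  by apply: goodZ; exact: good_pow.
- by apply: goodZ; exact: good_pow.
- by rewrite (expectZ QE); [rewrite (mulrAC _ _ (Q _)); exact: hr|exact: tameX tame_id].
- move=> y; apply: le_trans (sin_taylor_bound _ _ _ _) _.
  have ye : `|y| ^+ (2 * r) = y ^+ (2 * r) by rewrite !exprM real_normK ?num_real.
  by rewrite normrM exprMn ye mulrAC.
Qed.

Lemma sin_sin (x u : R) : sin x * sin u = 2^-1 * (sin (x - u + pi / 2) - sin (x + u + pi / 2)).
Proof. by rewrite !sinDpihalf cosB cosD; field. Qed.

(** Induction on the degree, for all phases and frequencies at once: the product of two sines is
    a difference of two sines. *)
Lemma good_bernstein_sin n (F : nat -> R) u th t :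
  good (fun y => sin (th + t * y) * bernstein n F ((1 + sin (u * y)) / 2)).
Proof.
elim: n F th t => [|n IH] F th t /=.
  by under [X in good X]eq_fun do rewrite mulrC; apply: goodZ; exact: good_sin.
have -> : (fun y => sin (th + t * y)
  * ((1 - (1 + sin (u * y)) / 2) * bernstein n F ((1 + sin (u * y)) / 2) +
     (1 + sin (u * y)) / 2 * bernstein n (F \o S) ((1 + sin (u * y)) / 2))) =
  (fun y => 2^-1 * (sin (th + t * y) * bernstein n F ((1 + sin (u * y)) / 2)) +
    (2^-1 * (sin (th + t * y) * bernstein n (F \o S) ((1 + sin (u * y)) / 2)) +
    (- 4^-1 * (sin (th + pi / 2 + (t - u) * y) * bernstein n F ((1 + sin (u * y)) / 2)) +
    (4^-1 * (sin (th + pi / 2 + (t + u) * y) * bernstein n F ((1 + sin (u * y)) / 2)) +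
    (4^-1 * (sin (th + pi / 2 + (t - u) * y) * bernstein n (F \o S) ((1 + sin (u * y)) / 2)) +
    (- 4^-1 * (sin (th + pi / 2 + (t + u) * y)
      * bernstein n (F \o S) ((1 + sin (u * y)) / 2)))))))).
  apply/funext => y; have := sin_sin (th + t * y) (u * y).
  have -> : th + t * y - u * y + pi / 2 = th + pi / 2 + (t - u) * y by ring.
  have -> : th + t * y + u * y + pi / 2 = th + pi / 2 + (t + u) * y by ring.
  set s1 := sin (th + pi / 2 + (t - u) * y); set s2 := sin (th + pi / 2 + (t + u) * y).
  move: (sin (th + t * y)) (sin (u * y)) => s v e.
  move: (bernstein n F _) (bernstein n (F \o S) _) => B1 B2.
  have -> : s * ((1 - (1 + v) / 2) * B1 + (1 + v) / 2 * B2) =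
     2^-1 * (s * B1) + (2^-1 * (s * B2) + (- 2^-1 * (s * v) * B1 + 2^-1 * (s * v) * B2)) by field.
  by rewrite e; field.
by do 5!apply: good_lin => //; apply: goodZ.
Qed.

(** On [-T, T] the variable y is recovered from sin(y / T) by the arcsine, so h is uniformly
    close to a polynomial in sin(y / T) there; outside, both functions are bounded and
    y^2 / T^2 > 1, which Chebyshev's inequality controls. *)
Lemma moments_cvg_bounded (h : R -> R) M : continuous h -> (forall x, `|h x| <= M) ->
  En n h @[n --> \oo] --> Q h.
Proof.
move=> hc hM; have M0 : 0 <= M by apply: le_trans (hM 0).
apply: cvg_expect_approx => [|eps e0]; first exact: tame_bounded hM.
pose eps' := eps / 3; have e'0 : 0 < eps' by rewrite divr_gt0.
pose V := Q (fun y => y ^+ 2).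
have V0 : 0 <= V.
  rewrite -(expect_cst QE 0); apply: (expect_le QE) => //; [exact: tame_cst|exact: tameX tame_id|].
  by move=> y; exact: sqr_ge0.
pose L := 2 * M + eps'; have L0 : 0 < L by rewrite ltr_wpDl ?mulr_ge0.
(* T is chosen so that the tail term L y^2 / T^2 has expectation at most eps'. *)
pose T2 := 1 + L * V / eps'.
have T20 : 0 < T2 by rewrite ltr_pwDl // divr_ge0 ?mulr_ge0 // ltW.
pose T := Num.sqrt T2; have T0 : 0 < T by rewrite sqrtr_gt0.
have TT : T ^+ 2 = T2 by rewrite sqr_sqrtr // ltW.
pose s1 : R := sin 1.
have pi2 := pihalf_ge1 R.
have s10 : 0 < s1 by apply: sin_gt0_pi;
  rewrite ?in_itv /= ltr01 /= (lt_le_trans _ (pi_ge2 R)) // ltr1n.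
have s11 : s1 < 1.
  have c1 : 0 < cos (1 : R).
    exact: cos1_gt0.
  have := cos2Dsin2 (1 : R); rewrite -/s1 => cs1.
  have : 0 < cos (1 : R) ^+ 2 by rewrite exprn_gt0.
  move=> ?; rewrite -(ltr_pXn2r (n := 2)) ?nnegrE ?(ltW s10) // expr1n; lra.
(* Clamping to [- sin 1, sin 1] keeps the arcsine away from the points where it is not
  differentiable; it has no effect when |y| <= T. *)
pose cl z := Num.max (- s1) (Num.min s1 z).
pose g x := h (T * asin (cl (2 * x - 1))).
have clb z : -1 < cl z < 1.
  by rewrite /cl lt_max ltrN2 s11 /= gt_max ltrNl (lt_trans _ s10) ?oppr_lt0 //= gt_min s11.
have gc : continuous g.
  move=> x; apply: continuous_comp; last exact: hc.
  apply: cvgM; first exact: cvg_cst.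
  apply: continuous_comp; last by apply: continuous_asin.
  apply: (@continuous_max R R (cst (- s1)) (fun x => Num.min s1 (2 * x - 1))); first exact: cvg_cst.
  apply: (@continuous_min R R (cst s1) (fun x => 2 * x - 1)); first exact: cvg_cst.
  by apply: cvgB; [apply: cvgM; [exact: cvg_cst|exact: cvg_id]|exact: cvg_cst].
have gM x : `|g x| <= M by exact: hM.
have [n happ] := bernstein_approx gc gM e'0.
exists (fun y => bernstein n (fun k => g (k%:R / n%:R)) ((1 + sin (T^-1 * y)) / 2)),
  (fun y => eps' + L / T2 * y ^+ 2).
have x01 y : 0 <= (1 + sin (T^-1 * y)) / 2 <= 1.
  have := sin_geN1 (T^-1 * y); have := sin_le1 (T^-1 * y); lra.
split.
- have := good_bernstein_sin n (fun k => g (k%:R / n%:R)) T^-1 (pi / 2) 0.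
  by under [X in good X]eq_fun do rewrite mul0r addr0 sin_pihalf mul1r.
- under [X in good X]eq_fun do rewrite addrC; apply: good_lin; [exact: good_pow|exact: good_cst].
- under eq_fun do rewrite addrC.
  rewrite (expect_linear QE) ?(expect_cst QE) -/V; [|exact: tameX tame_id|exact: tame_cst].
  have : L / T2 * V <= eps'.
    rewrite mulrAC ler_pdivrMr // /T2 mulrDr mulr1 mulrCA divff ?lt0r_neq0 // mulr1.
    by rewrite lerDr ltW.
  by rewrite /eps'; lra.
move=> y; case: (lerP `|y| T) => yT.
  have yT1 : -1 <= T^-1 * y <= 1.
    by rewrite -ler_norml normrM gtr0_norm ?invr_gt0 // mulrC ler_pdivrMr // mul1r.
  have -> : h y = g ((1 + sin (T^-1 * y)) / 2).
    rewrite /g; congr h.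
    have -> : 2 * ((1 + sin (T^-1 * y)) / 2) - 1 = sin (T^-1 * y) by field.
    have mono := @ltr_sin R.
    have itv (z : R) : -1 <= z <= 1 -> z \in `[(- (pi / 2)), pi / 2].
      by move=> /andP[? ?]; rewrite in_itv /=; apply/andP; split; lra.
    have l1 : sin (T^-1 * y) <= s1.
      by rewrite leNgt mono ?itv -?leNgt ?lexx //; lra.
    have l2 : - s1 <= sin (T^-1 * y).
      by rewrite -sinN leNgt mono ?itv -?leNgt ?lexx //; lra.
    rewrite /cl min_r // max_r // sinK ?itv //.
    by rewrite mulrA divff ?mul1r // lt0r_neq0.
  rewrite distrC; apply: le_trans (happ _ (x01 y)) _.
  by rewrite lerDl mulr_ge0 ?sqr_ge0 // divr_ge0 // ltW.
have bB : `|bernstein n (fun k => g (k%:R / n%:R)) ((1 + sin (T^-1 * y)) / 2)| <= M + eps'.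
  have := happ _ (x01 y); set b := bernstein _ _ _; set gg := g _ => hb.
  rewrite (_ : b = gg + (b - gg)); last by ring.
  by apply: le_trans (ler_normD _ _) _; rewrite lerD // gM.
apply: le_trans (ler_normB _ _) _; apply: (@le_trans _ _ L).
  by apply: le_trans (lerD (hM y) bB) _; rewrite /L; lra.
apply: (@le_trans _ _ (L / T2 * y ^+ 2)); last by rewrite lerDr ltW.
rewrite mulrAC ler_pdivlMr // ler_pM2l // -TT -[y ^+ 2]real_normK ?num_real //.
by rewrite lerXn2r // ?nnegrE ltW.
Qed.
End MomentMethod.

(** * Moments of the normal law *)

Section IntegralFunctional.
Context d (T : measurableType d) (R : realType) (P : probability T R).
Variables (Y : T -> R) (M : nat -> R).
Hypothesis mY : measurable_fun setT Y.
Hypothesis YM : forall q, has_integral P (fun o => Y o ^+ q) (M q).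

Lemma integrable_tame (F : R -> R) : tame F -> P.-integrable setT (EFin \o (F \o Y)).
Proof.
move=> [Fc [C [q FC]]].
have iW : P.-integrable setT (EFin \o (fun o => C * (1 + Y o ^+ 2) ^+ q)).
  have H : has_integral P (fun o => \sum_(i < q.+1) (C *+ 'C(q, i)) * Y o ^+ (2 * i))
    (\sum_(i < q.+1) (C *+ 'C(q, i)) * M (2 * i)%N).
    by apply: has_integral_sum => i _; apply: has_integralZ; exact: YM.
  have [+ _] := H; apply: eq_integrable => // o _; rewrite /= exprDn mulr_sumr; congr EFin.
  by apply: eq_bigr => i _; rewrite expr1n mul1r -exprM mulrnAl mulrnAr.
apply: le_integrable iW => //.
  apply/measurable_EFinP; apply: measurableT_comp => //.
  exact: continuous_measurable_fun.
by move=> o _; rewrite /= lee_fin (le_trans (FC _)) // ler_norm.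
Qed.

Lemma expectation_like_integral : expectation_like (fun F => \int[P]_o F (Y o)).
Proof.
split.
- rewrite Rintegral_cst // mul1r; exact: (congr1 fine (probability_setT P)).
- move=> c F G tF tG; rewrite RintegralD //.
  + by rewrite RintegralZl //; exact: integrable_tame.
  + by have := integrable_tame (tameZ c tF).
  + exact: integrable_tame.
- move=> F G tF tG FG; apply: le_Rintegral => //;
  by [exact: (integrable_tame tF)|exact: (integrable_tame tG)].
Qed.

Lemma expectation_bounded (h : R -> R) B : continuous h -> (forall x, `|h x| <= B) ->
  ('E_P[h \o Y])%E = (\int[P]_o h (Y o))%:E.
Proof.
move=> hc hB; rewrite unlock /Rintegral fineK //.
exact: (integrable_fin_num measurableT (integrable_tame (tame_bounded hc hB))).
Qed.
End IntegralFunctional.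

Section GaussianMoments.
Variable R : realType.
Implicit Types (v x : R).

Lemma gaussian_moment_even v r :
  gaussian_moment v (2 * r) / (2 * r)`!%:R = (v / 2) ^+ r / r`!%:R.
Proof.
elim: r => [|r IH]; first by rewrite muln0 expr0.
have -> : (2 * r.+1 = (2 * r).+2)%N by lia.
rewrite gaussian_momentSS exprS factS [(2 * r).+1`!]factS [r.+1`!]factS !natrM.
have f0 k : k`!%:R != 0 :> R by rewrite pnatr_eq0 -lt0n fact_gt0.
have -> : gaussian_moment v (2 * r) = (v / 2) ^+ r / r`!%:R * (2 * r)`!%:R.
  by rewrite -IH divfK.
have -> : (2 * r).+2%:R = 2 * r.+1%:R :> R by rewrite -natrM; congr _%:R; lia.
have n1 : (2 * r).+1%:R != 0 :> R by rewrite pnatr_eq0.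
have n2 : r.+1%:R != 0 :> R by rewrite pnatr_eq0.
move: (f0 r) (f0 (2 * r)%N) n1 n2.
move: (r`!%:R) ((2 * r)`!%:R) ((2 * r).+1%:R) (r.+1%:R) ((v / 2) ^+ r) => A B C D E A0 B0 C0 D0.
by field; rewrite A0 B0 C0 D0.
Qed.

(** By [gaussian_moment_even] these are the terms of an exponential series. *)
Lemma gaussian_moment_growth v (t eps : R) : 0 < eps -> exists r,
  `|t| ^+ (2 * r) * gaussian_moment v (2 * r) / (2 * r)`!%:R < eps.
Proof.
move=> e0.
have /cvg_series_cvg_0 := @is_cvg_series_exp_coeff R (t ^+ 2 * (v / 2)).
move=> /cvgrPdist_lt /(_ _ e0)[r _ /(_ r (leqnn _))].
rewrite sub0r normrN /exp_coeff /= => h; exists r; apply: le_lt_trans h.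
have -> : `|t| ^+ (2 * r) = (t ^+ 2) ^+ r by rewrite exprM real_normK ?num_real.
rewrite -mulrA gaussian_moment_even [leLHS]mulrA -exprMn.
exact: ler_norm.
Qed.

Section Density.
Variables (v : R) (v0 : 0 < v).
Let s := Num.sqrt v.
Let s2 := Num.sqrt (2 * v).
Let p := normal_pdf 0 s.
Let p2 := normal_pdf 0 s2.
Notation mu := (@lebesgue_measure R).

Let sN0 : s != 0. Proof. by rewrite lt0r_neq0 // sqrtr_gt0. Qed.
Let s2N0 : s2 != 0. Proof. by rewrite lt0r_neq0 // sqrtr_gt0 mulr_gt0. Qed.

Let pE x : p x = normal_peak s * expR (- (2 * v)^-1 * x ^+ 2).
Proof.
rewrite /p normal_pdfE // /normal_fun subr0 sqr_sqrtr ?ltW // mulNr mulNr mulrC -mulr_natl.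
by rewrite [x ^+ 2 / _]mulrC mulrC.
Qed.

Let p2E x : p2 x = normal_peak s2 * expR (- (4 * v)^-1 * x ^+ 2).
Proof.
rewrite /p2 normal_pdfE // /normal_fun subr0 sqr_sqrtr ?mulr_ge0 ?ltW // !mulNr.
by congr (_ * expR (- _)); rewrite mulrC; congr (_^-1 * _); rewrite -mulr_natl; ring.
Qed.

Lemma norm_exp_le_weight (x : R) q : `|x| ^+ q <= (1 + x ^+ 2) ^+ q.
Proof.
apply: lerXn2r; rewrite ?nnegrE //; first by apply: le_trans (le1_weight _).
rewrite -[x ^+ 2]real_normK ?num_real //.
have := sqr_ge0 (`|x| - 1); have := sqr_ge0 `|x|; rewrite /=; nra.
Qed.

(** A normal density of twice the variance absorbs polynomials; all integrability and decay
    at infinity follow from this. *)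
Lemma normal_pdf_domination k :
  exists2 C, 0 <= C & forall x, (1 + x ^+ 2) ^+ k * p x <= C * p2 x.
Proof.
(* The k factors 1 + x^2 together may cost exp(x^2 / 4v). *)
pose dl := (4 * v * k.+1%:R)^-1.
have dl0 : 0 < dl by rewrite invr_gt0 !mulr_gt0.
pose C1 := 1 + dl^-1.
have C10 : 0 <= C1 by rewrite addr_ge0 // invr_ge0 ltW.
have w x : 1 + x ^+ 2 <= C1 * expR (dl * x ^+ 2).
  apply: (@le_trans _ _ (C1 * (1 + dl * x ^+ 2))); last by rewrite ler_wpM2l // expR_ge1Dx.
  rewrite /C1 mulrDl mul1r mulrDr mulr1 mulrA mulVf ?lt0r_neq0 // mul1r.
  have : 0 <= dl * x ^+ 2 by rewrite mulr_ge0 ?sqr_ge0 // ltW.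
  have : 0 <= dl^-1 by rewrite invr_ge0 ltW.
  lra.
have q1 := normal_peak_gt0 sN0; have q2 := normal_peak_gt0 s2N0.
exists (C1 ^+ k * (normal_peak s / normal_peak s2)) => [|x].
  by rewrite mulr_ge0 ?exprn_ge0 // divr_ge0 // ltW.
rewrite pE p2E.
have -> : C1 ^+ k * (normal_peak s / normal_peak s2)
  * (normal_peak s2 * expR (- (4 * v)^-1 * x ^+ 2)) =
   C1 ^+ k * (normal_peak s * expR (- (4 * v)^-1 * x ^+ 2)) by field; rewrite lt0r_neq0.
have h1 : (1 + x ^+ 2) ^+ k <= C1 ^+ k * expR ((4 * v)^-1 * x ^+ 2).
  apply: (@le_trans _ _ ((C1 * expR (dl * x ^+ 2)) ^+ k)).
    by rewrite lerXn2r // nnegrE ?mulr_ge0 ?expR_ge0 // (le_trans _ (le1_weight _)).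
  rewrite exprMn ler_wpM2l ?exprn_ge0 // -expRM_natr ler_expR mulrAC ler_wpM2r ?sqr_ge0 //.
  rewrite /dl invfM -mulrA ler_piMr ?invr_ge0 ?mulr_ge0 ?(ltW v0) // mulrC ler_pdivrMr //.
  by rewrite mul1r ler_nat.
apply: le_trans (ler_wpM2r _ h1) _; first by rewrite mulr_ge0 ?expR_ge0 // ltW.
rewrite -mulrA ler_wpM2l ?exprn_ge0 // mulrCA ler_wpM2l ?(ltW q1) // -expRD -mulrDl.
rewrite ler_expR le_eqVlt; apply/orP; left; apply/eqP; congr (_ * _).
by field; rewrite lt0r_neq0.
Qed.

Lemma integrable_monomial_pdf q : mu.-integrable setT (fun x => (x ^+ q * p x)%:E).
Proof.
have [C C0 hC] := normal_pdf_domination q.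
have i2 := integrableZl measurableT C (integrable_normal_pdf 0 s2).
apply: (le_integrable measurableT _ _ i2).
  apply/measurable_EFinP; apply: measurable_funM; last exact: measurable_normal_pdf.
  exact: measurable_funX.
move=> x _; rewrite /= lee_fin normrM (ger0_norm (normal_pdf_ge0 _ _ _)).
rewrite (ger0_norm (mulr_ge0 C0 (normal_pdf_ge0 _ _ _))) (le_trans _ (hC x)) //.
rewrite ler_wpM2r ?normal_pdf_ge0 // normrX; exact: norm_exp_le_weight.
Qed.

Lemma is_derive_normal_pdf x : is_derive x 1 p (- v^-1 * x * p x).
Proof.
have -> : p = (fun x => normal_peak s * expR (- (2 * v)^-1 * x ^+ 2)) by apply/funext.
have h : is_derive x 1 (fun x : R => x ^+ 2) (2 * x).
  have := is_deriveX 2 (is_derive_id x (1 : R)); rewrite /GRing.scale /= mulr1 expr1.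
  have -> // : id ^+ 2 = (fun y : R => y ^+ 2) by apply/funext => z; rewrite exprfctE.
apply: is_derive_eq; rewrite /GRing.scale /=; field.
by rewrite lt0r_neq0.
Qed.

Lemma is_derive_monomial_pdf q x :
  is_derive x 1 (fun x => x ^+ q * p x) (q%:R * (x ^+ q.-1 * p x) - v^-1 * (x ^+ q.+1 * p x)).
Proof.
have h1 := is_derive_normal_pdf x.
have h : is_derive x 1 (fun x : R => x ^+ q) (q%:R * x ^+ q.-1).
  have := is_deriveX q (is_derive_id x (1 : R)); rewrite /GRing.scale /= mulr1.
  have -> // : id ^+ q = (fun y : R => y ^+ q) by apply/funext => z; rewrite exprfctE.
apply: is_derive_eq; rewrite /GRing.scale /= [x ^+ q.+1]exprSr; ring.
Qed.

(** One power more of 1 + x^2 than needed gives a bound of order 1 / (1 + x^2). *)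
Lemma monomial_pdf_cvg0 q (u : nat -> R) : (forall n, `|u n| = n%:R) ->
  (fun n => u n ^+ q * p (u n)) @ \oo --> (0 : R).
Proof.
move=> un; have [C C0 hC] := normal_pdf_domination q.+1.
pose C' := C * normal_peak s2.
have bnd x : `|x ^+ q * p x| * (1 + x ^+ 2) <= C'.
  rewrite normrM (ger0_norm (normal_pdf_ge0 _ _ _)).
  apply: (@le_trans _ _ (C * p2 x)); last by rewrite ler_wpM2l // normal_pdf_ub.
  apply: le_trans (hC x); rewrite mulrAC ler_wpM2r ?normal_pdf_ge0 // (exprSr _ q) normrX.
  by apply: ler_wpM2r; [apply: le_trans (le1_weight _)|exact: norm_exp_le_weight].
apply/cvgrPdist_lt => eps e0; near=> n.
rewrite sub0r normrN; have := bnd (u n); set a := `|_ * _|.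
have -> : u n ^+ 2 = n%:R ^+ 2 by rewrite -(un n) real_normK ?num_real.
have n0 : 0 <= n%:R :> R by [].
have nC : C' / eps < n%:R by near: n; exact: nbhs_infty_gtr.
move: nC; rewrite ltr_pdivrMr // => nC hb; rewrite ltNge; apply/negP => ea.
have h : eps * (1 + n%:R ^+ 2) <= a * (1 + n%:R ^+ 2) by
  rewrite ler_wpM2r // (le_trans _ (le1_weight _)).
have : n%:R <= 1 + n%:R ^+ 2 :> R by have := sqr_ge0 (n%:R - 1 : R); nra.
by move=> /(ler_wpM2l (ltW e0)); lra.
Unshelve. all: end_near. Qed.

Let g q x := q%:R * (x ^+ q.-1 * p x) - v^-1 * (x ^+ q.+1 * p x).

Let has_integral_g q : has_integral mu (g q)
  (q%:R * \int[mu]_x (x ^+ q.-1 * p x) - v^-1 * \int[mu]_x (x ^+ q.+1 * p x)).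
Proof.
have i1 k : mu.-integrable setT (fun x => (x ^+ k * p x)%:E) := integrable_monomial_pdf k.
have hi k : has_integral mu (fun x => x ^+ k * p x) (\int[mu]_x (x ^+ k * p x)).
  by split => //; exact: i1.
have h1 := has_integralZ q%:R (hi q.-1); have h2 := has_integralZ (- v^-1) (hi q.+1).
have := @has_integral_sum _ _ _ mu nat [:: 0%N; 1%N] predT
  (fun i x => if i == 0%N then q%:R * (x ^+ q.-1 * p x) else - v^-1 * (x ^+ q.+1 * p x))
  (fun i => if i == 0%N then q%:R * \int[mu]_x (x ^+ q.-1 * p x) else
      - v^-1 * \int[mu]_x (x ^+ q.+1 * p x)).
rewrite !big_cons big_nil addr0 /= mulNr => h.
apply: has_integral_ext (h _) => [x|[|i] _]; [|exact: h1|by rewrite /= -mulNr; exact: h2].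
by rewrite !big_cons big_nil addr0 /= mulNr.
Qed.

(** The fundamental theorem of calculus on [-n, n], with dominated convergence. *)
Lemma integral_derivative_monomial_pdf q : \int[mu]_x g q x = 0.
Proof.
have [ig _] := has_integral_g q.
have gc : continuous (g q).
  have pc : continuous p by exact: continuous_normal_pdf.
  by move=> x; apply: cvgB; apply: cvgM; (try exact: cvg_cst); apply: cvgM => //;
    [apply: exprn_continuous|exact: pc|apply: exprn_continuous|exact: pc].
pose D n := `[- n.+1%:R, n.+1%:R]%classic : set R.
have mg : measurable_fun setT (EFin \o g q) by apply/measurable_EFinP;
  exact: continuous_measurable_fun.
have mD n : measurable_fun setT ((EFin \o g q) \_ (D n)).
  by apply/(measurable_restrictT _ (measurable_itv _)); exact: measurable_funTS.
have ptw : {ae mu, forall x, setT x -> ((EFin \o g q) \_ (D n)) x @[n --> \oo] --> (EFin \o g q) x}.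
  apply: aeW => x _; apply: cvg_near_cst; near=> n; apply/eqP; rewrite patchE mem_set //=.
  rewrite /D /= in_itv /= -ler_norml; apply: ltW; near: n.
  have [N _ hN] := nbhs_infty_gtr `|x|; exists N => // n /= Nn.
  by apply: hN => /=; exact: leqW.
have dom : {ae mu, forall x n,
  setT x -> (`|((EFin \o g q) \_ (D n)) x| <= (abse \o (EFin \o g q)) x)%E}.
  by apply: aeW => x n _; rewrite patchE; case: ifP => // _; rewrite abse0 abse_ge0.
have iag : mu.-integrable setT (abse \o (EFin \o g q)) by exact: integrable_abse.
have [_ _ +] := @dominated_convergence _ _ R mu setT measurableT
  (fun n => (EFin \o g q) \_ (D n)) (EFin \o g q) (abse \o (EFin \o g q)) mD mg ptw iag dom.
have -> : (fun n => \int[mu]_x ((EFin \o g q) \_ (D n)) x)%E =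
   (fun n => (n.+1%:R ^+ q * p n.+1%:R - (- n.+1%:R) ^+ q * p (- n.+1%:R))%:E).
  apply/funext => n; rewrite -integral_mkcond EFinB.
  rewrite (@continuous_FTC2 _ (g q) (fun x => x ^+ q * p x)) //.
  - by rewrite gtrN.
  - exact: continuous_subspaceT.
  - have cF : continuous (fun x => x ^+ q * p x).
      move=> x; have h := is_derive_monomial_pdf q x.
      by apply/differentiable_continuous/derivable1_diffP.
    split; [by move=> x _; have h := is_derive_monomial_pdf q x|..].
    + by apply: cvg_at_right_filter; exact: cF.
    + by apply: cvg_at_left_filter; exact: cF.
  - by move=> x _; rewrite derive1E; have h := is_derive_monomial_pdf q x; rewrite derive_val.
move=> H; have c0 : (fun n : nat =>
  (n.+1%:R ^+ q * p n.+1%:R - (- n.+1%:R) ^+ q * p (- n.+1%:R))%:E) @ \oo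
    --> (0%:E : \bar R).
  apply: cvg_EFin; first by near=> n.
  rewrite -[0]subr0; apply: cvgB.
    by have := @monomial_pdf_cvg0 q (fun n => n%:R) (fun n => normr_nat _ n); rewrite -cvg_shiftS.
  have := @monomial_pdf_cvg0 q (fun n => - n%:R); rewrite -cvg_shiftS; apply => n.
  by rewrite normrN normr_nat.
by rewrite /Rintegral; have := cvg_unique _ H c0; move=> /(_ _)/wrap[//|] ->.
Unshelve. all: end_near. Qed.

Lemma normal_pdf_moment q : \int[mu]_x (x ^+ q * p x) = gaussian_moment v q.
Proof.
have rec k : \int[mu]_x (x ^+ k.+1 * p x) = v * (k%:R * \int[mu]_x (x ^+ k.-1 * p x)).
  have [_ e] := has_integral_g k; move: e; rewrite integral_derivative_monomial_pdf => e.
  have -> : k%:R * \int[mu]_x (x ^+ k.-1 * p x) = v^-1 * \int[mu]_x (x ^+ k.+1 * p x).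
    by apply/eqP; rewrite -subr_eq0 -e.
  by rewrite mulrA divff ?mul1r // lt0r_neq0.
elim/ltn_ind: q => -[|[|q]] IH.
- by rewrite /Rintegral; under eq_integral do rewrite expr0 mul1r; rewrite integral_normal_pdf.
- by rewrite rec mul0r mulr0.
- by rewrite rec /= IH // mulrCA mulrA.
Qed.
End Density.

(** The degenerate case is a point mass. *)
Lemma normal_law_moment v q : 0 <= v ->
  has_integral (normal_law 0 v) (fun x => x ^+ q) (gaussian_moment v q).
Proof.
move=> v0; rewrite /normal_law; case: ifPn => [/eqP ->|vN0].
  have mf : measurable_fun setT (fun x : measurableTypeR R => (x ^+ q)%:E).
    by apply/measurable_EFinP; exact: measurable_funX.
  split.
    apply/integrableP; split => //.
    rewrite integral_dirac // ?diracT ?mul1e ?ltry //.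
    by apply: measurableT_comp.
  rewrite /Rintegral integral_dirac // diracT mul1e /=.
  by case: q mf => [|[|q]] _ //=; rewrite ?expr0 ?expr1 // expr0n /= mulr0 mul0r.
have vp : 0 < v by rewrite lt_neqAle eq_sym vN0.
have pm := @measurable_normal_pdf R 0 (Num.sqrt v).
have mf : measurable_fun setT (fun x : R => x ^+ q) by exact: measurable_funX.
have dens (A : set R) : measurable A ->
  normal_prob 0 (Num.sqrt v) A =
    (\int[lebesgue_measure]_(x in A) (normal_pdf 0 (Num.sqrt v) x)%:E)%E by [].
split.
  refine (integrable_density (mu := lebesgue_measure) (nu :=
    normal_prob 0 (Num.sqrt v)) pm (normal_pdf_ge0 _ _) dens mf _).
  exact (integrable_monomial_pdf vp q).
rewrite /Rintegral (integral_density (mu := lebesgue_measure) (nu :=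
  normal_prob 0 (Num.sqrt v)) pm (normal_pdf_ge0 _ _) dens mf).
exact: normal_pdf_moment.
Qed.
End GaussianMoments.

Section MomentsToGaussian.
Variables (R : realType) (d : nat -> measure_display).
Variables (Omega : forall n, measurableType (d n)) (P : forall n, probability (Omega n) R).
Variables (Y : forall n : nat, Omega n -> R) (M : nat -> nat -> R) (v : R).
Hypothesis mY : forall n : nat, measurable_fun setT (@Y n).
Hypothesis YM : forall n q, (0 < n)%N -> has_integral (P n) (fun o => @Y n o ^+ q) (M n q).
Hypothesis v0 : 0 <= v.
Hypothesis Mcvg : forall q, M n q @[n --> \oo] --> gaussian_moment v q.

(** The moment hypothesis is asked for n > 0 only; the sequence is shifted by one. *)
Lemma moments_cvg_in_distribution : cvg_in_distribution P Y (normal_law 0 v).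
Proof.
move=> h hc [B hB].
have mQ q := normal_law_moment q v0.
have QE := expectation_like_integral (Y := fun x : measurableTypeR R =>
  x) (@measurable_id _ _ setT) mQ.
have En n := expectation_like_integral (@mY n.+1) (fun q => @YM n.+1 q (ltn0Sn n)).
rewrite -cvg_shiftS /=.
under eq_fun => n do rewrite (expectation_bounded (@mY n.+1) (fun q =>
  @YM n.+1 q (ltn0Sn n)) hc hB).
have <- : (\int[normal_law 0 v]_x h x)%:E = (\int[normal_law 0 v]_x (h x)%:E)%E.
  have := expectation_bounded (Y := fun x : measurableTypeR R =>
    x) (@measurable_id _ _ setT) mQ hc hB.
  by rewrite unlock => <-.
apply: cvg_EFin; first by near=> n.
have := moments_cvg_bounded En QE _ _ hc hB; apply.
- move=> q; have [_ ->] := mQ q.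
  under eq_fun => n do rewrite (proj2 (@YM n.+1 q (ltn0Sn n))).
  by have := @Mcvg q; rewrite -cvg_shiftS.
- by move=> t eps e0; have [r hr] := gaussian_moment_growth v t e0; exists r; have [_ ->] :=
  mQ (2 * r)%N.
Unshelve. all: end_near. Qed.
End MomentsToGaussian.

(** * Laurent coefficients for an abstract residue functional *)

Section ResidueFunctional.
Variables (C : fieldType) (T : Type) (D : T -> Prop) (g : T -> C) (pts : {pred C}).
Variables (adm : (T -> C) -> Prop) (L : (T -> C) -> C).
Implicit Types (u w : T -> C) (c p q : C) (ps : seq C).
Hypothesis adm_lin : forall c u w, adm u -> adm w -> adm (fun t => c * u t + w t).
Hypothesis adm_mul : forall u w, adm u -> adm w -> adm (fun t => u t * w t).
Hypothesis adm_cst : forall c, adm (fun=> c).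
Hypothesis adm_g : adm g.
Hypothesis adm_inv : forall p, p \in pts -> adm (fun t => (g t - p)^-1).
Hypothesis L_lin : forall c u w, adm u -> adm w -> L (fun t => c * u t + w t) = c * L u + L w.
Hypothesis L_ext : forall u w, (forall t, D t -> u t = w t) -> L u = L w.
Hypothesis g_neq : forall p t, p \in pts -> D t -> g t - p != 0.
Hypothesis L_pow : forall p n, L (fun t => (g t - p) ^+ n) = 0.
Hypothesis L_inv : forall p, p \in pts -> L (fun t => (g t - p)^-1) = 1.
Hypothesis L_invn : forall p n, p \in pts -> L (fun t => (g t - p) ^- n.+2) = 0.

Lemma adm_shift c : adm (fun t => g t - c).
Proof.
have := adm_lin 1 adm_g (adm_cst (- c)); congr adm; apply/funext => t; by rewrite mul1r.
Qed.

Lemma adm_pow u n : adm u -> adm (fun t => u t ^+ n).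
Proof.
move=> au; elim: n => [|n IH]; first by have := adm_cst 1; congr adm.
by have := adm_mul au IH; congr adm; apply/funext => t; rewrite exprS.
Qed.

Lemma admZ c u : adm u -> adm (fun t => c * u t).
Proof. by move=> au; apply: adm_mul. Qed.

Lemma adm_sum n (c : nat -> C) (u : nat -> T -> C) : (forall i, adm (u i)) ->
  adm (fun t => \sum_(i < n) c i * u i t).
Proof.
move=> au; elim: n => [|n IH].
  by have := adm_cst 0; congr adm; apply/funext => t; rewrite big_ord0.
have := adm_lin (c n) (au n) IH; congr adm; apply/funext => t.
by rewrite big_ord_recr /= addrC.
Qed.

Lemma L0 : L (fun=> 0) = 0.
Proof.
have := L_lin (-1) (adm_cst 0) (adm_cst 0).
have -> : (fun _ : T => -1 * 0 + 0) = (fun=> 0) :> (T -> C) by apply/funext => t; ring.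
by move=> e; rewrite {1}e mulN1r addNr.
Qed.

Lemma LZ c u : adm u -> L (fun t => c * u t) = c * L u.
Proof.
move=> au; have := L_lin c au (adm_cst 0); rewrite L0 addr0 => <-.
by apply: L_ext => t _; rewrite addr0.
Qed.

Lemma L_sum n (c : nat -> C) (u : nat -> T -> C) : (forall i, adm (u i)) ->
  L (fun t => \sum_(i < n) c i * u i t) = \sum_(i < n) c i * L (u i).
Proof.
move=> au; elim: n => [|n IH].
  rewrite [RHS]big_ord0; transitivity (L (fun=> 0)); last exact: L0.
  by apply: L_ext => t _; rewrite big_ord0.
rewrite big_ord_recr /= -IH addrC -L_lin //; last exact: adm_sum.
by apply: L_ext => t _; rewrite big_ord_recr /= addrC.
Qed.

(** Products of the functions 1 / (g - p) serve as test functions: a function of order at most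
    n - 2 at infinity is one that L kills after multiplication by n or more of them. Here [g]
    is the parametrization of a closed curve, [L] the normalized integral along it, and [pts]
    consists of points around which the curve winds once. *)
Definition inv_prod ps t : C := \prod_(p <- ps) (g t - p)^-1.

Lemma adm_inv_prod ps : all [in pts] ps -> adm (inv_prod ps).
Proof.
elim: ps => [|p ps IH] /=.
  by move=> _; have := adm_cst 1; congr adm; apply/funext => t; rewrite /inv_prod big_nil.
move=> /andP[pp /IH h]; have := adm_mul (adm_inv pp) h; congr adm.
by apply/funext => t; rewrite /inv_prod big_cons.
Qed.

Lemma inv_sub p q t : p \in pts -> q \in pts -> D t -> p != q ->
  (g t - p)^-1 * (g t - q)^-1 = (p - q)^-1 * (g t - p)^-1 - (p - q)^-1 * (g t - q)^-1.
Proof.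
move=> pp qq Dt pq; have pq0 : p - q != 0 by rewrite subr_eq0.
by field; rewrite pq0 !g_neq.
Qed.

Lemma inv_sub2 p q t : p \in pts -> q \in pts -> D t ->
  (g t - p)^-1 = (g t - q)^-1 + (p - q) * ((g t - q)^-1 * (g t - p)^-1).
Proof. by move=> pp qq Dt; field; rewrite !g_neq. Qed.

(** Partial fractions. If two poles differ, the product is a difference of two shorter ones, and
    1 / (z - p) and 1 / (z - q) have the same integral; otherwise it is a power of order at
    least two of 1 / (z - p). *)
Lemma L_inv_prod ps : all [in pts] ps -> (2 <= size ps)%N -> L (inv_prod ps) = 0.
Proof.
have [n] := ubnP (size ps); elim: n ps => // n IH [|p ps] //= sn /andP[pp pps] s2.
have [/allP same|/allPn [q qps qp]] := boolP (all (pred1 p) ps).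
  have -> : L (inv_prod (p :: ps)) = L (fun t => (g t - p) ^- (size ps).+1).
    apply: L_ext => t _; rewrite -exprVn exprS /inv_prod big_cons; congr (_ * _).
    rewrite -[in RHS](size_map id ps) map_id.
    elim: ps same {pps s2 sn} => [|q ps IHp] same; first by rewrite big_nil.
    rewrite big_cons exprS (eqP (same q (mem_head _ _))) IHp // => x xs.
    by apply: same; rewrite inE xs orbT.
  by case: (size ps) s2 => // k _; exact: L_invn.
have pq : perm_eq (p :: ps) [:: p, q & rem q ps] by rewrite perm_cons perm_to_rem.
have qq : q \in pts := allP pps q qps.
have pr : all [in pts] (rem q ps) by apply/allP => x /mem_rem /(allP pps).
have sr : size ps = (size (rem q ps)).+1 by rewrite (perm_size (perm_to_rem qps)).
have -> : L (inv_prod (p :: ps)) =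
   L (fun t => (p - q)^-1 * inv_prod (p :: rem q ps) t + (- (p - q)^-1)
     * inv_prod (q :: rem q ps) t).
  apply: L_ext => t Dt; rewrite /inv_prod (perm_big _ pq) !big_cons /= mulrA inv_sub // 1?eq_sym //.
  by rewrite mulrBl mulNr !mulrA.
have aP : adm (inv_prod (p :: rem q ps)) by apply: adm_inv_prod; rewrite /= pp.
have aQ : adm (inv_prod (q :: rem q ps)) by apply: adm_inv_prod; rewrite /= qq.
rewrite L_lin //; last exact: admZ.
rewrite LZ //; case: (rem q ps) sr pr aP aQ => [|r rs] sr pr aP aQ.
  have inv1 x : x \in pts -> L (inv_prod [:: x]) = 1.
    by move=> xp; rewrite -(L_inv xp); apply: L_ext => t _; rewrite /inv_prod big_seq1.
  by rewrite !inv1 // !mulr1 subrr.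
by rewrite !IH ?mulr0 ?addr0 //= ?pp ?qq // -ltnS -sr.
Qed.

(** Order at most n - 2 at infinity, expressed without reference to infinity. *)
Definition vanish n u := adm u /\
  forall ps, all [in pts] ps -> (n <= size ps)%N -> L (fun t => u t * inv_prod ps t) = 0.

Lemma vanish_leq n n' u : (n <= n')%N -> vanish n u -> vanish n' u.
Proof. by move=> nn [au h]; split => // ps pp sn; apply: h => //; exact: leq_trans sn. Qed.

Lemma vanish_lin n c u w : vanish n u -> vanish n w -> vanish n (fun t => c * u t + w t).
Proof.
move=> [au hu] [aw hw]; split; first exact: adm_lin.
move=> ps pp sn; have ai := adm_inv_prod pp.
transitivity (L (fun t => c * (u t * inv_prod ps t) + w t * inv_prod ps t)).
  by apply: L_ext => t _; rewrite mulrDl mulrA.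
by rewrite L_lin ?hu ?hw ?mulr0 ?addr0 //; exact: adm_mul.
Qed.

Lemma vanish1 : vanish 2 (fun=> 1).
Proof.
split=> // ps pp s2; rewrite -(L_inv_prod pp s2).
by apply: L_ext => t _; rewrite mul1r.
Qed.

Lemma vanish0 n : vanish n (fun=> 0).
Proof.
split=> // ps pp sn; transitivity (L (fun=> 0)); last exact: L0.
by apply: L_ext => t _; rewrite mul0r.
Qed.

Lemma vanish_sum k n (c : nat -> C) (u : nat -> T -> C) : (forall i, (i < n)%N -> vanish k (u i)) ->
  vanish k (fun t => \sum_(i < n) c i * u i t).
Proof.
elim: n => [|n IH] hu.
  by have := vanish0 k; congr vanish; apply/funext => t; rewrite big_ord0.
have := vanish_lin (c n) (hu n (ltnSn n)) (IH (fun i h => hu i (ltnW h))).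
by congr vanish; apply/funext => t; rewrite big_ord_recr /= addrC.
Qed.

(** (z - c) / (z - p) = 1 + (p - c) / (z - p). *)
Lemma vanish_shift n c u : vanish n u -> vanish n.+1 (fun t => u t * (g t - c)).
Proof.
move=> [au hu]; split; first by apply: adm_mul => //; exact: adm_shift.
move=> [//|p ps] /= /andP[pp pps] sn; rewrite ltnS in sn.
have app : adm (inv_prod (p :: ps)) by apply: adm_inv_prod; rewrite /= pp.
transitivity (L (fun t => (p - c) * (u t * inv_prod (p :: ps) t) + u t * inv_prod ps t)).
  apply: L_ext => t Dt; rewrite /inv_prod big_cons; move: (\prod_(j <- ps) _) => B.
  by field; rewrite g_neq.
rewrite L_lin; [|exact: adm_mul|by apply: adm_mul => //; exact: adm_inv_prod].
by rewrite !hu ?mulr0 ?addr0 //= ?pp // leqW.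
Qed.

Lemma vanish_inv n p u : p \in pts -> vanish n.+1 u -> vanish n (fun t => u t * (g t - p)^-1).
Proof.
move=> pp [au hu]; split; first by apply: adm_mul => //; exact: adm_inv.
move=> ps pps sn; rewrite -(hu (p :: ps)) /= ?pp //.
by apply: L_ext => t _; rewrite /inv_prod big_cons mulrA.
Qed.

Lemma inv_prod_nseq p n t : inv_prod (nseq n p) t = (g t - p) ^- n.
Proof.
elim: n => [|n IH]; first by rewrite /inv_prod big_nil expr0 invr1.
by move: IH; rewrite /inv_prod /= big_cons => ->; rewrite exprS invfM.
Qed.

Lemma vanish_invn n p u k : p \in pts -> vanish n u -> (n <= k)%N ->
  L (fun t => u t * (g t - p) ^- k) = 0.
Proof.
move=> pp [au hu] nk; rewrite -(hu (nseq k p)) ?size_nseq //; last by rewrite all_nseq /= pp orbT.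
by apply: L_ext => t _; rewrite inv_prod_nseq.
Qed.

(** Exchanging one pole p for q in a product of n inverses changes it by a product of n + 1
    inverses, so one product of n inverses decides. *)
Lemma vanish_down n q u : q \in pts -> vanish n.+1 u -> L (fun t => u t * (g t - q) ^- n) = 0 ->
  vanish n u.
Proof.
move=> qq [au hu] uq; split=> // ps pps; rewrite leq_eqVlt => /orP[/eqP nps|]; last exact: hu.
suff H k ps' : all [in pts] ps' -> (size ps' + k)%N = n ->
    L (fun t => u t * ((g t - q) ^- k * inv_prod ps' t)) = 0.
  rewrite -(H 0%N ps) ?addn0 //; apply: L_ext => t _; by rewrite expr0 invr1 mul1r.
elim: ps' k {ps pps nps} => [|p ps IH] k /=.
  move=> _ kn; rewrite -uq -kn; apply: L_ext => t _; by rewrite /inv_prod big_nil mulr1.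
move=> /andP[pp pps] sn.
have pall : all [in pts] (nseq k.+1 q ++ p :: ps) by rewrite all_cat all_nseq /= qq pp pps.
transitivity (L (fun t => (p - q) * (u t * inv_prod (nseq k.+1 q ++ p :: ps) t) +
    u t * ((g t - q) ^- k.+1 * inv_prod ps t))).
  apply: L_ext => t Dt.
  have -> : inv_prod (nseq k.+1 q ++ p :: ps) t =
      (g t - q) ^- k.+1 * ((g t - p)^-1 * inv_prod ps t).
    by rewrite -inv_prod_nseq /inv_prod big_cat big_cons.
  rewrite [inv_prod (p :: ps) t]big_cons -/(inv_prod ps t); move: (inv_prod ps t) => B.
  rewrite {1}(inv_sub2 pp qq Dt) exprS invfM; move: ((g t - q) ^- k) => Q; ring.
have aI : adm (fun t => (g t - q) ^- k.+1).
  have : adm (inv_prod (nseq k.+1 q)) by apply: adm_inv_prod; rewrite all_nseq qq orbT.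
  by congr adm; apply/funext => t; rewrite inv_prod_nseq.
rewrite L_lin; last 2 first.
- by apply: adm_mul => //; exact: adm_inv_prod.
- by apply: adm_mul => //; apply: adm_mul => //; exact: adm_inv_prod.
rewrite IH ?addnS -?addSn // hu ?mulr0 ?addr0 // size_cat size_nseq /=; lia.
Qed.

(** Coefficient of (z - c)^l in the expansion in powers of z - c at infinity. *)
Definition laurent c u (l : int) : C := L (fun t => u t * (g t - c) ^ (- l - 1)).

Lemma adm_zpow c (l : int) : c \in pts -> adm (fun t => (g t - c) ^ l).
Proof.
move=> cc; case: l => n; first by have := adm_pow n (adm_shift c).
have := adm_pow n.+1 (adm_inv cc); congr adm; apply/funext => t.
by rewrite NegzE -exprnN exprVn.
Qed.

Lemma L_zpow c (l : int) : c \in pts -> L (fun t => (g t - c) ^ l) = (l == -1)%:R.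
Proof.
move=> cc; case: l => [n|[|n]]; first exact: L_pow.
- rewrite eqxx -(L_inv cc); apply: L_ext => t _; by rewrite NegzE -exprnN expr1.
- transitivity (0 : C); last by [].
  by rewrite -(L_invn n cc); apply: L_ext => t _; rewrite NegzE -exprnN.
Qed.

Lemma laurent_lin c a u w l : c \in pts -> adm u -> adm w ->
  laurent c (fun t => a * u t + w t) l = a * laurent c u l + laurent c w l.
Proof.
move=> cc au aw; have az := adm_zpow (- l - 1) cc; rewrite /laurent -L_lin; [|exact: adm_mul..].
by apply: L_ext => t _; rewrite mulrDl mulrA.
Qed.

Lemma laurent_sum c n (a : nat -> C) (u : nat -> T -> C) l : c \in pts -> (forall i, adm (u i)) ->
  laurent c (fun t => \sum_(i < n) a i * u i t) l = \sum_(i < n) a i * laurent c (u i) l.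
Proof.
move=> cc au; have az := adm_zpow (- l - 1) cc; rewrite /laurent.
rewrite -(@L_sum n a (fun i t => u i t * (g t - c) ^ (- l - 1))) => [|i]; last exact: adm_mul.
by apply: L_ext => t _; rewrite mulr_suml; apply: eq_bigr => i _; rewrite mulrA.
Qed.

Lemma laurent_band c n u (l : nat) : c \in pts -> vanish n u -> (n <= l.+1)%N -> laurent c u l = 0.
Proof.
move=> cc vu nl; rewrite -(vanish_invn cc vu nl); apply: L_ext => t _; congr (_ * _).
by rewrite -opprD -[1]/(1%:Z) -PoszD addn1 -exprnN.
Qed.

Lemma laurent_poly c (P : {poly C}) (l : nat) : c \in pts ->
  laurent c (fun t => P.[g t]) l = (P \Po ('X + c%:P))`_l.
Proof.
move=> cc; set Q := P \Po _.
have PQ t : P.[g t] = Q.[g t - c] by rewrite horner_comp !hornerE subrK.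
transitivity (laurent c (fun t => \sum_(i < size Q) Q`_i * (g t - c) ^+ i) l).
  by apply: L_ext => t _; rewrite PQ horner_coef.
rewrite (@laurent_sum c (size Q) (fun i => Q`_i) (fun i t => (g t - c) ^+ i)) //; last first.
  by move=> i; apply: adm_pow; exact: adm_shift.
have e (i : nat) : laurent c (fun t => (g t - c) ^+ i) l = (i == l)%:R.
  rewrite (_ : (i == l) = (i%:Z - l%:Z - 1 == -1)); last by apply/idP/idP; lia.
  rewrite -(L_zpow _ cc); apply: L_ext => t Dt.
  by rewrite exprnP -expfzDr ?g_neq // addrA.
under eq_bigr => i _ do rewrite e.
have [lQ|Ql] := ltnP l (size Q).
  rewrite (bigD1 (Ordinal lQ)) //= eqxx mulr1 big1 ?addr0 // => i il.
  by rewrite (negbTE (il : (i : nat) != l)) mulr0.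
rewrite nth_default // big1 // => i _.
by rewrite (ltn_eqF (leq_trans (ltn_ord i) Ql)) mulr0.
Qed.

Lemma adm_poly (P : {poly C}) : adm (fun t => P.[g t]).
Proof.
have := @adm_sum (size P) (fun i => P`_i) (fun i t => g t ^+ i) (fun i => adm_pow i adm_g).
by congr adm; apply/funext => t; rewrite horner_coef.
Qed.

Lemma vanish_poly (P : {poly C}) : vanish (size P).+1 (fun t => P.[g t]).
Proof.
have hX i : vanish i.+2 (fun t => g t ^+ i).
  elim: i => [|i IH]; first by have := vanish1; congr vanish.
  by have := vanish_shift 0 IH; congr vanish; apply/funext => t; rewrite subr0 exprSr.
have := @vanish_sum (size P).+1 (size P) (fun i => P`_i) (fun i t => g t ^+ i).
move=> /(_ _)/wrap[i iP|]; first by apply: vanish_leq (hX i).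
by congr vanish; apply/funext => t; rewrite horner_coef.
Qed.

(** The polynomial P is read off from the Laurent coefficients of nonnegative index; that the
    difference has order -1 follows by descending with [vanish_down]. *)
Lemma vanish_poly_part d q u : q \in pts -> vanish d.+2 u ->
  exists2 P : {poly C}, (size P <= d.+1)%N & vanish 1 (fun t => u t - P.[g t]).
Proof.
move=> qq vu; have [au _] := vu.
pose Q := \poly_(l < d.+1) laurent q u l; pose P := Q \Po ('X - q%:P).
have sP : (size P <= d.+1)%N.
  by rewrite size_comp_poly2 ?size_XsubC // size_poly.
exists P => //.
have PQ : P \Po ('X + q%:P) = Q.
  by rewrite -comp_polyA comp_polyB comp_polyX comp_polyC addrK comp_polyXr.
have vr : vanish d.+2 (fun t => u t - P.[g t]).
  have := vanish_lin (-1) (vanish_leq (_ : ((size P).+1 <= d.+2)%N) (vanish_poly P)) vu.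
  by move=> /(_ sP); congr vanish; apply/funext => t; rewrite mulN1r addrC.
have lr (l : nat) : (l <= d)%N -> laurent q (fun t => u t - P.[g t]) l = 0.
  move=> ld; have := laurent_lin (-1) l qq (adm_poly P) au.
  rewrite laurent_poly // PQ coef_poly ltnS ld mulN1r addNr => <-.
  by apply: L_ext => t _; congr (_ * _); ring.
suff H k : (k <= d.+1)%N -> vanish (d.+2 - k) (fun t => u t - P.[g t]).
  by have := H d.+1 (leqnn _); rewrite subSS subSnn.
elim: k => [|k IH] kd; first by rewrite subn0.
have ek : ((d.+2 - k.+1).+1 = d.+2 - k)%N by lia.
apply: (vanish_down qq); first by rewrite ek; exact: IH (ltnW kd).
rewrite -(lr (d - k)%N (leq_subr _ _)); apply: L_ext => t _; congr (_ * _).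
by rewrite -opprD -[1]/(1%:Z) -PoszD -exprnN; congr (_ ^- _); lia.
Qed.

(** The coefficients of nonnegative index around any center x are the Taylor coefficients of P at
    x, so the sum over l is the integral of u P', whatever x. *)
Lemma laurent_pairing_center d c q u : c \in pts -> q \in pts -> vanish d.+2 u ->
  \sum_(l < d) l.+1%:R * laurent c u l.+1 * laurent c u (- l.+1%:Z) =
  \sum_(l < d) l.+1%:R * laurent q u l.+1 * laurent q u (- l.+1%:Z).
Proof.
move=> cc qq vu; have [au _] := vu; have [P sP vP] := vanish_poly_part cc vu.
have aP := adm_poly P.
suff H x : x \in pts -> \sum_(l < d) l.+1%:R * laurent x u l.+1 * laurent x u (- l.+1%:Z) =
    L (fun t => u t * P^`().[g t]) by rewrite !H.
move=> xx; pose Q := P \Po ('X + x%:P).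
have lQ (l : nat) : laurent x u l = Q`_l.
  rewrite -laurent_poly //.
  have := laurent_lin 1 l xx (proj1 vP) aP; rewrite (laurent_band xx vP) // mulr0 add0r => <-.
  by apply: L_ext => t _; rewrite mul1r subrK.
have sQ : (size Q <= d.+1)%N.
  apply: leq_trans sP; rewrite /Q (_ : 'X + x%:P = 'X - (- x)%:P) ?size_comp_poly2 ?size_XsubC //.
  by rewrite polyCN opprK.
have -> : L (fun t => u t * P^`().[g t]) =
   L (fun t => \sum_(l < d) (l.+1%:R * Q`_l.+1) * (u t * (g t - x) ^+ l)).
  apply: L_ext => t _.
  have -> : P^`().[g t] = Q^`().[g t - x].
    by rewrite deriv_comp derivD derivX derivC addr0 mulr1 horner_comp !hornerE subrK.
  have sQ' : (size Q^`() <= d)%N.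
    have [->|Q0] := eqVneq Q 0; first by rewrite deriv0 size_poly0.
    by rewrite -ltnS; apply: leq_trans (lt_size_deriv Q0) sQ.
  rewrite (horner_coef_wide _ sQ') mulr_sumr; apply: eq_bigr => l _.
  by rewrite coef_deriv -mulr_natl; ring.
rewrite (@L_sum d (fun l => l.+1%:R * Q`_l.+1) (fun l t => u t * (g t - x) ^+ l)); last first.
  by move=> i; apply: adm_mul => //; apply: adm_pow; exact: adm_shift.
apply: eq_bigr => l _; rewrite lQ; congr (_ * _); apply: L_ext => t _; congr (_ * _).
by rewrite opprK -[1]/(1%:Z) -addn1 PoszD addrK.
Qed.

Section Symbol.
Variables (R : realType) (iota : {rmorphism R -> C}) (m : nat) (a b : 'I_m -> R) (j0 : 'I_m).
Hypothesis b_pts : forall j, iota (b j) \in pts.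
Let c := iota (b j0).

Definition symbol t : C := g t + \sum_(j < m) iota (a j) / (g t - iota (b j)).

Lemma vanish_mul_symbol n u : vanish n u -> vanish n.+1 (fun t => u t * symbol t).
Proof.
move=> vu.
have h : vanish n.+1 (fun t => \sum_(j < m) iota (a j) * (u t * (g t - iota (b j))^-1)).
  elim: (index_enum 'I_m) => [|j s IH].
    by have := vanish0 n.+1; congr vanish; apply/funext => t; rewrite big_nil.
  have vj : vanish n.+1 (fun t => u t * (g t - iota (b j))^-1).
    by apply: vanish_inv => //; apply: vanish_leq vu; rewrite leqW.
  have := vanish_lin (iota (a j)) vj IH.
  by congr vanish; apply/funext => t; rewrite big_cons.
have := vanish_lin 1 (vanish_shift 0 vu) h; congr vanish; apply/funext => t.
rewrite mul1r subr0 /symbol mulrDr mulr_sumr; congr (_ + _); apply: eq_bigr => j _; ring.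
Qed.

Lemma vanish_symbol_pow r : vanish r.+2 (fun t => symbol t ^+ r).
Proof.
elim: r => [|r IH]; first by have := vanish1; congr vanish.
by have := vanish_mul_symbol IH; congr vanish; apply/funext => t; rewrite exprSr.
Qed.

(** Geometric expansion with remainder. *)
Lemma inv_expand p t N : p \in pts -> D t ->
  (g t - p)^-1 = \sum_(l < N) (p - c) ^+ l * (g t - c) ^- l.+1 +
     (p - c) ^+ N * ((g t - c) ^- N * (g t - p)^-1).
Proof.
move=> pp Dt; have cc : c \in pts by exact: b_pts.
elim: N => [|N IH]; first by rewrite big_ord0 add0r !expr0 invr1 !mul1r.
rewrite big_ord_recr /= {1}IH -addrA; congr (_ + _).
rewrite {1}(inv_sub2 pp cc Dt) !exprS !invfM; move: ((g t - c) ^- N) => Q; ring.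
Qed.

(** Terms beyond the band vanish, so the number of terms may be increased. *)
Lemma symbol_power_wide r (t : int) N : (absz (r.+1%:Z - t)%R < N)%N ->
  symbol_power a b j0 r.+1 t =
  \sum_(p < N) nn_symbol a b j0 p * symbol_power a b j0 r (t - 1 + p%:Z).
Proof.
move=> hN; rewrite -[LHS]/(\sum_(p < (absz (r.+1%:Z - t)%R).+1)
   nn_symbol a b j0 p * symbol_power a b j0 r (t - 1 + p%:Z)).
rewrite (big_ord_widen _ (fun p : nat =>
  nn_symbol a b j0 p * symbol_power a b j0 r (t - 1 + p%:Z)) hN).
rewrite big_mkcond; apply: eq_bigr => p _; case: ifPn => //; rewrite -leqNgt => hp.
by rewrite symbol_power_band ?mulr0 //; lia.
Qed.

(** Induction on r: multiplying by the symbol and expanding 1 / (z - b_j) around c to a high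
    order M gives the recursion of [symbol_power]; the remainder has order at most -2 at
    infinity and integrates to zero. *)
Lemma laurent_symbol_pow r (l : int) :
  laurent c (fun t => symbol t ^+ r) l = iota (symbol_power a b j0 r l).
Proof.
have cc : c \in pts by exact: b_pts.
elim: r l => [|r IH] l.
  rewrite /= rmorph_nat /laurent (_ : (l == 0) = (- l - 1 == -1)); last by apply/idP/idP; lia.
  by rewrite -(L_zpow _ cc); apply: L_ext => t _; rewrite expr0 mul1r.
(* Large enough for the remainder to have order at most -2. *)
pose M := absz (r.+1%:Z - l)%R.
rewrite (@symbol_power_wide _ _ M.+2) //.
have [as_ _] := vanish_symbol_pow r.
pose G t := symbol t ^+ r.
have aZ k : adm (fun t => G t * (g t - c) ^ k) by apply: adm_mul => //; exact: adm_zpow.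
pose W j (i : nat) : C := iota (a j) * (iota (b j) - c) ^+ i.
pose rest j t := G t * (g t - c) ^ (- l - 1 - M%:Z) * (g t - iota (b j))^-1.
have aR j : adm (rest j) by apply: adm_mul => //; exact: adm_inv.
have R0 j : L (rest j) = 0.
  have Mk : exists2 k : nat, - l - 1 - M%:Z = - k%:Z & (r.+1 <= k)%N.
    by exists (absz (l + 1 + M%:Z)%R); rewrite /M; lia.
  have [k ek rk] := Mk.
  have v : vanish r.+1 (fun t => G t * (g t - iota (b j))^-1).
    by apply: vanish_inv => //; exact: vanish_symbol_pow.
  rewrite -(vanish_invn cc v rk); apply: L_ext => t _; rewrite /rest ek -exprnN; ring.
rewrite big_ord_recl big_ord_recl.
have expand t : D t -> symbol t ^+ r.+1 * (g t - c) ^ (- l - 1) =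
  1 * (G t * (g t - c) ^ (- (l - 1) - 1)) + (c * (G t * (g t - c) ^ (- l - 1)) +
    \sum_(j < m) (\sum_(i < M) W j i * (G t * (g t - c) ^ (- (l - 1 + i.+2%:Z) - 1)) + W j M
      * rest j t)).
  move=> Dt; have z0 : g t - c != 0 by rewrite g_neq.
  have -> : (g t - c) ^ (- (l - 1) - 1) = (g t - c) * (g t - c) ^ (- l - 1).
    by rewrite -[X in X * _]expr1z -expfzDr //; congr (_ ^ _); ring.
  have sE : symbol t = g t + \sum_(j < m) iota (a j) / (g t - iota (b j)) by [].
  rewrite exprS -/(G t) sE.
  have -> : \sum_(j < m) iota (a j) / (g t - iota (b j)) = \sum_(j < m)
     (\sum_(i < M) W j i * (g t - c) ^- i.+1 + W j M * ((g t - c) ^- M * (g t - iota (b j))^-1)).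
    apply: eq_bigr => j _; rewrite {1}(inv_expand M (b_pts j) Dt) mulrDr mulr_sumr.
    by congr (_ + _); [apply: eq_bigr => i _|]; rewrite mulrA.
  have -> : \sum_(j < m) (\sum_(i < M) W j i * (G t * (g t - c) ^ (- (l - 1 + i.+2%:Z) - 1))
    + W j M * rest j t)
    = (\sum_(j < m) (\sum_(i < M) W j i * (g t - c) ^- i.+1 +
         W j M * ((g t - c) ^- M * (g t - iota (b j))^-1))) * (G t * (g t - c) ^ (- l - 1)).
    rewrite mulr_suml; apply: eq_bigr => j _; rewrite mulrDl mulr_suml; congr (_ + _).
      apply: eq_bigr => i _.
      have -> : (g t - c) ^ (- (l - 1 + i.+2%:Z) - 1) = (g t - c) ^- i.+1 * (g t - c) ^ (- l - 1).
        by rewrite exprnN -expfzDr //; congr (_ ^ _); lia.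
      ring.
    rewrite /rest.
    have -> : (g t - c) ^ (- l - 1 - M%:Z) = (g t - c) ^- M * (g t - c) ^ (- l - 1).
      by rewrite exprnN -expfzDr //; congr (_ ^ _); lia.
    ring.
  ring.
transitivity (L (fun t =>
  1 * (G t * (g t - c) ^ (- (l - 1) - 1)) + (c * (G t * (g t - c) ^ (- l - 1)) +
    \sum_(j < m) (\sum_(i < M) W j i * (G t * (g t - c) ^ (- (l - 1 + i.+2%:Z) - 1)) + W j M
      * rest j t)))).
  exact: L_ext.
have inner j : adm (fun t =>
  \sum_(i < M) W j i * (G t * (g t - c) ^ (- (l - 1 + i.+2%:Z) - 1)) + W j M * rest j t)
  /\ L (fun t => \sum_(i < M) W j i * (G t * (g t - c) ^ (- (l - 1 + i.+2%:Z) - 1)) + W j M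
    * rest j t)
  = \sum_(i < M) W j i * iota (symbol_power a b j0 r (l - 1 + i.+2%:Z)).
  have aS := @adm_sum M (W j) (fun i t => G t * (g t - c) ^ (- (l - 1 + i.+2%:Z) - 1)) (fun i =>
    aZ _).
  have e : (fun t => \sum_(i < M) W j i * (G t * (g t - c) ^ (- (l - 1 + i.+2%:Z) - 1)) + W j M
    * rest j t)
     = (fun t => W j M * rest j t + \sum_(i < M) W j i
       * (G t * (g t - c) ^ (- (l - 1 + i.+2%:Z) - 1))).
    by apply/funext => t; rewrite addrC.
  rewrite e; split; first exact: adm_lin.
  rewrite L_lin // R0 mulr0 add0r (L_sum _ _ (fun i => aZ (- (l - 1 + i.+2%:Z) - 1))).
  by apply: eq_bigr => i _; rewrite -IH.
have outer (s : seq 'I_m) (h : 'I_m -> T -> C) (v : 'I_m -> C) : (forall j,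
  adm (h j) /\ L (h j) = v j) ->
    adm (fun t => \sum_(j <- s) h j t) /\ L (fun t => \sum_(j <- s) h j t) = \sum_(j <- s) v j.
  move=> hv; elim: s => [|j s [IHa IHL]].
    split; last first.
      rewrite [RHS]big_nil; transitivity (L (fun=> 0)); last exact: L0.
      by apply: L_ext => t _; rewrite big_nil.
    by have := adm_cst 0; congr adm; apply/funext => t; rewrite big_nil.
  have [aj ej] := hv j.
  have e : (fun t => \sum_(k <- j :: s) h k t) = (fun t => 1 * h j t + \sum_(k <- s) h k t).
    by apply/funext => t; rewrite big_cons mul1r.
  rewrite e; split; first exact: adm_lin.
  by rewrite L_lin // mul1r IHL ej big_cons.
have [aO eO] := outer (index_enum 'I_m) _ _ inner.
rewrite L_lin // ; last by apply: adm_lin.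
rewrite L_lin // eO mul1r rmorphD rmorphD /= !rmorphM /= rmorph1 mul1r -!IH addr0.
congr (_ + (_ * _ + _)).
  by rewrite /bump /= addn0; congr (laurent c _ _); ring.
rewrite exchange_big rmorph_sum /=; apply: eq_bigr => i _.
rewrite rmorphM rmorph_sum mulr_suml; apply: eq_bigr => j _.
by rewrite /W rmorphM rmorphXn rmorphB.
Qed.

Variable f : {poly R}.

Definition symbol_value t : C := (map_poly iota f).[symbol t].

Lemma symbol_valueE t : symbol_value t = \sum_(r < size f) iota f`_r * symbol t ^+ r.
Proof.
rewrite /symbol_value (horner_coef_wide _ (size_poly _ _)).
by apply: eq_bigr => r _; rewrite coef_map.
Qed.

Lemma vanish_symbol_value : vanish (size f).-1.+2 symbol_value.
Proof.
have := @vanish_sum (size f).-1.+2 (size f) (fun r => iota f`_r) (fun r t => symbol t ^+ r).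
move=> /(_ _)/wrap[r rf|]; first by apply: vanish_leq (vanish_symbol_pow r); rewrite !ltnS; lia.
by congr vanish; apply/funext => t; rewrite symbol_valueE.
Qed.

Lemma laurent_symbol_value l : laurent c symbol_value l = iota (symbol_poly a b j0 f l).
Proof.
have cc : c \in pts by exact: b_pts.
rewrite /symbol_poly rmorph_sum /=.
under [RHS]eq_bigr => r _ do rewrite rmorphM /= -laurent_symbol_pow.
rewrite -(@laurent_sum c (size f) (fun r => iota f`_r) (fun r t => symbol t ^+ r)) //; last first.
  by move=> r; have [] := vanish_symbol_pow r.
by apply: L_ext => t _; rewrite symbol_valueE.
Qed.
End Symbol.
End ResidueFunctional.

(** * Integrals of piecewise C1 functions along a closed path *)

Section PathIntegral.
Variable R : realType.
Notation mu := (@lebesgue_measure R).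
Implicit Types (a b c d : R) (s : seq R) (x y h k : R -> R).

Lemma integrable_itv_oo a b h :
  mu.-integrable `]a, b[ (EFin \o h) -> mu.-integrable `[a, b] (EFin \o h).
Proof.
move=> /integrableP[mh fh].
have mh' : measurable_fun `[a, b] (EFin \o h).
  by apply/measurable_EFinP; apply: measurable_fun_itv_cc; apply/measurable_EFinP; exact: mh.
apply/integrableP; split => //; rewrite integral_itv_bndoo //.
exact: measurableT_comp.
Qed.

Lemma integrable_disjoint_setU (A B : set R) (f : R -> \bar R) : measurable A -> measurable B ->
  [disjoint A & B] -> mu.-integrable A f -> mu.-integrable B f -> mu.-integrable (A `|` B) f.
Proof.
move=> mA mB AB /integrableP[mfA fA] /integrableP[mfB fB].
have mAB : measurable_fun (A `|` B) f by apply/measurable_funU.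
apply/integrableP; split => //; rewrite integral_setU //; last exact: measurableT_comp.
by rewrite lte_add_pinfty.
Qed.

(** Integrals over the open pieces suffice, since the knots form a null set. *)
Lemma Rintegral_pieces a s h : path <%R a s ->
  (forall i, (i < size s)%N -> mu.-integrable `](a :: s)`_i, s`_i[ (EFin \o h)) ->
  mu.-integrable `[a, last a s] (EFin \o h) /\
  \int[mu]_(t in `[a, last a s]) h t = \sum_(i < size s) \int[mu]_(t in `](a :: s)`_i, s`_i[) h t.
Proof.
elim: s a => [|b s IH] a /=.
  move=> _ _; rewrite big_ord0 set_itv1 Rintegral_set1; split => //.
  apply/integrableP; split; first exact: measurable_fun_set1.
  by rewrite integral_set1.
move=> /andP[ab bs] hI.
have [i2 e2] := IH b bs (fun i is_ => hI i.+1 is_).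
have iab := integrable_itv_oo (hI 0%N isT : mu.-integrable `]a, b[ (EFin \o h)).
have bl : b <= last b s.
  elim: s b bs {IH ab hI i2 e2 iab} => [|e s IH] b //= /andP[be /IH]; exact: le_trans (ltW be).
have U : `[a, last b s]%classic = `[a, b] `|` `]b, last b s].
  by rewrite (@itv_bndbnd_setU _ _ _ (BRight b)) // bnd_simp // ltW.
have dj : [disjoint `[a, b]%classic & `]b, last b s]%classic].
  apply/disj_setPS => t [] /=; rewrite !in_itv /= => /andP[_ tb] /andP[bt _].
  by have := lt_le_trans bt tb; rewrite ltxx.
have i2' : mu.-integrable `]b, last b s] (EFin \o h).
  by apply: integrableS i2 => //; apply: subset_itvr; rewrite bnd_simp.
have iU : mu.-integrable (`[a, b] `|` `]b, last b s]) (EFin \o h).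
  exact: integrable_disjoint_setU.
rewrite U; split => //; rewrite Rintegral_setU // big_ord_recl /=; congr (_ + _).
  by rewrite /Rintegral integral_itv_bndoo //; exact: (measurable_int mu (hI 0%N isT)).
by rewrite Rintegral_itv_obnd_cbnd // e2.
Qed.

Lemma path_bounds a s i : path <%R a s -> (i <= size s)%N -> a <= (a :: s)`_i <= last a s.
Proof.
elim: s a i => [|b s IH] a [|i] //=; first by rewrite lexx.
  move=> /andP[ab /(IH b 0%N)/(_ isT)/andP[_ h]] _; rewrite lexx /=.
  exact: le_trans (ltW ab) h.
move=> /andP[ab bs] ils; have /andP[h ->] := IH b i bs ils.
by rewrite andbT (le_trans (ltW ab)).
Qed.

Lemma telescope_path a s x :
  \sum_(i < size s) (x s`_i - x (a :: s)`_i) = x (last a s) - x a.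
Proof.
elim: s a => [|b s IH] a /=; first by rewrite big_ord0 subrr.
by rewrite big_ord_recl /= IH; ring.
Qed.

Section C1Calculus.
Variables (c d : R).

Lemma C1_on_cst (v : R) : C1_on c d (fun=> v).
Proof.
split; first by move=> t; exact: cvg_cst.
exists (fun=> 0) => [t|t _]; first exact: cvg_cst.
exact: is_derive_cst.
Qed.

Lemma C1_onD x y : C1_on c d x -> C1_on c d y -> C1_on c d (fun t => x t + y t).
Proof.
move=> [xc [x' x'c dx]] [yc [y' y'c dy]]; split; first by move=> t; apply: cvgD;
  [exact: xc|exact: yc].
exists (fun t => x' t + y' t) => [t|t tcd]; first by apply: cvgD; [exact: x'c|exact: y'c].
by have hx := dx t tcd; have hy := dy t tcd; exact: is_deriveD.
Qed.

Lemma C1_onM x y : C1_on c d x -> C1_on c d y -> C1_on c d (fun t => x t * y t).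
Proof.
move=> [xc [x' x'c dx]] [yc [y' y'c dy]]; split; first by move=> t; apply: cvgM;
  [exact: xc|exact: yc].
exists (fun t => x t * y' t + y t * x' t) => [t|t tcd].
  by apply: cvgD; apply: cvgM; [exact: xc|exact: y'c|exact: yc|exact: x'c].
have hx := dx t tcd; have hy := dy t tcd; exact: is_deriveM.
Qed.

Lemma C1_onV x :
  (forall t, t \in `[c, d] -> x t != 0) -> C1_on c d x -> C1_on c d (fun t => (x t)^-1).
Proof.
move=> x0 [xc [x' x'c dx]].
have Vc : {within `[c, d], continuous (fun t => (x t)^-1)}.
  apply/subspace_continuousP => t tcd; apply: cvgV; first exact: x0.
  exact: (subspace_continuousP _ _).1 xc t tcd.
split => //; exists (fun t => - ((x t)^-1 * (x t)^-1) * x' t) => [t|t tcd].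
  by apply: cvgM; [apply: cvgN; apply: cvgM; exact: Vc|exact: x'c].
have hx := dx t tcd; have xt0 : x t != 0 by apply: x0; apply: subset_itvW tcd; rewrite lexx.
have := is_deriveV xt0 hx; congr is_derive.
by rewrite /GRing.scale /= -expr2 exprVn.
Qed.

Lemma derive1_C1_on x : C1_on c d x -> exists2 x' : R -> R, {within `[c, d], continuous x'} &
  forall t, t \in `]c, d[ -> derive1 x t = x' t.
Proof.
move=> [_ [x' x'c dx]]; exists x' => // t tcd; rewrite derive1E.
by have h := dx t tcd; rewrite derive_val.
Qed.

Lemma derivable_C1_on x t : C1_on c d x -> t \in `]c, d[ -> derivable x t 1.
Proof. by move=> [_ [x' _ dx]] tcd; have h := dx t tcd. Qed.

(** At the endpoints [derive1] is arbitrary, so it is replaced by its continuous extension. *)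
Lemma C1_on_integrable x y : C1_on c d x -> C1_on c d y ->
  mu.-integrable `]c, d[ (EFin \o (fun t => y t * derive1 x t)).
Proof.
move=> /derive1_C1_on[x' x'c xE] [yc _].
have i1 : mu.-integrable `[c, d] (EFin \o (fun t => y t * x' t)).
  apply: continuous_compact_integrable; first exact: segment_compact.
  by move=> t; apply: cvgM; [exact: yc|exact: x'c].
have i2 : mu.-integrable `]c, d[ (EFin \o (fun t => y t * x' t)).
  by apply: integrableS i1 => //; exact: subset_itvW.
by apply: eq_integrable i2 => // t /[!inE] tcd /=; rewrite xE.
Qed.

Lemma C1_on_FTC x : c < d -> C1_on c d x -> \int[mu]_(t in `]c, d[) derive1 x t = x d - x c.
Proof.
move=> cd Cx; have [x' x'c xE] := derive1_C1_on Cx; have [xc _] := Cx.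
have -> : \int[mu]_(t in `]c, d[) derive1 x t = \int[mu]_(t in `]c, d[) x' t.
  by apply: eq_Rintegral => t /[!inE] tcd; rewrite xE.
have m' : measurable_fun `[c, d] x'.
  by apply: subspace_continuous_measurable_fun.
rewrite /Rintegral -(@integral_itv_bndoo _ c d _ true false); last first.
  by apply/measurable_EFinP; apply: measurable_funS m' => //; exact: subset_itvW.
rewrite (@continuous_FTC2 _ x' x) //.
have /(continuous_within_itvP _ cd)[xo xl xr] := xc.
by split => // t tcd; exact: derivable_C1_on Cx tcd.
Qed.
End C1Calculus.

Section Complexified.
Variable s : seq R.
Hypotheses (s_path : path <%R 0 s) (s_last : last 0 s = 1).
Implicit Types (u w H K : R -> R[i]).
Notation C := R[i].
Notation knot i := ((0 :: s)`_i).

Let knot_lt i : (i < size s)%N -> knot i < s`_i.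
Proof. by move/(pathP 0): s_path; apply. Qed.

Lemma piece_sub01 i t : (i < size s)%N -> t \in `]knot i, s`_i[ -> t \in `[0, 1].
Proof.
move=> is_; rewrite !in_itv /= => /andP[l r].
have /andP[h1 _] := path_bounds s_path (ltnW is_).
have /andP[_ h2] := @path_bounds 0 s i.+1 s_path is_.
rewrite s_last in h2; by rewrite (le_trans h1 (ltW l)) (le_trans (ltW r) h2).
Qed.

Definition piecewise_integrable h := forall i, (i < size s)%N ->
  mu.-integrable `]knot i, s`_i[ (EFin \o h).

Definition integral01 h := \int[mu]_(t in `[0, 1]) h t.

Lemma integral01E h : piecewise_integrable h ->
  integral01 h = \sum_(i < size s) \int[mu]_(t in `]knot i, s`_i[) h t.
Proof. by move=> hI; have [_] := Rintegral_pieces s_path hI; rewrite s_last. Qed.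

Lemma piecewise_integrable_lin (v : R) h k : piecewise_integrable h -> piecewise_integrable k ->
  piecewise_integrable (fun t => v * h t + k t).
Proof.
move=> hI kI i is_; have h1 : mu.-integrable `]knot i, s`_i[ (fun t => v%:E * (h t)%:E)%E.
  by apply: integrableZl => //; exact: hI.
have : mu.-integrable `]knot i, s`_i[ ((fun t => v%:E * (h t)%:E) \+ (EFin \o k))%E.
  by apply: integrableD => //; exact: kI.
by apply: eq_integrable.
Qed.

Lemma integral01_lin (v : R) h k : piecewise_integrable h -> piecewise_integrable k ->
  integral01 (fun t => v * h t + k t) = v * integral01 h + integral01 k.
Proof.
move=> hI kI; rewrite !integral01E //; last exact: piecewise_integrable_lin.
rewrite mulr_sumr -big_split; apply: eq_bigr => i _.
have h1 := hI i (ltn_ord i); have k1 := kI i (ltn_ord i).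
rewrite RintegralD ?RintegralZl //.
have : mu.-integrable `]knot i, s`_i[ (fun t => v%:E * (h t)%:E)%E by apply: integrableZl.
by apply: eq_integrable.
Qed.

Definition eq_on_pieces (V : Type) (H K : R -> V) := forall i t, (i < size s)%N ->
  t \in `]knot i, s`_i[ -> H t = K t.

Lemma piecewise_integrable_ext h k : eq_on_pieces h k -> piecewise_integrable h ->
  piecewise_integrable k.
Proof.
move=> hk hI i is_; apply: eq_integrable (hI i is_) => // t /[!inE] ti /=.
by rewrite (hk i t).
Qed.

Lemma integral01_ext h k : eq_on_pieces h k -> piecewise_integrable h -> integral01 h =
  integral01 k.
Proof.
move=> hk hI; rewrite !integral01E //; last exact: piecewise_integrable_ext hk hI.
by apply: eq_bigr => i _; apply: eq_Rintegral => t /[!inE] ti; rewrite (hk i t).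
Qed.

Definition piecewise_C1_real x := forall i, (i < size s)%N -> C1_on (knot i) s`_i x.

Definition cintegrable H :=
  piecewise_integrable (fun t => complex.Re (H t)) /\
  piecewise_integrable (fun t => complex.Im (H t)).
Definition cintegral01 H : C :=
  integral01 (fun t => complex.Re (H t)) +i* integral01 (fun t => complex.Im (H t)).
(** All functions considered are C1 on the pieces of one fixed partition [s], which makes them an
    algebra. *)
Definition C1_path u :=
  piecewise_C1_real (fun t => complex.Re (u t)) /\
  piecewise_C1_real (fun t => complex.Im (u t)).

Lemma ReM (z z' : C) : complex.Re (z * z') = complex.Re z * complex.Re z' - complex.Im z
  * complex.Im z'.
Proof. by case: z z' => [? ?] [? ?]. Qed.
Lemma ImM (z z' : C) : complex.Im (z * z') = complex.Re z * complex.Im z' + complex.Im z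
  * complex.Re z'.
Proof. by case: z z' => [? ?] [? ?]. Qed.
Lemma ReD (z z' : C) : complex.Re (z + z') = complex.Re z + complex.Re z'.
Proof. by case: z z' => [? ?] [? ?]. Qed.
Lemma ImD (z z' : C) : complex.Im (z + z') = complex.Im z + complex.Im z'.
Proof. by case: z z' => [? ?] [? ?]. Qed.

Lemma cintegral01_ext H K : eq_on_pieces H K -> cintegrable H -> cintegral01 H = cintegral01 K.
Proof.
move=> HK [hr hi]; rewrite /cintegral01; congr (_ +i* _); apply: integral01_ext => // i t is_ ti /=;
  by rewrite (HK i t).
Qed.

Lemma cintegral01_lin (z : C) H K : cintegrable H -> cintegrable K ->
  cintegral01 (fun t => z * H t + K t) = z * cintegral01 H + cintegral01 K.
Proof.
move=> [hr hi] [kr ki].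
have r1 := piecewise_integrable_lin (- complex.Im z) hi kr.
have i1 := piecewise_integrable_lin (complex.Im z) hr ki.
have Re_e : (fun t => complex.Re (z * H t + K t)) =
  (fun t => complex.Re z * complex.Re (H t)
    + (- complex.Im z * complex.Im (H t) + complex.Re (K t))).
  by apply/funext => t /=; rewrite ReD ReM; ring.
have Im_e : (fun t => complex.Im (z * H t + K t)) =
  (fun t => complex.Re z * complex.Im (H t) + (complex.Im z * complex.Re (H t) + complex.Im (K t))).
  by apply/funext => t /=; rewrite ImD ImM; ring.
rewrite /cintegral01 Re_e Im_e (integral01_lin _ hr r1) (integral01_lin _ hi i1).
rewrite (integral01_lin _ hi kr) (integral01_lin _ hr ki).
by case: z {r1 i1 Re_e Im_e} => zr zi; apply/eqP; rewrite eq_complex /=; apply/andP; split;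
  apply/eqP; ring.
Qed.

Lemma C1_path_cst (z : C) : C1_path (fun=> z).
Proof. by split=> i is_; exact: C1_on_cst. Qed.

Lemma C1_pathM u w : C1_path u -> C1_path w -> C1_path (fun t => u t * w t).
Proof.
move=> [ur ui] [wr wi]; split=> i is_.
  have := C1_onD (C1_onM (ur i is_) (wr i is_))
    (C1_onM (C1_on_cst _ _ (-1)) (C1_onM (ui i is_) (wi i is_))).
  by congr C1_on; apply/funext => t /=; rewrite ReM mulN1r.
have := C1_onD (C1_onM (ur i is_) (wi i is_)) (C1_onM (ui i is_) (wr i is_)).
by congr C1_on; apply/funext => t /=; rewrite ImM.
Qed.

Lemma C1_pathD u w : C1_path u -> C1_path w -> C1_path (fun t => u t + w t).
Proof.
move=> [ur ui] [wr wi]; split=> i is_.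
  by have := C1_onD (ur i is_) (wr i is_); congr C1_on; apply/funext => t /=; rewrite ReD.
by have := C1_onD (ui i is_) (wi i is_); congr C1_on; apply/funext => t /=; rewrite ImD.
Qed.

Lemma C1_path_lin (z : C) u w : C1_path u -> C1_path w -> C1_path (fun t => z * u t + w t).
Proof. by move=> hu hw; apply: C1_pathD => //; apply: C1_pathM => //; exact: C1_path_cst. Qed.

Lemma C1_pathX u n : C1_path u -> C1_path (fun t => u t ^+ n).
Proof.
move=> hu; elim: n => [|n IH]; first by have := C1_path_cst 1; congr C1_path.
by have := C1_pathM hu IH; congr C1_path; apply/funext => t; rewrite exprS.
Qed.

Lemma C1_pathV u :
  (forall t, t \in `[0, 1] -> u t != 0) -> C1_path u -> C1_path (fun t => (u t)^-1).
Proof.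
move=> u0 [ur ui].
pose nrm t := complex.Re (u t) ^+ 2 + complex.Im (u t) ^+ 2.
have V i : (i < size s)%N -> C1_on (knot i) s`_i (fun t => (nrm t)^-1).
  move=> is_; apply: C1_onV => [t ti|].
    have t01 : t \in `[0, 1].
      move: ti; rewrite !in_itv /= => /andP[l r].
      have /andP[h1 _] := path_bounds s_path (ltnW is_).
      have /andP[_ h2] := @path_bounds 0 s i.+1 s_path is_.
      by rewrite s_last in h2; rewrite (le_trans h1 l) (le_trans r h2).
    apply: contra (u0 t t01); rewrite /nrm paddr_eq0 ?sqr_ge0 // !sqrf_eq0.
    by case: (u t) => p q /= /andP[/eqP -> /eqP ->].
  have := C1_onD (C1_onM (ur i is_) (ur i is_)) (C1_onM (ui i is_) (ui i is_)).
  by congr C1_on; apply/funext => t /=; rewrite -!expr2.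
split=> i is_.
  have := C1_onM (ur i is_) (V i is_); congr C1_on; apply/funext => t /=.
  by rewrite /nrm; case: (u t).
have := C1_onM (C1_onM (C1_on_cst _ _ (-1)) (ui i is_)) (V i is_); congr C1_on; apply/funext =>
  t /=.
by rewrite /nrm; case: (u t) => p q /=; rewrite mulN1r mulNr.
Qed.

Lemma C1_path_integrable u w : C1_path u -> C1_path w ->
  cintegrable (fun t => u t * contour_derive w t).
Proof.
move=> [ur ui] [wr wi].
have I x y : piecewise_C1_real x -> piecewise_C1_real y ->
    piecewise_integrable (fun t => y t * derive1 x t).
  by move=> hx hy i is_; exact: C1_on_integrable (hx i is_) (hy i is_).
split.
  have := piecewise_integrable_lin (-1) (I _ _ wi ui) (I _ _ wr ur).
  by apply: piecewise_integrable_ext => i t _ _ /=; rewrite ReM /=; ring.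
have := piecewise_integrable_lin 1 (I _ _ wr ui) (I _ _ wi ur).
by apply: piecewise_integrable_ext => i t _ _ /=; rewrite ImM /=; ring.
Qed.

Lemma cintegral01_derive w : C1_path w -> cintegral01 (contour_derive w) = w 1 - w 0.
Proof.
move=> [wr wi].
have F x : piecewise_C1_real x -> integral01 (derive1 x) = x 1 - x 0.
  move=> hx; rewrite integral01E; last first.
    move=> i is_; have := C1_on_integrable (hx i is_) (C1_on_cst _ _ 1).
    by apply: eq_integrable => // t _; rewrite /= mul1r.
  rewrite -[in RHS]s_last -telescope_path; apply: eq_bigr => i _.
  by rewrite C1_on_FTC // ?knot_lt //; exact: hx.
rewrite /cintegral01 (F _ wr) (F _ wi) /=.
by case: (w 1) (w 0) => [? ?] [? ?].
Qed.

Lemma contour_deriveM u w : C1_path u -> C1_path w ->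
  eq_on_pieces (contour_derive (fun t => u t * w t))
    (fun t => u t * contour_derive w t + w t * contour_derive u t).
Proof.
move=> [ur ui] [wr wi] i t is_ ti.
have dx x : piecewise_C1_real x -> is_derive t 1 x (derive1 x t).
  by move=> hx; rewrite derive1E; apply: derivableP; exact: derivable_C1_on (hx i is_) ti.
have hur := dx _ ur; have hui := dx _ ui; have hwr := dx _ wr; have hwi := dx _ wi.
rewrite /contour_derive.
have -> : (fun t => complex.Re (u t * w t)) = (fun t => complex.Re (u t))
  * (fun t => complex.Re (w t)) - (fun t => complex.Im (u t)) * (fun t => complex.Im (w t)).
  by apply/funext => r; rewrite ReM.
have -> : (fun t => complex.Im (u t * w t)) = (fun t => complex.Re (u t))
  * (fun t => complex.Im (w t)) + (fun t => complex.Im (u t)) * (fun t => complex.Re (w t)).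
  by apply/funext => r; rewrite ImM.
have eR := is_deriveB (is_deriveM hur hwr) (is_deriveM hui hwi).
have eI := is_deriveD (is_deriveM hur hwi) (is_deriveM hui hwr).
rewrite !(derive1E (_ + _)) !derive_val.
move: (derive1 _ _) (derive1 _ _) (derive1 _ _) (derive1 _ _) => a1 a2 a3 a4.
rewrite /GRing.scale /=; case: (u t) (w t) => [p q] [p' q'] /=.
by apply/eqP; rewrite eq_complex /=; apply/andP; split; apply/eqP; ring.
Qed.

Lemma contour_derive_cst (z : C) t : contour_derive (fun=> z) t = 0.
Proof. by rewrite /contour_derive !derive1_cst. Qed.

Lemma contour_deriveX u n : C1_path u ->
  eq_on_pieces (contour_derive (fun t => u t ^+ n.+1)) (fun t =>
    n.+1%:R * (u t ^+ n * contour_derive u t)).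
Proof.
move=> hu; elim: n => [|n IH] i t is_ ti.
  by rewrite expr0 !mul1r; congr (contour_derive _ t); apply/funext => r; rewrite expr1.
have -> : (fun t => u t ^+ n.+2) = (fun t => u t * u t ^+ n.+1) by apply/funext => r; rewrite exprS.
rewrite (contour_deriveM hu (C1_pathX n.+1 hu) is_ ti) (IH i t is_ ti) -[n.+2%:R]natr1 exprS; ring.
Qed.

(** Differentiate u u^-1 = 1. *)
Lemma contour_deriveV u : (forall t, t \in `[0, 1] -> u t != 0) -> C1_path u ->
  eq_on_pieces (contour_derive (fun t => (u t)^-1)) (fun t =>
    - ((u t)^-1) ^+ 2 * contour_derive u t).
Proof.
move=> u0 hu i t is_ ti; have hV := C1_pathV u0 hu.
have := contour_deriveM hu hV is_ ti.
have -> : contour_derive (fun t => u t * (u t)^-1) t = 0.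
  rewrite -(contour_derive_cst 1 t) /contour_derive !derive1E.
  have near1 : \near t, u t * (u t)^-1 = 1.
    have o : \forall r \near t, r \in `]knot i, s`_i[.
      by apply: near_in_itvoo.
    near=> r; rewrite divff // u0 //; apply: (piece_sub01 is_); near: r; exact: o.
  by congr (_ +i* _); apply: near_eq_derive; near=> r; (have -> : u r * (u r)^-1 = 1 by near: r).
have ut0 := u0 t (piece_sub01 is_ ti).
move=> /esym/eqP; rewrite addr_eq0 => /eqP e.
by apply: (mulfI ut0); rewrite e expr2 mulNr mulrN !mulrA divff // mul1r.
Unshelve. all: end_near. Qed.

(** w^n w' is the derivative of w^(n+1) / (n+1), and the path is closed. *)
Lemma cintegral01_pow w n : C1_path w -> w 0 = w 1 ->
  cintegral01 (fun t => w t ^+ n * contour_derive w t) = 0.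
Proof.
move=> hw w01; have hp := C1_pathX n hw; have hp1 := C1_pathX n.+1 hw.
have iC := C1_path_integrable hp hw.
have := cintegral01_derive hp1; rewrite w01 subrr.
have i0 : cintegrable (fun=> 0).
  have := C1_path_integrable (C1_path_cst 0) hw; congr cintegrable; apply/funext => t.
  by rewrite mul0r.
have iD : cintegrable (contour_derive (fun t => w t ^+ n.+1)).
  have := C1_path_integrable (C1_path_cst 1) hp1; congr cintegrable; apply/funext => t.
  by rewrite mul1r.
have z0 : cintegral01 (fun=> 0) = 0.
  have := cintegral01_lin (-1) i0 i0.
  have -> : (fun _ : R => -1 * 0 + 0) = (fun=> 0) :> (R -> C) by apply/funext => t; ring.
  by move=> e; rewrite {1}e mulN1r addNr.
have e1 := cintegral01_lin n.+1%:R iC i0; rewrite z0 addr0 in e1.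
rewrite (cintegral01_ext (K := fun t => n.+1%:R * (w t ^+ n * contour_derive w t) + 0) _ iD);
  last first.
  by move=> i t is_ ti; rewrite (contour_deriveX n hw is_ ti) addr0.
rewrite e1 => /eqP; rewrite mulf_eq0 pnatr_eq0 /= => /eqP //.
Qed.

End Complexified.
End PathIntegral.

(** * The contour integral as a residue functional *)

Lemma cvg_eventually_cst (T : topologicalType) (u : nat -> T) (l : T) N :
  (forall n, (N <= n)%N -> u n = l) -> u @ \oo --> l.
Proof. by move=> ul; apply: cvg_near_cst; exists N => // n /= /ul ->. Qed.

Lemma sum_from1_trunc (V : nmodType) (G : nat -> V) d N : (d < N)%N ->
  (forall l, (d < l)%N -> G l = 0) -> \sum_(1 <= l < N) G l = \sum_(l < d) G l.+1.
Proof.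
move=> dN G0; rewrite (big_cat_nat (n := d.+1)) //= [X in _ + X]big_nat [X in _ + X]big1 =>
  [|l /andP[dl _]]; last exact: G0.
by rewrite addr0 big_add1 /= big_mkord.
Qed.

Section ContourFunctional.
Variables (R : realType) (gamma : R -> R[i]) (s : seq R).
Hypotheses (s_path : path <%R 0 s) (s_last : last 0 s = 1).
Hypothesis gamma_C1 : C1_path s gamma.
Hypothesis gamma_closed : gamma 0 = gamma 1.
Notation C := R[i].
Implicit Types (u w : R -> C) (p : C).

Definition contour_fun u : C :=
  (@two_pi_i R)^-1 * cintegral01 (fun t => u t * contour_derive gamma t).
(** The points that may be used as poles. *)
Definition inside_pts : {pred C} := [pred p | `[< winds_once_around gamma p >]].

Lemma contour_fun_lin (c : C) u w : C1_path s u -> C1_path s w ->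
  contour_fun (fun t => c * u t + w t) = c * contour_fun u + contour_fun w.
Proof.
move=> hu hw; rewrite /contour_fun.
have -> : (fun t => (c * u t + w t) * contour_derive gamma t) =
   (fun t => c * (u t * contour_derive gamma t) + w t * contour_derive gamma t).
  by apply/funext => t; ring.
by rewrite (cintegral01_lin s_path s_last) //; [ring|exact: C1_path_integrable..].
Qed.

Lemma contour_fun_ext u w : (forall t, t \in `[0, 1] -> u t = w t) -> contour_fun u = contour_fun w.
Proof.
move=> uw; congr (_ * (_ +i* _)); apply: eq_Rintegral => t /[!inE] t01 /=; by rewrite uw.
Qed.

Lemma inside_neq p t : p \in inside_pts -> t \in `[0, 1] -> gamma t - p != 0.
Proof. by move=> /asboolP[h _] t01; rewrite subr_eq0 h. Qed.

Lemma C1_path_shift p : C1_path s (fun t => gamma t - p).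
Proof. exact: C1_pathD (C1_path_cst s (- p)). Qed.

Lemma C1_path_inv p : p \in inside_pts -> C1_path s (fun t => (gamma t - p)^-1).
Proof.
move=> pp; apply: (C1_pathV s_path s_last); last exact: C1_path_shift.
by move=> t t01; exact: inside_neq.
Qed.

Lemma contour_derive_shift p : eq_on_pieces s (contour_derive (fun t =>
  gamma t - p)) (contour_derive gamma).
Proof.
move=> i t is_ ti; have [gr gi] := gamma_C1.
have dx x : piecewise_C1_real s x -> is_derive t 1 x (derive1 x t).
  by move=> hx; rewrite derive1E; apply: derivableP; exact: derivable_C1_on (hx i is_) ti.
have hr := dx _ gr; have hi := dx _ gi.
rewrite /contour_derive.
have -> : (fun t => complex.Re (gamma t - p)) = (fun t => complex.Re (gamma t))
  - cst (complex.Re p).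
  by apply/funext => r; rewrite !fctE; case: (gamma r) (p) => [? ?] [? ?].
have -> : (fun t => complex.Im (gamma t - p)) = (fun t => complex.Im (gamma t))
  - cst (complex.Im p).
  by apply/funext => r; rewrite !fctE; case: (gamma r) (p) => [? ?] [? ?].
have eR := is_deriveB hr (is_derive_cst (complex.Re p) t (1 : R)).
have eI := is_deriveB hi (is_derive_cst (complex.Im p) t (1 : R)).
by rewrite !(derive1E (_ + _)) !derive_val !subr0.
Qed.

Lemma contour_fun_pow p n : contour_fun (fun t => (gamma t - p) ^+ n) = 0.
Proof.
have hp := C1_path_shift p; rewrite /contour_fun.
rewrite -(cintegral01_ext s_path s_last (H := fun t =>
  (gamma t - p) ^+ n * contour_derive (fun t => gamma t - p) t)).
- by rewrite (cintegral01_pow s_path s_last n hp) ?mulr0 // gamma_closed.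
- by move=> i t is_ ti; rewrite (contour_derive_shift p is_ ti).
- by apply: C1_path_integrable => //; exact: C1_pathX.
Qed.

Lemma contour_fun_inv p : p \in inside_pts -> contour_fun (fun t => (gamma t - p)^-1) = 1.
Proof. by move=> /asboolP[_ h]. Qed.

(** [cintegral01_pow] for 1 / (gamma - p), whose derivative is - gamma' / (gamma - p)^2. *)
Lemma contour_fun_invn p n : p \in inside_pts -> contour_fun (fun t => (gamma t - p) ^- n.+2) = 0.
Proof.
move=> pp; have hp := C1_path_shift p; have hw := C1_path_inv pp.
have iw := C1_path_integrable (C1_pathX n hw) hw.
have e := cintegral01_pow s_path s_last n hw.
have := e; rewrite gamma_closed => /(_ erefl).
have iF : cintegrable s (fun t => (gamma t - p) ^- n.+2 * contour_derive gamma t).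
  have := C1_path_integrable (C1_pathX n.+2 hw) gamma_C1; congr cintegrable.
  by apply/funext => t; rewrite exprVn.
have i0 : cintegrable s (fun=> 0).
  have := C1_path_integrable (C1_path_cst s 0) gamma_C1; congr cintegrable; apply/funext => t.
  by rewrite mul0r.
rewrite (cintegral01_ext s_path s_last (K := fun t =>
  -1 * ((gamma t - p) ^- n.+2 * contour_derive gamma t) + 0) _ iw).
  rewrite (cintegral01_lin s_path s_last) // => h.
  have z0 : cintegral01 (fun _ : R => 0) = 0 :> C.
    have := cintegral01_lin s_path s_last (-1) i0 i0.
    have -> : (fun _ : R => -1 * 0 + 0) = (fun=> 0) :> (R -> C) by apply/funext => t; ring.
    by move=> e0; rewrite {1}e0 mulN1r addNr.
  move: h; rewrite z0 addr0 mulN1r => /eqP; rewrite oppr_eq0 => /eqP h.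
  by rewrite /contour_fun h mulr0.
move=> i t is_ ti.
have u0 r : r \in `[0, 1] -> gamma r - p != 0 by exact: inside_neq.
rewrite (contour_deriveV s_path s_last u0 hp is_ ti) (contour_derive_shift p is_ ti).
rewrite addr0 mulN1r -exprVn !exprS; ring.
Qed.

Variables (m : nat) (a b : 'I_m -> R) (f : {poly R}) (j0 : 'I_m).
Hypothesis gamma_b : forall j, winds_once_around gamma (b j)%:C.
Hypothesis gamma_0 : winds_once_around gamma 0.

Let iota : {rmorphism R -> C} := real_complex R.
Let F := symbol_value gamma iota a b f.
Let d := (size f).-1.

Let b_pts j : iota (b j) \in inside_pts. Proof. exact/asboolP/gamma_b. Qed.
Let zero_pts : 0 \in inside_pts. Proof. exact/asboolP. Qed.

Lemma laurent_coefE l : laurent_coef a b f gamma l = laurent gamma contour_fun 0 F l.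
Proof.
rewrite /laurent_coef /laurent; congr (_ * _); congr (_ +i* _); apply: eq_Rintegral =>
  t /[!inE] t01;
  by rewrite subr0 -opprD invr_expz.
Qed.

Let D t := t \in `[0, 1 : R].
Let A_lin := @C1_path_lin R s.
Let A_mul := @C1_pathM R s.
Let A_cst := @C1_path_cst R s.
Let L_neq p t (pp : p \in inside_pts) (Dt : D t) := inside_neq pp Dt.

Let vF : vanish gamma inside_pts (C1_path s) contour_fun d.+2 F :=
  vanish_symbol_value (D := D) A_lin A_mul A_cst gamma_C1 C1_path_inv contour_fun_lin
    contour_fun_ext L_neq contour_fun_inv contour_fun_invn a b_pts f.

Let pairing := laurent_pairing_center (D :=
  D) A_lin A_mul A_cst gamma_C1 C1_path_inv contour_fun_lin
    contour_fun_ext L_neq contour_fun_pow contour_fun_inv contour_fun_invn zero_pts (b_pts j0) vF.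

Let value := laurent_symbol_value (D := D) A_lin A_mul A_cst gamma_C1 C1_path_inv contour_fun_lin
    contour_fun_ext L_neq contour_fun_pow contour_fun_inv contour_fun_invn a j0 b_pts f.

Let zero_tail (l : nat) : (d < l)%N -> laurent_coef a b f gamma l%:Z = 0.
Proof.
move=> dl; rewrite laurent_coefE; apply: (laurent_band (D := D) contour_fun_ext zero_pts vF).
by rewrite ltnS.
Qed.

(** The coefficients of index larger than the degree of f vanish, so the partial sums are
    eventually constant. *)
Lemma laurent_coef_pairing_cvg :
  (fun N : nat => \sum_(1 <= l < N) l%:R * laurent_coef a b f gamma l%:Z
      * laurent_coef a b f gamma (- l%:Z) : R[i]^o) @ \oo -->
  ((\sum_(l < d) l.+1%:R * symbol_poly a b j0 f l.+1%:Z
    * symbol_poly a b j0 f (- l.+1%:Z))%:C : R[i]^o).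
Proof.
have e : (\sum_(l < d) l.+1%:R * symbol_poly a b j0 f l.+1%:Z
  * symbol_poly a b j0 f (- l.+1%:Z))%:C =
   \sum_(l < d) l.+1%:R * laurent_coef a b f gamma l.+1%:Z * laurent_coef a b f gamma (- l.+1%:Z).
  rewrite -[LHS]/(iota _) rmorph_sum /=.
  under [RHS]eq_bigr => l _ do rewrite !laurent_coefE.
  rewrite [RHS]pairing; apply: eq_bigr => l _.
  by rewrite !value !rmorphM; congr (_ * _ * _); exact: (rmorph_nat iota).
refine (cvg_eventually_cst (N := d.+1) _) => N dN; rewrite e.
apply: (sum_from1_trunc (G := fun l =>
  l%:R * laurent_coef a b f gamma l%:Z * laurent_coef a b f gamma (- l%:Z)) dN).
have mul_mid0 (K : pzRingType) (x y z : K) : y = 0 -> x * y * z = 0 by move=> ->;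
  rewrite mulr0 mul0r.
by move=> l dl; exact: (mul_mid0 _ _ _ _ (zero_tail dl)).
Qed.
End ContourFunctional.

(** * The central limit theorem *)

(** A direction in which the path grows linearly. *)
Lemma simplex_pos (R : realType) (m : nat) (nu : 'I_m -> R) : unit_simplex nu ->
  exists j, 0 < nu j.
Proof.
move=> [nu01 nu1]; apply/not_existsP => h.
suff s0 : \sum_(j < m) nu j <= 0 by move: s0; rewrite nu1 leNgt ltr01.
by apply: sumr_le0 => j _; rewrite leNgt; apply/negP; exact: h.
Qed.

(** The limit theorem with the variance expressed by the Toeplitz symbol. *)
Lemma mope_clt (R : realType) (m : nat)
    (mu : {sigma_finite_measure set R -> \bar R})
    (w : 'I_m -> R -> R)
    (w_meas : forall j, measurable_fun setT (w j))
    (w_ge0 : forall j x, 0 <= w j x)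
    (mus : 'I_m -> {measure set R -> \bar R})
    (musE : forall j (A : set R), measurable A ->
       mus j A = (\int[mu]_(x in A) (w j x)%:E)%E)
    (mus_mom : has_moments mus) (mus_perfect : perfect mus)
    (kk : nat -> multi_index m) (kk_norm : forall n, mi_norm (kk n) = n)
    (nu : 'I_m -> R)
    (kk_nu : forall j, (fun n => (kk n j)%:R / n%:R : R) @ \oo --> nu j)
    (d : nat -> measure_display) (Omega : forall n, measurableType (d n))
    (P : forall n, probability (Omega n) R)
    (X : forall n, {RV (P n) >-> n.-tuple R})
    (X_mope : forall n, is_mope mu w (kk n) (distribution (P n) (X n)))
    (a b : multi_index m -> 'I_m -> R) (ab_nn : nn_recurrence mus a b)
    (anu bnu : 'I_m -> R)
    (a_lim : forall j, directional_limit (a^~ j) nu (anu j))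
    (b_lim : forall j, directional_limit (b^~ j) nu (bnu j))
    (j0 : 'I_m) (nu_j0 : 0 < nu j0) (f : {poly R}) :
  let sigma2 := \sum_(l < (size f).-1)
    l.+1%:R * symbol_poly anu bnu j0 f l.+1%:Z * symbol_poly anu bnu j0 f (- l.+1%:Z) in
  let stat := fun n (o : Omega n) => linear_stat f (X n o) in
  0 <= sigma2 /\
  cvg_in_distribution P (fun n o => stat n o - fine ('E_(P n)[stat n])%E) (normal_law 0 sigma2).
Proof.
move=> sigma2 stat.
pose e n := path_basis mus kk j0 n.
have e_monic n i : e n i \is monic by exact: path_basis_monic.
have e_size n i : size (e n i) = i.+1 by exact: (size_path_basis mus_perfect kk_norm nu_j0).
have e_orth n r : (n <= r)%N -> mop_orthogonal mus (kk n) (e n r)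
  by exact: (path_basis_orth mus_perfect nu_j0).
pose tau n j := if j == 0%N then 0 else stat_gen (e n) n f j.
pose Y n (o : Omega n) := stat n o - fine ('E_(P n)[stat n])%E.
have /choice[y yP] n : exists y : nat -> R, (0 < n)%N ->
    [/\ y 0%N = 1, forall q, q.+1%:R * y q.+1 = \sum_(i < q.+1) y i * tau n (q - i)%N &
      forall q, has_integral (P n) (fun o => Y n o ^+ q) (y q * q`!%:R)].
  case: (posnP n) => [->|n0]; first by exists (fun=> 0).
  have [y [y0 yS yI]] := centered_stat_moments w_meas w_ge0 musE mus_mom (e_monic n) (e_size n)
    (kk_norm n) (e_orth n) (X_mope n) f n0.
  by exists y.
have tau_cvg k : tau n k.+1 @[n --> \oo] --> (if k == 0%N then sigma2 else 0).
  apply: (@riccati_gen_trace_cvg _ (size f).-1 (symbol_poly anu bnu j0 f) (fun n i j =>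
    mul_coord (e n) f i j)).
  - by move=> l; exact: symbol_poly_band.
  - by move=> n i j; exact: mul_coord_band.
  - by move=> s u v; exact: (mul_path_cvg mus_perfect ab_nn kk_norm kk_nu a_lim b_lim nu_j0).
have Mcvg q : y n q * q`!%:R @[n --> \oo] --> gaussian_moment sigma2 q.
  apply: (@moment_recursion_cvg _ 1 sigma2 y tau) => //.
  - by move=> n n0; have [] := yP n n0.
  - by move=> n k n0; have [_ h _] := yP n n0; exact: h.
have s0 : 0 <= sigma2.
  have := Mcvg 2%N; rewrite /= mul1r mulr1 => h.
  rewrite -(cvg_lim (@Rhausdorff R) h); apply: limr_ge; first exact: cvgP h.
  exists 1%N => // n /= n0; have [_ _ /(_ 2%N)[_ <-]] := yP n n0.
  by apply: Rintegral_ge0 => o _; exact: sqr_ge0.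
split => //; apply: (@moments_cvg_in_distribution _ _ _ _ Y (fun n q => y n q * q`!%:R)) => //.
- move=> n; apply: measurable_funB; last exact: measurable_cst.
  by apply: measurableT_comp; [exact: measurable_linear_stat|exact: measurable_funP].
- by move=> n q n0; have [_ _ h] := yP n n0; exact: h.
Qed.

Theorem theorem1p2 (R : realType) (m : nat)
    (mu : {sigma_finite_measure set R -> \bar R})
    (mu_supp : compact (msupport mu))
    (w : 'I_m -> R -> R)
    (w_meas : forall j, measurable_fun setT (w j))
    (w_ge0 : forall j x, 0 <= w j x)
    (mus : 'I_m -> {measure set R -> \bar R})
    (musE : forall j (A : set R), measurable A ->
       mus j A = (\int[mu]_(x in A) (w j x)%:E)%E)
    (mus_mom : has_moments mus)
    (mus_nevai : multiple_nevai mus)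
    (kk : nat -> multi_index m)
    (kk_norm : forall n, mi_norm (kk n) = n)
    (kk_step : forall n, exists j : 'I_m, kk n.+1 = mi_incr (kk n) j)
    (nu : 'I_m -> R) (nu_simplex : unit_simplex nu)
    (kk_nu : forall j, (fun n => (kk n j)%:R / n%:R : R) @ \oo --> nu j)
    (d : nat -> measure_display) (Omega : forall n, measurableType (d n))
    (P : forall n, probability (Omega n) R)
    (X : forall n, {RV (P n) >-> n.-tuple R})
    (X_mope : forall n, is_mope mu w (kk n) (distribution (P n) (X n)))
    (a b : multi_index m -> 'I_m -> R) (ab_nn : nn_recurrence mus a b)
    (anu bnu : 'I_m -> R)
    (a_lim : forall j, directional_limit (a^~ j) nu (anu j))
    (b_lim : forall j, directional_limit (b^~ j) nu (bnu j))
    (f : {poly R})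
    (gamma : R -> R[i]) (gamma_contour : simple_closed_contour gamma)
    (gamma_b : forall j, winds_once_around gamma (bnu j)%:C)
    (gamma_0 : winds_once_around gamma 0) :
  let stat := fun n (omega : Omega n) => \sum_(j < n) f.[tnth (X n omega) j] in
  let fhat := laurent_coef anu bnu f gamma in
  exists sigma2 : R,
    [/\ 0 <= sigma2,
        (fun N : nat =>
           \sum_(1 <= l < N) l%:R * fhat l%:Z * fhat (- l%:Z) : R[i]^o)
          @ \oo --> (sigma2%:C : R[i]^o) &
        cvg_in_distribution P
          (fun n omega => stat n omega - fine ('E_(P n)[stat n])%E)
          (normal_law 0 sigma2)].
Proof.
move=> stat fhat; have [mus_perfect _] := mus_nevai.
have [j0 nu_j0] := simplex_pos nu_simplex.
have [s0 clt] := mope_clt w_meas w_ge0 musE mus_mom mus_perfect kk_norm kk_nu X_mope ab_nn a_lim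
  b_lim nu_j0 f.
have [[s [s_path s_last sC]] g01 _] := gamma_contour.
have gamma_C1 : C1_path s gamma by split=> i is_; have [] := sC i is_.
eexists; split; [exact: s0| |exact: clt].
exact: (laurent_coef_pairing_cvg s_path s_last gamma_C1 g01 gamma_b gamma_0).
Qed.
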